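(* Let $\omega\in\mathbb{T}$. There exists a common hypercyclic vector for all composition operators $C_\varphi$ acting on $L^2(\mathbb{T})$, where $\varphi$ ranges over all $\varphi\in\mathrm{Aut}(\mathbb{D})$ admitting $\omega$ as attractive fixed point. Moreover, the set of these common hypercyclic vectors is a residual set in $L^2(\mathbb{T})$.
   Context: $\mathbb{D}$ is the open unit disk, $\mathbb{T}=\partial\mathbb{D}$, $\mathrm{Aut}(\mathbb{D})$ is the set of (holomorphic) automorphisms of $\mathbb{D}$, and $L^2(\mathbb{T})$ is taken with respect to normalized Lebesgue measure. Each $\varphi\in\mathrm{Aut}(\mathbb{D})$ extends to a homeomorphism of $\mathbb{T}$, and $C_\varphi(f)=f\circ\varphi$ is a continuous operator on $L^2(\mathbb{T})$. The automorphisms admitting $\omega\in\mathbb{T}$ as attractive fixed point are the parabolic ones whose single fixed point is $\omega$, and the hyperbolic ones (two fixed points, both on $\mathbb{T}$) for which $\omega$ is the attractive one, i.e. the iterates of $\varphi$ converge to $\omega$ on $\mathbb{D}$. A hypercyclic vector for a continuous linear operator $R$ on $X$ is an $x\in X$ such that $\{R^nx:\ n\geq1\}$ is dense in $X$; a common hypercyclic vector for a family of operators is a vector that is hypercyclic for each of them. ''Residual set'' means dense $G_\delta$ set. *)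

(* Defs.v *)
From HB Require Import structures.
From mathcomp Require Import all_boot all_order all_algebra.
From mathcomp Require Import all_classical all_reals all_analysis.
From mathcomp Require Import measurable_realfun borel_hierarchy.
From mathcomp Require Import complex.

Set Implicit Arguments.
Unset Strict Implicit.
Unset Printing Implicit Defensive.
Import Order.TTheory GRing.Theory Num.Theory.
Import numFieldNormedType.Exports.

Local Open Scope classical_set_scope.
Local Open Scope ring_scope.
Local Open Scope complex_scope.
Local Open Scope quotient_scope.

(* The complex plane as a normed space over itself, so that [derivable] means
   complex differentiable. *)
Notation plane R := (R[i]^o).

Definition disk (R : realType) : set (plane R) := [set z | `|z| < 1].
Arguments disk : clear implicits.

Definition unit_circle (R : realType) : set (plane R) := [set z | `|z| = 1].
Arguments unit_circle : clear implicits.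

Definition circle (R : realType) : Type := set_type (unit_circle R).

HB.instance Definition _ (R : realType) := Choice.on (circle R).
HB.instance Definition _ (R : realType) := SubType.on (circle R).
HB.instance Definition _ (R : realType) :=
  Topological.copy (circle R) (set_type (unit_circle R)).

Section circle_pointed.
Variable R : realType.

Lemma expi_in_circle (t : R) : ((cos t +i* sin t : plane R) \in unit_circle R).
Proof.
by rewrite inE /unit_circle /= normc_def /= cos2Dsin2 sqrtr1.
Qed.

Definition expi (t : R) : circle R :=
  Sub (cos t +i* sin t : plane R) (expi_in_circle t).

HB.instance Definition _ := isPointed.Build (circle R) (expi 0).

End circle_pointed.

Definition circle_open (R : realType) : set (set (circle R)) := open.

HB.instance Definition _ (R : realType) :=
  Measurable.copy (circle R) (g_sigma_algebraType (@circle_open R)).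

Definition borel_plane (R : realType) : Type :=
  g_sigma_algebraType (@open (plane R)).

HB.instance Definition _ (R : realType) := Measurable.on (borel_plane R).

Section measurability.
Variable R : realType.
Let normc := (@Normc.normc R).

Lemma near_plane (z : plane R) (e : R) : 0 < e ->
  \forall w \near z, normc (z - w) < e.
Proof.
move=> e0; apply/nbhs_ballP; exists e%:C; first by rewrite /= ltcR.
by move=> w; rewrite -ball_normE /= ltcR.
Qed.

Lemma continuous_Re : continuous (@complex.Re R : plane R -> R).
Proof.
move=> z; apply/(@cvgrPdist_lt _ _ _ _ (nbhs_filter z)) => e e0; near=> w.
apply: le_lt_trans (_ : normc (z - w) < e); last first.
  by near: w; exact: near_plane.
by rewrite -lecR; have := normc_ge_Re (z - w); case: (z) (w) => [a b] [c d].
Unshelve. all: by end_near. Qed.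

Lemma continuous_Im : continuous (@complex.Im R : plane R -> R).
Proof.
move=> z; apply/(@cvgrPdist_lt _ _ _ _ (nbhs_filter z)) => e e0; near=> w.
apply: le_lt_trans (_ : normc (z - w) < e); last first.
  by near: w; exact: near_plane.
case: (z) (w) => [a b] [c d] /=.
by rewrite -sqrtr_sqr ler_wsqrtr// lerDr sqr_ge0.
Unshelve. all: by end_near. Qed.

Lemma continuous_expi_plane :
  continuous (fun t : R => (cos t +i* sin t : plane R)).
Proof.
move=> t; apply/cvgrPdist_lt => -[e e'].
rewrite ltcE /= => /andP[/eqP -> e0].
have e20 : 0 < e / 2 by rewrite divr_gt0.
have /cvgrPdist_lt/(_ _ e20) Hc := @continuous_cos R t.
have /cvgrPdist_lt/(_ _ e20) Hs := @continuous_sin R t.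
near=> u; rewrite normc_def /= ltcR.
have c2 : `|cos t - cos u| < e / 2 by near: u.
have s2 : `|sin t - sin u| < e / 2 by near: u.
apply: le_lt_trans (_ : `|cos t - cos u| + `|sin t - sin u| < e); last first.
  by rewrite [ltRHS]splitr ltrD.
rewrite -[leRHS]ger0_norm ?addr_ge0// -[leRHS]sqrtr_sqr ler_wsqrtr//.
by rewrite [leRHS]sqrrD !real_normK ?num_real// addrAC lerDl mulrn_wge0// mulr_ge0.
Unshelve. all: by end_near. Qed.

Lemma continuous_expi : continuous (@expi R).
Proof.
apply/continuousP => _ [U oU <-].
by move/continuousP: continuous_expi_plane; exact.
Qed.

Lemma measurable_expi : measurable_fun setT (@expi R : measurableTypeR R -> _).
Proof.
apply: (measurability (@circle_open R)) => // _ [U oU <-].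
rewrite setTI; apply: open_measurable.
by move/continuousP: continuous_expi; exact.
Qed.

Lemma measurable_Re : measurable_fun setT (@complex.Re R : borel_plane R -> R).
Proof.
apply: (measurability _ (RGenOpens.measurableE R)) => _ [_ [a [b ->]] <-].
rewrite setTI; apply: sub_sigma_algebra.
by move/continuousP: continuous_Re; apply; exact: interval_open.
Qed.

Lemma measurable_Im : measurable_fun setT (@complex.Im R : borel_plane R -> R).
Proof.
apply: (measurability _ (RGenOpens.measurableE R)) => _ [_ [a [b ->]] <-].
rewrite setTI; apply: sub_sigma_algebra.
by move/continuousP: continuous_Im; apply; exact: interval_open.
Qed.

End measurability.

Section arc_measure.
Variable R : realType.

Let inv_2pi_ge0 : 0 <= (2 * pi)^-1 :> R.
Proof. by rewrite invr_ge0 mulr_ge0// pi_ge0. Qed.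

(* Normalized Lebesgue measure on the circle: the image under t |-> e^(it) of
   Lebesgue measure on [0, 2 pi[ divided by 2 pi. *)
Definition arc_measure : set (circle R) -> \bar R :=
  pushforward
    (mscale (NngNum inv_2pi_ge0)
       (mrestr lebesgue_measure (measurable_itv `[0, 2 * pi[)))
    (@expi R).

HB.instance Definition _ := Measure.copy arc_measure
  (@measure_function_pushforward__canonical__measure_function_Measure
     _ _ _ _ R _ _ (@measurable_expi R)).

Lemma arc_measureT : arc_measure setT = 1%E.
Proof.
rewrite /arc_measure /pushforward /mscale /= /mrestr.
rewrite [X in lebesgue_measure X](_ : _ = `[0%R, 2 * pi[%classic); last first.
  by apply/seteqP; split => [t []|].
rewrite lebesgue_measure_itv/= lte_fin mulr_gt0 ?pi_gt0// oppr0 adde0.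
by rewrite -EFinM mulVf// gt_eqF// mulr_gt0 ?pi_gt0.
Qed.

HB.instance Definition _ := Measure_isProbability.Build _ _ _
  arc_measure arc_measureT.

End arc_measure.

(* Complex-valued L2 space of the circle: classes modulo equality almost
   everywhere of Borel functions with finite L2 norm, with the distance given
   by the norm of the difference. *)
Section L2.
Variable R : realType.
Local Notation mu := (@arc_measure R).
Local Notation mfunT := {mfun circle R >-> borel_plane R}.
Local Notation mfunC := {mfun_ mu, circle R >-> borel_plane R}.

Definition L2norm (f : circle R -> plane R) : \bar R :=
  'N[mu]_2%:E[EFin \o (@Normc.normc R \o f)]%E.

Definition L2fin (f : mfunC) : bool := `[< (L2norm f < +oo)%E >].

Definition L2 : Type := {f : mfunC | L2fin f}.
HB.instance Definition _ := Choice.on L2.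
HB.instance Definition _ := SubType.on L2.

Definition fun_of_L2 (f : L2) : circle R -> plane R := \val f.
Coercion fun_of_L2 : L2 >-> Funclass.

Definition L2edist (f g : circle R -> plane R) : \bar R :=
  L2norm (fun z => f z - g z).

Definition L2dist (f g : L2) : R := fine (L2edist f g).

Lemma measurable_normcB (f g : mfunT) :
  measurable_fun setT (fun z => Normc.normc (f z - g z : plane R)).
Proof.
rewrite (_ : (fun _ => _) = Num.sqrt \o (fun z =>
  (complex.Re (f z) - complex.Re (g z)) ^+ 2 +
  (complex.Im (f z) - complex.Im (g z)) ^+ 2)); last first.
  by apply/funext => z /=; case: (f z) (g z) => [a b] [c d].
have mRe (h : mfunT) : measurable_fun setT (@complex.Re R \o h).
  by apply: measurableT_comp => //; exact: measurable_Re.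
have mIm (h : mfunT) : measurable_fun setT (@complex.Im R \o h).
  by apply: measurableT_comp => //; exact: measurable_Im.
apply: measurableT_comp.
  by apply: continuous_measurable_fun; exact: sqrt_continuous.
apply: measurable_funD; apply: measurable_funX; apply: measurable_funB.
- exact: mRe.
- exact: mRe.
- exact: mIm.
- exact: mIm.
Qed.

Lemma measurable_powR2 (u : circle R -> R) : measurable_fun setT u ->
  measurable_fun setT (fun z => (`|(u z)%:E| `^ 2)%E).
Proof.
move=> mu_; apply: (measurableT_comp (measurable_poweR _)).
by apply: measurableT_comp => //; exact/measurable_EFinP.
Qed.

Let normc_ge0 (w : plane R) : 0 <= Normc.normc w.
Proof. by case: w => a b /=; exact: sqrtr_ge0. Qed.

Lemma L2edist_triangle (g f h : mfunT) :
  (L2edist f h <= L2edist f g + L2edist g h)%E.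
Proof.
have mfh := measurable_normcB f h.
have mfg := measurable_normcB f g; have mgh := measurable_normcB g h.
set u := fun z => _ in mfg; set v := fun z => _ in mgh.
apply: le_trans (_ : 'N[mu]_2%:E[EFin \o (u \+ v)%R] <= _)%E; last first.
  by apply: (@eminkowski _ _ _ mu u v 2%:E) => //; rewrite lee_fin ler1n.
rewrite /L2edist /L2norm unlock /=; apply: gt0_ler_poweR; first by rewrite invr_ge0.
- by rewrite in_itv/= leey andbT integral_ge0// => z _; exact: poweR_ge0.
- by rewrite in_itv/= leey andbT integral_ge0// => z _; exact: poweR_ge0.
apply: ge0_le_integral => //.
- exact: measurable_powR2.
- by apply: measurable_powR2; exact: measurable_funD.
move=> z _ /=; rewrite lee_fin ge0_ler_powR ?nnegrE//.
rewrite !ger0_norm ?addr_ge0 ?normc_ge0//.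
rewrite /u /v; have -> : (f z - h z : plane R) = (f z - g z) + (g z - h z).
  by rewrite addrA subrK.
exact: le_normcD.
Qed.

Lemma L2edistC (f g : circle R -> plane R) : L2edist f g = L2edist g f.
Proof.
rewrite /L2edist /L2norm; apply: eq_Lnorm => z /=.
by rewrite -normcN opprB.
Qed.

Let L2_mfun (f : L2) : mfunT := repr (\val f).

Lemma L2norm_fin (f : mfunC) : L2fin f -> (L2norm f < +oo)%E.
Proof. by move/asboolP. Qed.

Lemma L2edist_fin (f g : L2) : L2edist f g \is a fin_num.
Proof.
rewrite ge0_fin_numE ?Lnorm_ge0//.
pose z0 : mfunT := cst (0 : plane R).
apply: le_lt_trans (@L2edist_triangle z0 (L2_mfun f) (L2_mfun g)) _.
rewrite [X in (_ + X)%E]L2edistC lte_add_pinfty//.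
- rewrite /L2edist; under eq_fun do rewrite subr0.
  exact/L2norm_fin/(valP f).
- rewrite /L2edist; under eq_fun do rewrite subr0.
  exact/L2norm_fin/(valP g).
Qed.

Lemma L2distxx (f : L2) : L2dist f f = 0.
Proof.
rewrite /L2dist /L2edist /L2norm (_ : _ \o _ = cst 0%E) ?Lnorm0//.
by apply/funext => z /=; rewrite subrr; congr EFin; exact: Normc.normc0.
Qed.

Lemma L2distC (f g : L2) : L2dist f g = L2dist g f.
Proof. by rewrite /L2dist L2edistC. Qed.

Lemma L2dist_triangle (g f h : L2) : L2dist f h <= L2dist f g + L2dist g h.
Proof.
rewrite /L2dist -fineD ?L2edist_fin// fine_le ?fin_numD ?L2edist_fin//.
exact: (@L2edist_triangle (L2_mfun g) (L2_mfun f) (L2_mfun h)).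
Qed.

Lemma L2dist_positivity (f g : L2) : L2dist f g = 0 -> f = g.
Proof.
move=> fg0; have : L2edist f g = 0%E.
  by rewrite -[LHS]fineK ?L2edist_fin//; congr EFin.
move=> /Lnorm_eq0_eq0 fg; apply: val_inj; apply/eqP.
rewrite -[val f]reprK -[val g]reprK eqmodE; apply/asboolP.
have : EFin \o (@Normc.normc R \o (fun z => f z - g z)) = \0%E %[ae mu].
  apply: fg => //; apply/measurable_EFinP.
  exact: (measurable_normcB (L2_mfun f) (L2_mfun g)).
apply: filterS => z /(_ I) /= [] /Normc.eq0_normc /eqP.
by rewrite subr_eq0 => /eqP.
Qed.

HB.instance Definition _ := isMetric.Build R L2
  L2distxx L2dist_positivity L2distC L2dist_triangle.

Lemma eq_L2norm_ae (f g : mfunT) : f = g %[ae mu] -> L2norm f = L2norm g.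
Proof.
move=> fg; rewrite /L2norm unlock /=; congr (_ `^ _)%E.
have mnormc (h : mfunT) : measurable_fun setT (@Normc.normc R \o h).
  have := measurable_normcB h (cst (0 : plane R)).
  by under eq_fun do rewrite subr0.
apply: ae_eq_integral => //.
- by apply: measurable_powR2; exact: mnormc.
- by apply: measurable_powR2; exact: mnormc.
by apply: filterS fg => z /[apply] /= ->.
Qed.

Lemma repr_pi_ae (f : mfunT) : repr (\pi_mfunC f) = f %[ae mu].
Proof.
by apply/asboolP; rewrite -[asbool _]/(ae_eq_op _ _ _) -eqmodE reprK.
Qed.

Lemma L2fin_pi (f : mfunT) : L2fin (\pi_mfunC f) = `[< (L2norm f < +oo)%E >].
Proof.
by rewrite /L2fin (eq_L2norm_ae (repr_pi_ae f)).
Qed.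

Lemma L2fin0 : L2fin (\pi_mfunC (cst (0 : plane R))).
Proof.
rewrite L2fin_pi; apply/asboolP.
rewrite /L2norm (_ : _ \o _ = cst 0%E) ?Lnorm0//.
by apply/funext => z /=; congr EFin; exact: Normc.normc0.
Qed.

HB.instance Definition _ := isPointed.Build L2 (Sub _ L2fin0).

(* The class in L2 of a square-integrable function; 0 on other functions. *)
Definition L2class (f : circle R -> plane R) : L2 :=
  insubd (point : L2) (\pi_mfunC (insubd (cst (0 : plane R) : mfunT) f)).

Lemma L2classE (f : circle R -> plane R) :
  measurable_fun setT (f : circle R -> borel_plane R) ->
  (L2norm f < +oo)%E -> L2class f = f %[ae mu].
Proof.
move=> mf finf; have mfP : (f : circle R -> borel_plane R) \in mfun.
  by rewrite inE.
pose g : mfunT := insubd (cst (0 : plane R) : mfunT) f.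
have gf : (g : circle R -> plane R) = f.
  exact: (insubdK (cst (0 : plane R) : mfunT) mfP).
rewrite /fun_of_L2 /L2class insubdK.
  by rewrite -[X in _ = X %[ae mu]]gf; exact: repr_pi_ae.
by rewrite -topredE /= L2fin_pi; apply/asboolP; rewrite -/g gf.
Qed.

End L2.

Section automorphisms.
Variable R : realType.
Implicit Types (phi : plane R -> plane R) (z : plane R) (omega : circle R).

(* Only the values of [phi] on the disk matter. *)
Definition holomorphic_self_map phi :=
  set_fun (disk R) (disk R) phi /\
  forall z, disk R z -> derivable phi z 1.

Definition disk_automorphism phi :=
  holomorphic_self_map phi /\
  exists psi, [/\ holomorphic_self_map psi,
    {in disk R, cancel phi psi} & {in disk R, cancel psi phi}].

(* Extension of [phi] to the closed disk: the values on the circle are the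
   limits from inside the disk, which exist when [phi] is an automorphism. *)
Definition disk_ext phi z : plane R :=
  if `|z| < 1 then phi z else lim (phi @ within (disk R) (nbhs z)).

(* Fixed points in the closed disk. *)
Definition fixed_points phi : set (plane R) :=
  [set z | `|z| <= 1 /\ disk_ext phi z = z].

(* The extension maps the circle to itself when [phi] is an automorphism, so the
   default value of [insubd] is then never used. *)
Definition circle_map phi (z : circle R) : circle R :=
  insubd z (disk_ext phi (\val z)).

Definition parabolic_at phi omega := fixed_points phi = [set \val omega].

Definition hyperbolic_attracted_to phi omega :=
  (exists2 omega' : circle R, omega' != omega &
     fixed_points phi = [set \val omega; \val omega']) /\
  (forall z, disk R z ->
     iter n phi z @[n --> \oo] --> (\val omega : plane R)).

Definition attractive_fixed_point phi omega :=
  parabolic_at phi omega \/ hyperbolic_attracted_to phi omega.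

(* For an automorphism, the boundary map and its inverse preserve null sets and
   composition with it preserves square-integrability, so the result depends
   neither on the representative of [f] nor on the default of [L2class]. *)
Definition composition_operator phi (f : L2 R) : L2 R :=
  L2class (f \o circle_map phi).

End automorphisms.

Definition hypercyclic (X : topologicalType) (T : X -> X) (x : X) :=
  dense [set iter n T x | n in [set n | (1 <= n)%N]].

Definition common_hypercyclic (X : topologicalType) (F : set (X -> X)) : set X :=
  [set x | forall T, F T -> hypercyclic T x].

Definition residual (X : topologicalType) (A : set X) := dense A /\ Gdelta A.

(* Main.v *)
Require Import Defs.
From HB Require Import structures.
From mathcomp Require Import all_boot all_order all_algebra.
From mathcomp Require Import all_classical all_reals all_analysis.
From mathcomp Require Import measurable_realfun borel_hierarchy.
From mathcomp Require Import complex ring lra.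

Set Implicit Arguments.
Unset Strict Implicit.
Unset Printing Implicit Defensive.
Import Order.TTheory GRing.Theory Num.Theory.
Import numFieldNormedType.Exports.

Local Open Scope classical_set_scope.
Local Open Scope ring_scope.

(* A Cayley transform sends [omega] to infinity and the rest of the circle to the
   line.  By the Schwarz lemma, the automorphisms with attractive fixed point
   [omega] become the maps [x |-> a x + b] with [a = 1], [b <> 0] (parabolic) or
   [1 < a] (hyperbolic).  By Baire's theorem it suffices that, for a compact set
   of parameters [la], a target [g] and [e > 0], the vectors [f] some iterate of
   which is within [e] of [g], for every [la], form an open dense set.  Openness
   is compactness together with joint continuity in [f] and [la].  For density,
   perturb a given vector far out on the line, in disjoint windows, the k-th of
   which carries a copy of [g] transported by the iterate of order [N k] at the
   k-th point of a grid of parameters.  This copy also serves the parameters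
   within [c / (N k)] of the grid point; the harmonic series being divergent,
   finitely many windows suffice for the whole compact set. *)

(** In the Cayley coordinate the arc measure is the Cauchy distribution: it is finite, so altering a
    bounded function far out costs little, and each affine map distorts it by a bounded factor,
    which makes the operators bounded. The grid steps are forced: an iterate of order [n] multiplies
    an error in the parameter (in its logarithm, for dilations) by [n], hence a tolerance of order
    [1 / n]. Orders growing linearly are enough to keep the windows disjoint, and this slow growth
    is what makes the tolerances sum to infinity. Dilations have a second parameter, their fixed
    point, but its error is not amplified once the copy is transported back, so small boxes around
    rational points suffice. Holomorphy enters as complex differentiability alone: what the Schwarz
    lemma takes from Cauchy's theory is the mean value property, obtained from the vanishing of a
    real flux over rectangles in the coordinates [(ln |z|, arg z)]. *)

(** * Integrals of continuous functions over segments *)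

Section segment_integral.
Context {R : realType}.
Implicit Types (f : R -> R) (a b c k e : R).
Local Notation mu := (@lebesgue_measure R).

Definition segint f a b : R := \int[mu]_(x in `[a, b]) f x.

Lemma segint_integrable f a b : {within `[a, b], continuous f} ->
  mu.-integrable `[a, b] (EFin \o f).
Proof. by move=> cf; apply: continuous_compact_integrable => //; exact: segment_compact. Qed.

Lemma segint_split f a b c : a <= b -> b <= c ->
  {within `[a, c], continuous f} ->
  segint f a c = segint f a b + segint f b c.
Proof.
move=> ab bc cf; have itf := segint_integrable cf.
rewrite /segint -(@Rintegral_itv_obnd_cbnd _ b); last first.
  apply: integrableS itf => //=.
  by apply: subset_itvr; rewrite bnd_simp.
rewrite -(@Rintegral_itvB _ f (BLeft a) (BRight c) b) ?bnd_simp//.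
by rewrite addrC subrK.
Qed.

Lemma segint_near_cst f a b k e : a <= b -> {within `[a, b], continuous f} ->
  (forall x, a <= x <= b -> `|f x - k| <= e) ->
  `|segint f a b - k * (b - a)| <= e * (b - a).
Proof.
move=> ab cf fk; have itf := segint_integrable cf.
have len : fine (mu `[a, b]%classic) = b - a.
  rewrite lebesgue_measure_itv /= lte_fin; case: ltgtP ab => //= ->.
  by rewrite subrr.
have cst_int r : mu.-integrable `[a, b] (EFin \o cst r).
  by apply: segint_integrable => x; exact: cst_continuous.
have seg_cst r : \int[mu]_(x in `[a, b]) r = r * (b - a).
  by rewrite Rintegral_cst// len.
have le1 : segint f a b <= (k + e) * (b - a).
  rewrite -seg_cst; apply: le_Rintegral => //; first exact: (cst_int (k + e)).
  by move=> x; rewrite /= in_itv /= => /fk; rewrite ler_norml => /andP[_]; lra.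
have le2 : (k - e) * (b - a) <= segint f a b.
  rewrite -seg_cst; apply: le_Rintegral => //; first exact: (cst_int (k - e)).
  by move=> x; rewrite /= in_itv /= => /fk; rewrite ler_norml => /andP[+ _]; lra.
by rewrite ler_norml; lra.
Qed.

Lemma segint_le_cst f a b M : a <= b -> {within `[a, b], continuous f} ->
  (forall x, a <= x <= b -> f x <= M) -> segint f a b <= M * (b - a).
Proof.
move=> ab cf fM; have itf := segint_integrable cf.
have len : fine (mu `[a, b]%classic) = b - a.
  rewrite lebesgue_measure_itv /= lte_fin; case: ltgtP ab => //= ->.
  by rewrite subrr.
have -> : M * (b - a) = \int[mu]_(x in `[a, b]) M by rewrite Rintegral_cst// len.
apply: le_Rintegral => //.
by apply: (@segint_integrable (cst M)) => x; exact: cst_continuous.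
Qed.

(** If [f t < M], continuity keeps [f] below the midpoint of [f t] and [M] on a piece of positive
    length, and the integral falls short. The piece is clipped to the segment because [t] may be an
    endpoint. *)
Lemma segint_eq_max f a b M t : a < b -> {within `[a, b], continuous f} ->
  (forall x, a <= x <= b -> f x <= M) -> a <= t <= b ->
  (forall e, 0 < e -> exists2 d : R, 0 < d & forall x, `|x - t| < d -> `|f x - f t| < e) ->
  segint f a b = M * (b - a) -> f t = M.
Proof.
move=> ab cf fM /andP[at_ tb] ct fE; apply/eqP; rewrite eq_le fM ?at_//=.
rewrite leNgt; apply/negP => ftM.
have [d d0 Hd] := ct ((M - f t) / 2) ltac:(by rewrite divr_gt0// subr_gt0).
pose x1 := Num.max a (t - d / 2); pose x2 := Num.min b (t + d / 2).
have ax1 : a <= x1 by rewrite le_max lexx.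
have x2b : x2 <= b by rewrite ge_min lexx.
have x1d : t - d / 2 <= x1 by rewrite le_max lexx orbT.
have x2d : x2 <= t + d / 2 by rewrite ge_min lexx orbT.
have x12 : x1 < x2.
  by rewrite gt_max !lt_min ab /=; apply/and3P; split; lra.
have sub c e : a <= c -> e <= b -> {within `[c, e], continuous f}.
  move=> ac eb; apply: continuous_subspaceW cf.
  by apply: subset_itv; rewrite bnd_simp.
move: fE; rewrite (@segint_split _ a x1 b)//; last lra.
rewrite (@segint_split _ x1 x2 b)//; [|lra|exact: sub].
have s1 : segint f a x1 <= M * (x1 - a).
  by apply: segint_le_cst => //; [apply: sub => //; lra|move=> x ?; apply: fM; lra].
have s2 : segint f x2 b <= M * (b - x2).
  by apply: segint_le_cst => //; [apply: sub => //; lra|move=> x ?; apply: fM; lra].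
have s3 : segint f x1 x2 <= (M + f t) / 2 * (x2 - x1).
  apply: segint_le_cst; [exact: ltW|exact: sub|move=> x /andP[? ?]].
  have := Hd x; rewrite ltr_norml => /(_ ltac:(lra)).
  by rewrite ltr_norml; lra.
nra.
Qed.

End segment_integral.

(** * Goursat's argument for divergence-free plane fields *)

Section divergence.
Context {R : realType}.
Implicit Types (u v : R -> R -> R) (x y w h : R).

(** Real differentiability at [(x, y)] with partial derivatives [A] and [B]. *)
Definition near_linear u x y A B := forall e : R, 0 < e ->
  exists2 d : R, 0 < d & forall x' y', `|x' - x| < d -> `|y' - y| < d ->
    `|u x' y' - (u x y + A * (x' - x) + B * (y' - y))| <=
      e * (`|x' - x| + `|y' - y|).

(** The shared [A] says that [u_x = v_y], that is, the field [(u, - v)] has zero divergence at the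
    point. *)
Definition divergence_free u v x y :=
  exists A B C, near_linear u x y A B /\ near_linear v x y C A.

Lemma near_linear_cts u x y A B : near_linear u x y A B ->
  forall e : R, 0 < e -> exists2 d : R, 0 < d & forall x' y',
    `|x' - x| < d -> `|y' - y| < d -> `|u x' y' - u x y| < e.
Proof.
move=> + e e0 => /(_ 1 ltr01) [d d0 H].
pose M := `|A| + `|B| + 2.
have M0 : 0 < M by rewrite /M ltr_wpDl// addr_ge0.
exists (Num.min d (e / (2 * M))); first by rewrite lt_min d0 divr_gt0// mulr_gt0.
move=> x' y'; rewrite !lt_min => /andP[xd xe] /andP[yd ye].
have := H _ _ xd yd; set q := u x' y'; set p := u x y => Hq.
have -> : q - p = (q - (p + A * (x' - x) + B * (y' - y))) +
   (A * (x' - x) + B * (y' - y)) by ring.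
apply: le_lt_trans (ler_normD _ _) _.
apply: le_lt_trans (lerD Hq (ler_normD _ _)) _.
rewrite !normrM; move: xe ye; rewrite !ltr_pdivlMr ?mulr_gt0// /M.
have := normr_ge0 A; have := normr_ge0 B.
have := normr_ge0 (x' - x); have := normr_ge0 (y' - y).
set s := `|x' - x|; set t := `|y' - y|; set a := `|A|; set b := `|B|.
by move=> *; nra.
Qed.

(** Outward flux of the field [(u, - v)] through the boundary of the rectangle with lower left
    corner [(x, y)] and sides [w], [h]. *)
Definition flux u v x y w h :=
  (segint (u (x + w)) y (y + h) - segint (u x) y (y + h)) -
  (segint (v ^~ (y + h)) x (x + w) - segint (v ^~ y) x (x + w)).

Variables (u v : R -> R -> R) (b : R).
Hypothesis uv : forall x y, x < b -> divergence_free u v x y.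

Lemma ctsu x y1 y2 : x < b -> {within `[y1, y2], continuous (u x)}.
Proof.
move=> xb; apply: continuous_subspaceT => y.
have [A [B [C [nu _]]]] := uv y xb.
apply/cvgrPdist_lt => e e0; have [d d0 H] := near_linear_cts nu e0.
near=> z; rewrite distrC; apply: H; first by rewrite subrr normr0.
by rewrite distrC; near: z; apply/nbhs_ballP; exists d.
Unshelve. all: by end_near. Qed.

Lemma ctsv x1 x2 y : x2 < b -> {within `[x1, x2], continuous (v ^~ y)}.
Proof.
move=> xb; apply/continuous_in_subspaceT => x; rewrite inE /= in_itv /= => /andP[_ xx].
have [A [B [C [_ nv]]]] := uv y (le_lt_trans xx xb).
apply/cvgrPdist_lt => e e0; have [d d0 H] := near_linear_cts nv e0.
near=> z; rewrite distrC; apply: H; last by rewrite subrr normr0.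
by rewrite distrC; near: z; apply/nbhs_ballP; exists d.
Unshelve. all: by end_near. Qed.

Lemma flux_quarter x y w h : 0 < w -> 0 < h -> x + w < b ->
  flux u v x y w h =
  (flux u v x y (w / 2) (h / 2) + flux u v (x + w / 2) y (w / 2) (h / 2)) +
  (flux u v x (y + h / 2) (w / 2) (h / 2) +
   flux u v (x + w / 2) (y + h / 2) (w / 2) (h / 2)).
Proof.
move=> w0 h0 xw; rewrite /flux.
have -> : x + w / 2 + w / 2 = x + w by field.
have -> : y + h / 2 + h / 2 = y + h by field.
have xb : x < b by rewrite (lt_trans _ xw)// ltrDl.
have yh : y <= y + h / 2 /\ y + h / 2 <= y + h by split; lra.
have xw' : x <= x + w / 2 /\ x + w / 2 <= x + w by split; lra.
rewrite (segint_split yh.1 yh.2 (@ctsu (x + w) _ _ xw)).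
rewrite (segint_split yh.1 yh.2 (@ctsu x _ _ xb)).
rewrite (segint_split xw'.1 xw'.2 (@ctsv _ _ (y + h) xw)).
rewrite (segint_split xw'.1 xw'.2 (@ctsv _ _ y xw)).
ring.
Qed.

(** The first-order parts contribute [A * w * h] to each of the two differences of opposite sides
    and cancel; what remains is the error of differentiability, integrated over the sides. *)
Lemma flux_small x y : x < b -> forall e : R, 0 < e ->
  exists2 d : R, 0 < d & forall x0 y0 w h, 0 < w -> 0 < h -> w < d -> h < d ->
    x0 <= x <= x0 + w -> y0 <= y <= y0 + h -> x0 + w < b ->
    `|flux u v x0 y0 w h| <= e * (w + h) ^+ 2.
Proof.
move=> xb e e0; have [A [B [C [nu nv]]]] := uv y xb.
have e2 : 0 < e / 4 by rewrite divr_gt0.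
have [d1 d10 H1] := nu _ e2; have [d2 d20 H2] := nv _ e2.
exists (Num.min d1 d2); first by rewrite lt_min d10.
move=> x0 y0 w h w0 h0; rewrite !lt_min => /andP[wd1 wd2] /andP[hd1 hd2].
move=> /andP[x1 x2] /andP[y1 y2] xwb.
have bx x' : x0 <= x' <= x0 + w -> `|x' - x| <= w.
  by move=> /andP[? ?]; rewrite ler_norml; lra.
have bY y' : y0 <= y' <= y0 + h -> `|y' - y| <= h.
  by move=> /andP[? ?]; rewrite ler_norml; lra.
have x0b : x0 < b by rewrite (lt_trans _ xwb)// ltrDl.
pose r := e / 4 * (w + h).
have U x' y' : x0 <= x' <= x0 + w -> y0 <= y' <= y0 + h ->
    `|u x' y' - (u x y + A * (x' - x) + B * (y' - y))| <= r.
  move=> hx hy; apply: le_trans (H1 _ _ _ _) _.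
  - exact: le_lt_trans (bx _ hx) wd1.
  - exact: le_lt_trans (bY _ hy) hd1.
  by rewrite /r ler_pM2l// lerD ?bx ?bY.
have V x' y' : x0 <= x' <= x0 + w -> y0 <= y' <= y0 + h ->
    `|v x' y' - (v x y + C * (x' - x) + A * (y' - y))| <= r.
  move=> hx hy; apply: le_trans (H2 _ _ _ _) _.
  - exact: le_lt_trans (bx _ hx) wd2.
  - exact: le_lt_trans (bY _ hy) hd2.
  by rewrite /r ler_pM2l// lerD ?bx ?bY.
(* Subtracting the linear function [B (y' - y)], resp. [C (x' - x)], from both
   opposite sides makes all four integrands nearly constant. *)
have ends : x0 <= x0 <= x0 + w /\ x0 <= x0 + w <= x0 + w.
  by clear -w0; split; apply/andP; split; lra.
have endsy : y0 <= y0 <= y0 + h /\ y0 <= y0 + h <= y0 + h.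
  by clear -h0; split; apply/andP; split; lra.
have itu x' : x' < b -> lebesgue_measure.-integrable `[y0, y0 + h] (EFin \o u x').
  by move=> ?; apply/segint_integrable/ctsu.
have itv y' : lebesgue_measure.-integrable `[x0, x0 + w] (EFin \o v ^~ y').
  by apply/segint_integrable/ctsv.
have Eu : segint (u (x0 + w)) y0 (y0 + h) - segint (u x0) y0 (y0 + h) =
    segint (fun t => u (x0 + w) t - u x0 t) y0 (y0 + h).
  by rewrite /segint RintegralB//; exact: itu.
have Ev : segint (v ^~ (y0 + h)) x0 (x0 + w) - segint (v ^~ y0) x0 (x0 + w) =
    segint (fun t => v t (y0 + h) - v t y0) x0 (x0 + w).
  by rewrite /segint RintegralB//; exact: itv.
have Su : `|segint (fun t => u (x0 + w) t - u x0 t) y0 (y0 + h) -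
    (A * w) * (y0 + h - y0)| <= (2 * r) * (y0 + h - y0).
  apply: segint_near_cst; first lra.
    by move=> t; apply: cvgB; exact: ctsu.
  move=> t ht; have := U _ _ ends.2 ht; have := U _ _ ends.1 ht.
  by rewrite !ler_norml; lra.
have Sv : `|segint (fun t => v t (y0 + h) - v t y0) x0 (x0 + w) -
    (A * h) * (x0 + w - x0)| <= (2 * r) * (x0 + w - x0).
  apply: segint_near_cst; first lra.
    by move=> t; apply: cvgB; exact: ctsv.
  move=> t ht; have := V _ _ ht endsy.2; have := V _ _ ht endsy.1.
  by rewrite !ler_norml; lra.
rewrite /flux Eu Ev; move: Su Sv.
have -> : y0 + h - y0 = h by ring.
have -> : x0 + w - x0 = w by ring.
rewrite /r !ler_norml; move: (segint _ _ _) (segint _ _ _) => p q.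
by clear -w0 h0 e0 => /andP[? ?] /andP[? ?]; apply/andP; split; nra.
Qed.

Lemma flux_bisect x y w h k : 0 < w -> 0 < h -> x + w < b ->
  k * (w * h) <= `|flux u v x y w h| ->
  exists x' y', [/\ x' = x \/ x' = x + w / 2, y' = y \/ y' = y + h / 2 &
    k * (w / 2 * (h / 2)) <= `|flux u v x' y' (w / 2) (h / 2)|].
Proof.
move=> w0 h0 xw; rewrite flux_quarter//; set q1 := flux _ _ x y _ _.
set q2 := flux _ _ (x + w / 2) y _ _; set q3 := flux _ _ x (y + h / 2) _ _.
set q4 := flux _ _ (x + w / 2) (y + h / 2) _ _ => H.
set m := k * (w / 2 * (h / 2)).
have [l1|l1] := leP m `|q1|; first by exists x, y; split; [left|left|].
have [l2|l2] := leP m `|q2|; first by exists (x + w / 2), y; split; [right|left|].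
have [l3|l3] := leP m `|q3|; first by exists x, (y + h / 2); split; [left|right|].
have [l4|l4] := leP m `|q4|.
  by exists (x + w / 2), (y + h / 2); split; [right|right|].
move: H; rewrite leNgt => /negP[].
have -> : k * (w * h) = (m + m) + (m + m) by rewrite /m; field.
by do 2 (apply: le_lt_trans (ler_normD _ _) _; apply: ltrD).
Qed.

(** If the flux were nonzero, repeated quartering would yield nested rectangles whose flux stays at
    least [k] times their area, against [flux_small] at their common point. *)
Lemma flux_eq0 x y w h : 0 < w -> 0 < h -> x + w < b -> flux u v x y w h = 0.
Proof.
move=> w0 h0 xw; apply/eqP/contraT => nz.
pose k := `|flux u v x y w h| / (w * h).
have wh0 : 0 < w * h by rewrite mulr_gt0.
have k0 : 0 < k by rewrite divr_gt0// normr_gt0.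
pose W n := w / 2 ^+ n; pose H n := h / 2 ^+ n.
have W0 n : 0 < W n by rewrite divr_gt0// exprn_gt0.
have H0 n : 0 < H n by rewrite divr_gt0// exprn_gt0.
have WS n : W n.+1 = W n / 2 by rewrite /W exprSr invfM mulrA.
have HS n : H n.+1 = H n / 2 by rewrite /H exprSr invfM mulrA.
pose good n (p : R * R) := p.1 + W n < b /\
  k * (W n * H n) <= `|flux u v p.1 p.2 (W n) (H n)|.
pose next n (p q : R * R) := [/\ good n.+1 q, p.1 <= q.1,
  q.1 + W n.+1 <= p.1 + W n, p.2 <= q.2 & q.2 + H n.+1 <= p.2 + H n].
have /choice[f Hf] (np : nat * (R * R)) :
    exists q, good np.1 np.2 -> next np.1 np.2 q.
  case: np => n [p1 p2] /=; have [[/= g1 g2]|ng] := pselect (good n (p1, p2)); last first.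
    by exists (p1, p2).
  have [q1 [q2 [e1 e2 B]]] := flux_bisect (W0 n) (H0 n) g1 g2.
  exists (q1, q2) => _; rewrite /next /good /= !WS !HS.
  have Wn := W0 n; have Hn := H0 n.
  by case: e1 e2 => -> [] -> in B *; repeat split => //; clear -Wn Hn g1; lra.
pose fix s n := if n is m.+1 then f (m, s m) else (x, y).
have gs n : good n (s n).
  elim: n => [|n /(Hf (n, _))[] //].
  rewrite /good /= /W /H expr0 !divr1; split => //.
  by rewrite /k divfK// gt_eqF.
have ns n : next n (s n) (s n.+1) by exact: (Hf (n, s n)).
have lim (g : R * R -> R) (L : nat -> R) : (forall n, 0 < L n) ->
    (forall n, g (s n) <= g (s n.+1) /\ g (s n.+1) + L n.+1 <= g (s n) + L n) ->
    exists z, forall n, g (s n) <= z <= g (s n) + L n.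
  move=> L0 gL; have mono : nondecreasing_seq (g \o s).
    by apply/nondecreasing_seqP => n; have [] := gL n.
  have anti : nonincreasing_seq (fun n => g (s n) + L n).
    by apply/nonincreasing_seqP => n; have [] := gL n.
  have ub n : ubound (range (g \o s)) (g (s n) + L n).
    move=> _ [m _ <-] /=; apply: le_trans (mono _ _ (leq_maxl m n)) _.
    apply: le_trans (anti _ _ (leq_maxr m n)).
    by rewrite /= lerDl ltW.
  exists (sup (range (g \o s))) => n; apply/andP; split.
    apply: ub_le_sup; last by exists n.
    by exists (g (s 0%N) + L 0%N).
  apply: ge_sup; last exact: ub.
  by exists (g (s 0%N)); exists 0%N.
have [x1 Hx1] : exists z, forall n, (s n).1 <= z <= (s n).1 + W n.
  by apply: (lim fst W) => // n; have [] := ns n.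
have [y1 Hy1] : exists z, forall n, (s n).2 <= z <= (s n).2 + H n.
  by apply: (lim snd H) => // n; have [] := ns n.
have x1b : x1 < b.
  have /andP[_] := Hx1 0%N; move/le_lt_trans; apply.
  by rewrite /= /W expr0 divr1.
(* Quartering keeps the ratio of the sides, so [(W n + H n) ^+ 2] is a fixed multiple of
   [W n * H n]; with this [e], the bound of [flux_small] is half the lower bound carried by
   [good]. *)
pose e := k * (w * h) / (w + h) ^+ 2 / 2.
have wph : 0 < w + h by rewrite addr_gt0.
have e0 : 0 < e by rewrite !divr_gt0 ?exprn_gt0// mulr_gt0.
have [d d0 Hd] := flux_small y1 x1b e0.
have [n nd] : exists n, (w + h) / 2 ^+ n < d.
  exists (Num.truncn ((w + h) / d)).+1.
  rewrite ltr_pdivrMr ?exprn_gt0// mulrC -ltr_pdivrMr//.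
  apply: lt_le_trans (truncnS_gt _) _.
  by rewrite -natrX ler_nat ltnW// ltn_expl.
have WHd : W n < d /\ H n < d.
  move: nd (W0 n) (H0 n); rewrite /W /H mulrDl; lra.
have := Hd _ _ _ _ (W0 n) (H0 n) WHd.1 WHd.2 (Hx1 n) (Hy1 n) (gs n).1.
rewrite leNgt => /negP[]; apply: lt_le_trans (gs n).2.
have -> : W n + H n = (w + h) / 2 ^+ n by rewrite /W /H mulrDl.
have -> : e * ((w + h) / 2 ^+ n) ^+ 2 = k * (W n * H n) / 2.
  by rewrite /e /W /H; field; rewrite ?expf_neq0 ?gt_eqF.
have kWH : 0 < k * (W n * H n) by rewrite (mulr_gt0 k0)// (mulr_gt0 (W0 n) (H0 n)).
by rewrite ltr_pdivrMr// ltr_pMr// ltr1n.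
Qed.

End divergence.

(** * Complex differentiability and the complex exponential *)

Section complex_derivative.
Context {R : realType}.
Local Notation C := (plane R).
Local Notation nc := (@Normc.normc R).
Implicit Types (z w : C) (x y : R).

Lemma normcE z : `|z| = (nc z)%:C%C. Proof. by case: z. Qed.

Lemma normc_ge0 z : 0 <= nc z.
Proof. by case: z => a b; exact: sqrtr_ge0. Qed.

Lemma normcB z w : nc (z - w) = nc (w - z).
Proof. by rewrite -normcN opprB. Qed.

Lemma normc_gt0 z : (0 < nc z) = (z != 0).
Proof.
rewrite lt_def normc_ge0 andbT; congr (~~ _); apply/eqP/eqP => [/Normc.eq0_normc//|->].
exact: Normc.normc0.
Qed.

Lemma normcX z n : nc (z ^+ n) = nc z ^+ n.
Proof.
elim: n => [|n IH]; first by rewrite !expr0 Normc.normc1.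
by rewrite !exprS Normc.normcM IH.
Qed.

Lemma normc_real x : nc x%:C%C = `|x|.
Proof. by rewrite /= expr0n addr0 sqrtr_sqr. Qed.

Lemma normc_le_Re_Im z : nc z <= `|complex.Re z| + `|complex.Im z|.
Proof.
case: z => a b /=; rewrite -[leRHS]ger0_norm ?addr_ge0// -[leRHS]sqrtr_sqr.
by rewrite ler_wsqrtr// sqrrD !real_normK ?num_real// addrAC lerDl mulrn_wge0 ?mulr_ge0.
Qed.

Lemma normr_Re_le z : `|complex.Re z| <= nc z.
Proof. by case: z => a b /=; rewrite -sqrtr_sqr ler_wsqrtr// lerDl sqr_ge0. Qed.

Lemma normr_Im_le z : `|complex.Im z| <= nc z.
Proof. by case: z => a b /=; rewrite -sqrtr_sqr ler_wsqrtr// lerDr sqr_ge0. Qed.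

Lemma derivable_littleo (K : numFieldType) (f : K^o -> K^o) (x : K) :
  derivable f x 1 -> forall e : K, 0 < e ->
    exists2 d : K, 0 < d & forall y : K, `|y - x| < d ->
      `|f y - f x - 'D_1 f x * (y - x)| <= e * `|y - x|.
Proof.
move=> + e e0; rewrite /derivable -/('D_1 f x) => /cvgrPdist_le/(_ _ e0)[d /= d0 Hd].
exists d => // y yd; have [->|yx] := eqVneq y x.
  by rewrite !subrr mulr0 subr0 normr0 mulr0.
have yx0 : y - x != 0 by rewrite subr_eq0.
have := Hd (y - x); rewrite /= sub0r normrN => /(_ yd yx0).
rewrite /= /shift /= !scaler1 subrK.
have -> : 'D_1 f x - (y - x)^-1 *: (f y - f x) = - (f y - f x - 'D_1 f x * (y - x)) / (y - x).
  by rewrite /GRing.scale /=; field.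
by rewrite normrM normrN normfV ler_pdivrMr// normr_gt0.
Qed.

Lemma derivable_littleoC (f : C -> C) z :
  derivable f z 1 -> exists D : C, forall e : R, 0 < e ->
    exists2 d : R, 0 < d & forall w, nc (w - z) < d ->
      nc (f w - f z - D * (w - z)) <= e * nc (w - z).
Proof.
move=> df; exists ('D_1 f z) => e e0.
have [|d d0 Hd] := derivable_littleo df (e := e%:C%C); first by rewrite ltcR.
move: d0; rewrite ltcE /= => /andP[/eqP d0 dp].
exists (complex.Re d) => // w wz.
have := Hd w; rewrite !normcE ltcE /= d0 eqxx wz => /(_ isT).
by rewrite -(rmorphM (real_complex R)) lecR.
Qed.

Lemma derivable_ctsC (f : C -> C) z : derivable f z 1 ->
  forall e : R, 0 < e -> exists2 d : R, 0 < d & forall w, nc (w - z) < d ->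
      nc (f w - f z) < e.
Proof.
move=> /derivable_littleoC[D HD] e e0.
have [d d0 Hd] := HD _ ltr01.
have M0 : 0 < nc D + 1 by rewrite ltr_wpDl// normc_ge0.
exists (Num.min d (e / (nc D + 1))); first by rewrite lt_min d0 divr_gt0.
move=> w; rewrite lt_min => /andP[wd we].
have -> : f w - f z = (f w - f z - D * (w - z)) + D * (w - z) by rewrite subrK.
apply: le_lt_trans (le_normcD _ _) _.
apply: le_lt_trans (lerD (Hd _ wd) (lexx _)) _; rewrite Normc.normcM -mulrDl [1 + _]addrC -ltr_pdivlMl//.
by rewrite mulrC.
Qed.

(* [E s t] is the complex exponential of [s + it]. *)
Definition E (s t : R) : C := (expR s * cos t +i* (expR s * sin t))%C.

Lemma E_add s t h k : E (s + h) (t + k) = E s t * E h k.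
Proof.
rewrite /E expRD cosD sinD; apply/eqP; rewrite eq_complex /=.
by apply/andP; split; apply/eqP; ring.
Qed.

Lemma normcE_E s t : nc (E s t) = expR s.
Proof.
by rewrite /E /= !exprMn -mulrDr cos2Dsin2 mulr1 sqrtr_sqr ger0_norm ?expR_ge0.
Qed.

Lemma E_littleo e : 0 < e -> exists2 d : R, 0 < d & forall h k,
  `|h| < d -> `|k| < d ->
  nc (E h k - 1 - (h +i* k)%C) <= e * (`|h| + `|k|).
Proof.
(* The real and imaginary parts leave together at most [e1 * |h| + 7 * e1 * |k|], hence the 8. *)
move=> e0; have [e1 [e10 e11 e18]] : exists e1 : R, [/\ 0 < e1, e1 <= 1 & e1 <= e / 8].
  exists (Num.min (e / 8) 1).
  by rewrite lt_min divr_gt0// ltr01 !ge_min !lexx orbT.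
have der (f : R -> R) D : is_derive (0 : R) (1 : R) f D -> exists2 d : R, 0 < d &
    forall y, `|y| < d -> `|f y - f 0 - D * y| <= e1 * `|y|.
  move=> Df; have [d d0 H] := derivable_littleo (@ex_derive _ _ _ _ _ _ _ Df) e10.
  by exists d => // y; have := H y; rewrite subr0 derive_val.
have De : is_derive (0 : R) (1 : R) expR 1.
  by rewrite -[X in is_derive _ _ _ X](expR0 R); exact: is_derive_expR.
have Dc : is_derive (0 : R) (1 : R) cos 0.
  by rewrite -[X in is_derive _ _ _ X]oppr0 -[X in - X](sin0 R); exact: is_derive_cos.
have Ds : is_derive (0 : R) (1 : R) sin 1.
  by rewrite -[X in is_derive _ _ _ X](cos0 R); exact: is_derive_sin.
have [d1 d10 H1] := der expR 1 De; have [d2 d20 H2] := der cos 0 Dc.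
have [d3 d30 H3] := der sin 1 Ds.
exists (Num.min (Num.min d1 d2) (Num.min d3 e1)).
  by rewrite !lt_min d10 d20 d30 e10.
move=> h k; rewrite !lt_min => /andP[/andP[h1 h2] /andP[h3 he]].
move=> /andP[/andP[k1 k2] /andP[k3 ke]].
apply: le_trans (normc_le_Re_Im _) _.
have := H1 _ h1; have := H2 _ k2; have := H3 _ k3.
rewrite expR0 cos0 sin0 mul0r !mul1r !subr0 => S K X.
have X1 : `|expR h - 1| <= 2 * `|h|.
  have -> : expR h - 1 = (expR h - 1 - h) + h by rewrite subrK.
  apply: le_trans (ler_normD _ _) _; have := normr_ge0 h; nra.
have S1 : `|sin k| <= 2 * `|k|.
  have -> : sin k = (sin k - k) + k by rewrite subrK.
  apply: le_trans (ler_normD _ _) _; have := normr_ge0 k; nra.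
have Re1 : `|complex.Re (E h k - 1 - (h +i* k)%C)| <= e1 * `|h| + 2 * e1 * `|k|.
  rewrite /= (_ : _ - h = (expR h - 1 - h) * cos k + (1 + h) * (cos k - 1)); last by ring.
  apply: le_trans (ler_normD _ _) _; rewrite !normrM; apply: lerD.
    rewrite -[leRHS]mulr1 ler_pM// ler_norml cos_geN1 cos_le1//.
  rewrite -mulrA ler_pM//; apply: le_trans (ler_normD _ _) _.
  by rewrite normr1; lra.
have Im1 : `|complex.Im (E h k - 1 - (h +i* k)%C)| <= 4 * e1 * `|k| + e1 * `|k|.
  rewrite /= (_ : _ - k = (expR h - 1) * sin k + (sin k - k)); last by ring.
  apply: le_trans (ler_normD _ _) _; rewrite normrM; apply: lerD => //.
  have -> : 4 * e1 * `|k| = (2 * e1) * (2 * `|k|) by ring.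
  rewrite ler_pM//; apply: le_trans X1 _; lra.
apply: le_trans (lerD Re1 Im1) _; have := normr_ge0 h; have := normr_ge0 k; nra.
Qed.

End complex_derivative.

(** * The mean value property on circles around the center *)

Section mean_value.
Context {R : realType}.
Local Notation C := (plane R).
Local Notation nc := (@Normc.normc R).
Implicit Types (f : C -> C) (z w : C) (s t e : R).

(* The Cauchy-Riemann equations for [f \o exp]. *)
Lemma E_comp_near_linear f s t : derivable f (E s t) 1 -> exists A B,
  near_linear (fun s t => complex.Re (f (E s t))) s t A (- B) /\
  near_linear (fun s t => complex.Im (f (E s t))) s t B A.
Proof.
move=> /derivable_littleoC[D HD].
set z := E s t; pose m := nc z; pose k := nc (D * z).
exists (complex.Re (D * z)), (complex.Im (D * z)).
suff H e : 0 < e -> exists2 d : R, 0 < d & forall s' t',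
    `|s' - s| < d -> `|t' - t| < d ->
    nc (f (E s' t') - f z - D * z * ((s' - s) +i* (t' - t))%C) <=
      e * (`|s' - s| + `|t' - t|).
  split=> e /H[d d0 Hd]; exists d => // s' t' hs ht.
    apply: le_trans (Hd _ _ hs ht); apply: le_trans (normr_Re_le _).
    rewrite le_eqVlt; apply/orP; left; apply/eqP; congr `| _ |.
    move: (f (E s' t')) (f z) (D * z) => [a1 b1] [a2 b2] [a3 b3] /=; ring.
  apply: le_trans (Hd _ _ hs ht); apply: le_trans (normr_Im_le _).
  rewrite le_eqVlt; apply/orP; left; apply/eqP; congr `| _ |.
  move: (f (E s' t')) (f z) (D * z) => [a1 b1] [a2 b2] [a3 b3] /=; ring.
move=> e0; have m0 : 0 < m by rewrite /m normcE_E expR_gt0.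
have k0 : 0 <= k by exact: normc_ge0.
have [|d1 d10 H1] := HD (e / (4 * m)); first by rewrite divr_gt0 ?mulr_gt0.
pose e2 := Num.min 1 (e / (2 * (k + 1))).
have e20 : 0 < e2 by rewrite lt_min ltr01 divr_gt0// mulr_gt0// ltr_wpDl.
have [d2 d20 H2] := E_littleo e20.
exists (Num.min d2 (d1 / (8 * m))).
  by rewrite lt_min d20 divr_gt0// mulr_gt0.
move=> s' t'; rewrite !lt_min => /andP[s1 s2] /andP[t1 t2].
set h := s' - s in s1 s2 *; set l := t' - t in t1 t2 *.
have -> : E s' t' = z * E h l by rewrite -E_add /h /l ![_ + (_ - _)]addrC !subrK.
have := H2 _ _ s1 t1; set r := E h l - 1 - _ => Hr.
have e2e : e2 * k <= e / 2.
  apply: le_trans (_ : e / (2 * (k + 1)) * k <= _).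
    by rewrite ler_wpM2r// ge_min lexx orbT.
  have k1 : 0 < k + 1 by rewrite ltr_wpDl.
  have -> : e / (2 * (k + 1)) * k = e / 2 * (k / (k + 1)) by field; rewrite gt_eqF.
  apply: ler_piMr; first by rewrite divr_ge0 ?ltW.
  rewrite ler_pdivrMr// mul1r; lra.
have e21 : e2 <= 1 by rewrite ge_min lexx.
have E1 : nc (E h l - 1) <= 2 * (`|h| + `|l|).
  have -> : E h l - 1 = r + (h +i* l)%C by rewrite /r subrK.
  apply: le_trans (le_normcD _ _) _; rewrite mulr2n mulrDl mul1r; apply: lerD.
    apply: le_trans Hr _; rewrite ler_piMl// addr_ge0//.
  exact: normc_le_Re_Im.
have zz : z * E h l - z = z * (E h l - 1) by rewrite mulrBr mulr1.
have zzl : nc (z * E h l - z) <= 2 * m * (`|h| + `|l|).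
  by rewrite zz Normc.normcM -/m [2 * m]mulrC -mulrA ler_pM2l.
have zd : nc (z * E h l - z) < d1.
  apply: le_lt_trans zzl _; rewrite -ltr_pdivlMl ?mulr_gt0//.
  have -> : (2 * m)^-1 * d1 = d1 / (8 * m) + d1 / (8 * m) + 2 * (d1 / (8 * m)).
    by field; rewrite gt_eqF.
  by have : 0 < d1 / (8 * m); [rewrite divr_gt0 ?mulr_gt0|lra].
have -> : f (z * E h l) - f z - D * z * (h +i* l)%C =
    (f (z * E h l) - f z - D * (z * E h l - z)) + D * z * r.
  rewrite /r zz; ring.
apply: le_trans (le_normcD _ _) _.
have -> : e = e / 2 + e / 2 by rewrite -splitr.
rewrite mulrDl; apply: lerD.
  apply: le_trans (H1 _ zd) _; apply: le_trans (ler_wpM2l _ zzl) _.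
    by rewrite divr_ge0 ?mulr_ge0 ?ltW.
  rewrite mulrA ler_wpM2r ?addr_ge0// le_eqVlt; apply/orP; left; apply/eqP.
  by field; rewrite gt_eqF.
rewrite Normc.normcM -/k; apply: le_trans (ler_wpM2l k0 Hr) _.
by rewrite mulrA ler_wpM2r ?addr_ge0// mulrC.
Qed.

Lemma E_periodic s : E s (2 * pi) = E s 0 :> C.
Proof. by rewrite /E mulr_natl cos2pi sin2pi cos0 sin0. Qed.

Variable f : C -> C.
Hypothesis df : forall z, 0 < nc z < 1 -> derivable f z 1.
Hypothesis cf0 : forall e, 0 < e -> exists2 d : R, 0 < d &
  forall z, nc z < d -> nc (f z - f 0) < e.

Let u s t := complex.Re (f (E s t)).
Let v s t := complex.Im (f (E s t)).

Let uv s t : s < 0 -> divergence_free u v s t.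
Proof.
move=> s0; have [|A [B [nu nv]]] := @E_comp_near_linear f s t.
  by apply: df; rewrite normcE_E expR_gt0 expR_lt1.
by exists A, (- B), B.
Qed.

Let pi2 : 0 < 2 * pi :> R. Proof. by rewrite mulr_gt0// pi_gt0. Qed.

(** In the coordinates [(s, t)] the sides [t = 0] and [t = 2 * pi] cancel by periodicity, so zero
    flux says that the means over two circles agree; the smaller circle then shrinks to the center.
    Continuity at the center is enough for this limit, so the result applies to a quotient such as
    [phi z / z]. *)
Lemma circle_mean s : s < 0 -> segint (u s) 0 (2 * pi) = 2 * pi * complex.Re (f 0).
Proof.
move=> s0; apply/eqP; rewrite -subr_eq0 -normr_eq0 eq_le normr_ge0 andbT.
apply/ler_addgt0Pr => e e0; rewrite add0r.
have e1 : 0 < e / (2 * pi) by rewrite divr_gt0.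
have [d d0 Hd] := cf0 e1.
pose s1 := Num.min (s - 1) (ln d - 1).
have s1s : s1 < s by rewrite (@le_lt_trans _ _ (s - 1)) ?ge_min ?lexx// ltrBlDr ltrDl.
have s10 : s1 < 0 by exact: lt_trans s0.
have s1d : expR s1 < d.
  rewrite -[ltRHS]lnK ?posrE// ltr_expR (@le_lt_trans _ _ (ln d - 1)) ?ge_min ?lexx ?orbT//.
  by rewrite ltrBlDr ltrDl.
have ss1 : 0 < s - s1 by rewrite subr_gt0.
have : flux u v s1 0 (s - s1) (2 * pi) = 0.
  by apply: (flux_eq0 uv) => //; rewrite addrC subrK.
rewrite /flux add0r [s1 + _]addrC subrK.
have -> : v ^~ (2 * pi) = v ^~ 0 by apply/funext => x; rewrite /v E_periodic.
rewrite subrr subr0 => /eqP; rewrite subr_eq0 => /eqP ->.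
have := @segint_near_cst _ (u s1) 0 (2 * pi) (complex.Re (f 0)) (e / (2 * pi)) (ltW pi2) (@ctsu _ u v 0 uv s1 0 (2 * pi) s10).
rewrite subr0 [_ * (2 * pi)]mulrC divfK ?gt_eqF//; apply => t _.
have := Hd (E s1 t); rewrite normcE_E => /(_ s1d)/ltW; apply: le_trans.
apply: le_trans (normr_Re_le _); rewrite /u.
by move: (f _) (f _) => [? ?] [? ?].
Qed.

Lemma Re_center_le s M : s < 0 -> (forall t, complex.Re (f (E s t)) <= M) ->
  complex.Re (f 0) <= M.
Proof.
move=> s0 fM; rewrite -(ler_pM2l pi2) -(circle_mean s0).
rewrite [leRHS]mulrC -{2}[2 * pi]subr0; apply: segint_le_cst; first exact: ltW.
  exact: (@ctsu _ u v 0 uv s 0 (2 * pi)).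
by move=> t _; exact: fM.
Qed.

(** The equality case of the preceding bound, from which the rigidity in the Schwarz lemma
    follows. *)
Lemma Re_center_eq s M : s < 0 -> (forall t, complex.Re (f (E s t)) <= M) ->
  complex.Re (f 0) = M -> forall t, 0 <= t <= 2 * pi -> complex.Re (f (E s t)) = M.
Proof.
move=> s0 fM f0M t ht; refine (@segint_eq_max _ (u s) 0 (2 * pi) M t pi2 _ (fun x _ => fM x) ht _ _).
- exact: (@ctsu _ u v 0 uv s 0 (2 * pi)).
- move=> e e0; have [A [B [D [nu _]]]] := uv t s0.
  have [d d0 Hd] := near_linear_cts nu e0.
  by exists d => // x xt; apply: Hd => //; rewrite subrr normr0.
- by rewrite circle_mean// subr0 f0M mulrC.
Qed.

End mean_value.

(** * Polar coordinates *)

Section polar.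
Context {R : realType}.
Local Notation C := (plane R).
Local Notation nc := (@Normc.normc R).

Lemma unit_polar (z : C) : nc z = 1 ->
  exists2 t : R, 0 <= t < 2 * pi & z = (cos t +i* sin t)%C.
Proof.
case: z => x y /= xy1.
have xy : x ^+ 2 + y ^+ 2 = 1.
  by rewrite -[LHS]sqr_sqrtr ?addr_ge0 ?sqr_ge0// xy1 expr1n.
have x1 : -1 <= x <= 1.
  by have y2 := sqr_ge0 y; apply/andP; split; nra.
have acosx : acos x \in `[0, pi]%R by rewrite in_itv /= acos_ge0// acos_lepi.
have cx : cos (acos x) = x by rewrite acosK// in_itv.
have sx : sin (acos x) = `|y|.
  by rewrite sin_acos// (_ : 1 - x ^+ 2 = y ^+ 2) ?sqrtr_sqr//; lra.
have pi0 := pi_gt0 R.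
move: acosx; rewrite in_itv /= => /andP[a0 api].
have [y0|y0] := leP 0 y.
  exists (acos x); first by apply/andP; split => //; lra.
  by rewrite cx sx ger0_norm.
exists (2 * pi - acos x).
  apply/andP; split; first lra.
  rewrite ltrBlDr ltrDl lt_neqAle a0 andbT; apply/negP => /eqP a00.
  by move: sx; rewrite -a00 sin0 => /esym/eqP; rewrite normr_eq0 lt_eqF.
rewrite mulr_natl addrC -[X in (cos X +i* _)%C]/(- acos x + pi *+ 2).
by rewrite cosD2pi sinD2pi cosN sinN cx sx ltr0_norm// opprK.
Qed.

Lemma polar (z : C) : z != 0 ->
  exists2 t : R, 0 <= t <= 2 * pi & z = E (ln (nc z)) t.
Proof.
move=> z0; have n0 : 0 < nc z by rewrite normc_gt0.
have [|t /andP[t0 t1] zt] := @unit_polar (z * ((nc z)^-1)%:C%C).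
  by rewrite Normc.normcM normc_real ger0_norm ?invr_ge0 ?ltW// mulfV// gt_eqF.
exists t; first by rewrite t0 ltW.
rewrite /E lnK ?posrE//; move: zt; case: z z0 n0 => x y z0.
set r := nc _ => r0 /eqP; rewrite eq_complex /= => /andP[/eqP <- /eqP <-].
by apply/eqP; rewrite eq_complex /=; apply/andP; split; apply/eqP; field; rewrite gt_eqF.
Qed.

End polar.

(** * Disk automorphisms that are affine in the Cayley coordinate *)

Section affine_disk.
Context {R : realType}.
Local Notation C := (plane R).
Local Notation nc := (@Normc.normc R).
Implicit Types (z w : C) (a b c d : R).
Variable om : C.
Hypothesis om1 : nc om = 1.

(* The Cayley transform [i (om + z) / (om - z)] sends the disk to the upper
   half-plane and [om] to infinity; [aden] and [anum] come from conjugating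
   [w |-> a w + b] by it. *)
Definition cayley z : C := 'i%C * (om + z) / (om - z).
Definition aden a b z : C := a%:C%C * (om + z) + (1 -i* b)%C * (om - z).
Definition anum a b z : C := om * (a%:C%C * (om + z) - (1 +i* b)%C * (om - z)).
Definition adisk a b z : C := anum a b z / aden a b z.

Definition nsq z : R := complex.Re z ^+ 2 + complex.Im z ^+ 2.

Lemma nsqE z : nsq z = nc z ^+ 2.
Proof. by case: z => x y /=; rewrite sqr_sqrtr// addr_ge0// sqr_ge0. Qed.

Lemma nsqM z w : nsq (z * w) = nsq z * nsq w.
Proof. by rewrite !nsqE Normc.normcM exprMn. Qed.

Lemma normc_ltP z r : 0 <= r -> (nc z < r) = (nsq z < r ^+ 2).
Proof. by move=> r0; rewrite nsqE ltr_pXn2r// nnegrE ?normc_ge0. Qed.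

Lemma normc_leP z r : 0 <= r -> (nc z <= r) = (nsq z <= r ^+ 2).
Proof. by move=> r0; rewrite nsqE ler_pXn2r// nnegrE ?normc_ge0. Qed.

Lemma om_neq0 : om != 0.
Proof. by rewrite -normc_gt0 om1. Qed.

Lemma nsq_om : nsq om = 1. Proof. by rewrite nsqE om1 expr1n. Qed.

(** [aden a b z] is [((a + 1) -i* b) * om + ((a - 1) +i* b) * z], so this difference of moduli
    bounds it from below on the closed disk. *)
Definition agap a b : R := nc ((a + 1) -i* b)%C - nc ((a - 1) +i* b)%C.

Lemma agap_gt0 a b : 0 < a -> 0 < agap a b.
Proof.
move=> a0; rewrite subr_gt0 normc_ltP ?normc_ge0// -nsqE /nsq /=.
by rewrite sqrrN ltrD2r; nra.
Qed.

Lemma aden_ge a b z : nc z <= 1 -> agap a b <= nc (aden a b z).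
Proof.
move=> z1; rewrite /agap lerBlDr.
have -> : nc ((a + 1) -i* b)%C = nc (aden a b z - ((a - 1) +i* b)%C * z).
  transitivity (nc (((a + 1) -i* b)%C * om)); first by rewrite Normc.normcM om1 mulr1.
  congr nc.
  rewrite /aden; case: (om) (z) => [p q] [x y].
  by apply/eqP; rewrite eq_complex /=; apply/andP; split; apply/eqP; ring.
apply: le_trans (le_normcD _ _) _.
by rewrite normcN Normc.normcM lerD2l ler_piMr// normc_ge0.
Qed.

Lemma aden_neq0 a b z : 0 < a -> nc z <= 1 -> aden a b z != 0.
Proof.
by move=> a0 z1; rewrite -normc_gt0 (lt_le_trans (agap_gt0 b a0))// aden_ge.
Qed.

(** A single identity for three uses: the disk is preserved, the circle is preserved, and points
    near the circle stay near it quantitatively, as [max_principle] requires. *)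
Lemma adisk_nsq a b z : 0 < a -> nc z <= 1 ->
  1 - nsq (adisk a b z) = 4 * a * (1 - nsq z) / nsq (aden a b z).
Proof.
move=> a0 z1; have d0 := aden_neq0 b a0 z1.
have n0 : nsq (aden a b z) != 0 by rewrite nsqE sqrf_eq0 gt_eqF// normc_gt0.
have -> : nsq (adisk a b z) = nsq (anum a b z) / nsq (aden a b z).
  by apply: (canRL (mulfK n0)); rewrite -nsqM divfK.
have -> : 1 - nsq (anum a b z) / nsq (aden a b z) =
    (nsq (aden a b z) - nsq (anum a b z)) / nsq (aden a b z) by field.
congr (_ / _); rewrite nsqM nsq_om mul1r /aden.
have -> : 1 - nsq z = nsq om - nsq z by rewrite nsq_om.
by case: (om) (z) => [p q] [x y]; rewrite /nsq /=; ring.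
Qed.

Lemma adisk_lt1 a b z : 0 < a -> nc z < 1 -> nc (adisk a b z) < 1.
Proof.
move=> a0 z1; rewrite normc_ltP// expr1n -subr_gt0 adisk_nsq// ?ltW//.
have ? : 0 < nsq (aden a b z).
  by rewrite nsqE exprn_gt0// normc_gt0 aden_neq0// ltW.
by rewrite divr_gt0 ?mulr_gt0// subr_gt0; move: z1; rewrite normc_ltP// expr1n.
Qed.

Lemma adisk_eq1 a b z : 0 < a -> nc z = 1 -> nc (adisk a b z) = 1.
Proof.
move=> a0 z1; have : nsq (adisk a b z) = 1.
  apply/eqP; rewrite eq_sym -subr_eq0 adisk_nsq// ?z1//.
  by rewrite [nsq z]nsqE z1 expr1n subrr mulr0 mul0r.
by rewrite nsqE => /eqP; rewrite sqrf_eq1 => /orP[/eqP//|/eqP n];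
  have := normc_ge0 (adisk a b z); rewrite n; lra.
Qed.

Lemma adisk_om a b : 0 < a -> adisk a b om = om.
Proof.
move=> a0; have := aden_neq0 b a0 (_ : nc om <= 1); rewrite om1 => /(_ (lexx _)).
rewrite /adisk /anum /aden subrr !mulr0 subr0 addr0 => d0.
by rewrite mulfK.
Qed.

Lemma adisk_id z : nc z <= 1 -> adisk 1 0 z = z.
Proof.
move=> z1; have := aden_neq0 0 ltr01 z1; rewrite /adisk => d0.
apply: (mulIf d0); rewrite divfK// /anum /aden.
case: (om) (z) => [p q] [x y].
by apply/eqP; rewrite eq_complex /=; apply/andP; split; apply/eqP; ring.
Qed.

(** Proved by clearing denominators rather than through [cayley], so that [z = om] is included. *)
Lemma adisk_comp a b c d z : 0 < a -> 0 < c -> nc z <= 1 ->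
  adisk a b (adisk c d z) = adisk (a * c) (a * d + b) z.
Proof.
move=> a0 c0 z1.
have n1 : nc (adisk c d z) <= 1.
  move: z1; rewrite le_eqVlt => /orP[/eqP z1|z1]; first by rewrite adisk_eq1.
  by rewrite ltW// adisk_lt1.
have d1 := aden_neq0 d c0 z1; have d2 := aden_neq0 b a0 n1.
have d3 := aden_neq0 (a * d + b) (mulr_gt0 a0 c0) z1.
have n : adisk c d z * aden c d z = anum c d z by rewrite divfK.
have A : aden a b (adisk c d z) * aden c d z = 2 * om * aden (a * c) (a * d + b) z.
  have -> : aden a b (adisk c d z) * aden c d z =
    a%:C%C * (om * aden c d z + adisk c d z * aden c d z) +
    (1 -i* b)%C * (om * aden c d z - adisk c d z * aden c d z).
    by rewrite /aden; ring.
  rewrite n /anum /aden; case: (om) (z) => [p q] [x y].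
  by apply/eqP; rewrite eq_complex /=; apply/andP; split; apply/eqP; ring.
have B : anum a b (adisk c d z) * aden c d z = 2 * om * anum (a * c) (a * d + b) z.
  have -> : anum a b (adisk c d z) * aden c d z =
    om * (a%:C%C * (om * aden c d z + adisk c d z * aden c d z) -
    (1 +i* b)%C * (om * aden c d z - adisk c d z * aden c d z)).
    by rewrite /anum; ring.
  rewrite n /anum /aden; case: (om) (z) => [p q] [x y].
  by apply/eqP; rewrite eq_complex /=; apply/andP; split; apply/eqP; ring.
rewrite [LHS]/adisk [RHS]/adisk -(mulfK d1 (anum _ _ _)) -(mulfK d1 (aden a b _)).
rewrite A B; field.
by apply/and3P; split => //; exact: om_neq0.
Qed.

Lemma cayley_adisk a b z : 0 < a -> nc z <= 1 -> z != om ->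
  adisk a b z != om /\ cayley (adisk a b z) = a%:C%C * cayley z + b%:C%C.
Proof.
move=> a0 z1 zom; have d1 := aden_neq0 b a0 z1.
have zo : om - z != 0 by rewrite subr_eq0 eq_sym.
have Bm : om - adisk a b z = 2 * om * (om - z) / aden a b z.
  apply: (mulIf d1); rewrite divfK// mulrBl divfK// /anum /aden.
  case: (om) (z) => [p q] [x y].
  by apply/eqP; rewrite eq_complex /=; apply/andP; split; apply/eqP; ring.
have Bp : om + adisk a b z = 2 * om * (a%:C%C * (om + z) - 'i%C * b%:C%C * (om - z)) / aden a b z.
  apply: (mulIf d1); rewrite divfK// mulrDl divfK// /anum /aden.
  case: (om) (z) => [p q] [x y].
  by apply/eqP; rewrite eq_complex /=; apply/andP; split; apply/eqP; ring.
have n0 : om - adisk a b z != 0.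
  by rewrite Bm !mulf_neq0 ?invr_eq0 ?om_neq0// pnatr_eq0.
split; first by rewrite eq_sym -subr_eq0.
rewrite /cayley Bm Bp.
have i2 : ('i%C : R[i]) * 'i%C = -1 by rewrite -expr2 sqr_i.
have -> : 'i%C * (2 * om * (a%:C%C * (om + z) - 'i%C * b%:C%C * (om - z)) / aden a b z) =
  2 * om * (a%:C%C * ('i%C * (om + z)) - ('i%C * 'i%C) * b%:C%C * (om - z)) / aden a b z by ring.
by rewrite i2; field; rewrite zo d1 om_neq0.
Qed.

Lemma cayley_inj z w : z != om -> w != om -> cayley z = cayley w -> z = w.
Proof.
move=> zo wo; have z0 : om - z != 0 by rewrite subr_eq0 eq_sym.
have w0 : om - w != 0 by rewrite subr_eq0 eq_sym.
move=> /(congr1 (fun x => x * (om - z) * (om - w))); rewrite /cayley.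
rewrite divfK// -[RHS]mulrA [X in _ = _ * X]mulrC mulrA divfK//.
rewrite -!mulrA => /(mulfI (_ : 'i%C != 0)) H.
have i0 : ('i%C : R[i]) != 0 by rewrite eq_complex /= oner_eq0 andbF.
move: (H i0) => {}H.
have /(mulfI (_ : (2 * om : C) != 0)) : 2 * om * z = 2 * om * w.
  have -> : 2 * om * z = (om + z) * (om - w) - om * om + om * z + z * w + om * w by ring.
  by rewrite H; ring.
by apply; rewrite mulf_neq0 ?om_neq0// pnatr_eq0.
Qed.

Lemma cayleyE z : z != om -> cayley z =
  ((2 * (complex.Re z * complex.Im om - complex.Im z * complex.Re om)) / nsq (om - z) +i*
    ((1 - nsq z) / nsq (om - z)))%C.
Proof.
move=> zo; have z0 : om - z != 0 by rewrite subr_eq0 eq_sym.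
have n0 : nsq (om - z) != 0 by rewrite nsqE sqrf_eq0 gt_eqF// normc_gt0.
have -> : 1 - nsq z = nsq om - nsq z by rewrite nsq_om.
apply: (mulIf z0); rewrite divfK//.
move: n0; rewrite /nsq; case: (om) (z) => [p q] [x y] /= n0.
by apply/eqP; rewrite eq_complex /=; apply/andP; split; apply/eqP; field.
Qed.

(** The center has Cayley coordinate [i], which goes to [a * i + b]; hence [a] and [b] are read off
    the coordinate of [z]. *)
Lemma adisk_trans z : nc z < 1 -> exists a b, 0 < a /\ adisk a b 0 = z.
Proof.
move=> z1; have zo : z != om.
  by apply/eqP => zo; move: z1; rewrite zo om1 ltxx.
exists (complex.Im (cayley z)), (complex.Re (cayley z)).
have a0 : 0 < complex.Im (cayley z).
  rewrite cayleyE//= divr_gt0// ?subr_gt0.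
    by move: z1; rewrite normc_ltP// expr1n.
  by rewrite nsqE exprn_gt0// normc_gt0 subr_eq0 eq_sym.
split => //; have [||h1 h2] := @cayley_adisk _ (complex.Re (cayley z)) 0 a0.
  by rewrite Normc.normc0.
  by rewrite eq_sym om_neq0.
apply: cayley_inj => //; rewrite h2.
have -> : cayley 0 = 'i%C by rewrite /cayley addr0 subr0 mulfK// om_neq0.
by case: (cayley z) => x y; apply/eqP; rewrite eq_complex /=; apply/andP; split; apply/eqP; ring.
Qed.

Lemma affine_derivable (A B z : C) : derivable (fun w : C => A + B * w) z 1.
Proof.
apply: (@derivableD _ _ _ (cst A) (fun w => B * w)); first exact: derivable_cst.
by apply: (@derivableM _ _ (cst B) id); [exact: derivable_cst|exact: derivable_id].
Qed.

Lemma adisk_derivable a b z : 0 < a -> nc z <= 1 -> derivable (adisk a b) z 1.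
Proof.
move=> a0 z1.
have dE : aden a b = fun w => ((a + 1) -i* b)%C * om + ((a - 1) +i* b)%C * w.
  apply/funext => w; rewrite /aden; case: (om) (w) => [p q] [x y].
  by apply/eqP; rewrite eq_complex /=; apply/andP; split; apply/eqP; ring.
have nE : anum a b = fun w =>
    om * ((a - 1) -i* b)%C * om + om * ((a + 1) +i* b)%C * w.
  apply/funext => w; rewrite /anum; case: (om) (w) => [p q] [x y].
  by apply/eqP; rewrite eq_complex /=; apply/andP; split; apply/eqP; ring.
apply: (@derivableM _ _ (anum a b) (fun w => (aden a b w)^-1)).
  by rewrite nE; exact: affine_derivable.
apply: (@derivableV _ _ (aden a b)); first exact: aden_neq0.
by rewrite dE; exact: affine_derivable.
Qed.

End affine_disk.

(** * Maximum principle, Schwarz lemma and the form of disk automorphisms *)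

Section schwarz.
Context {R : realType}.
Local Notation C := (plane R).
Local Notation nc := (@Normc.normc R).
Implicit Types (z w : C) (f phi psi : C -> C).

Lemma diskE z : disk R z <-> nc z < 1.
Proof. by rewrite /disk /= normcE -(rmorph1 (real_complex R)) ltcR. Qed.

Lemma derivable_compC f g z : derivable g z 1 -> derivable f (g z) 1 ->
  derivable (f \o g) z 1.
Proof.
move=> /derivable1_diffP dg /derivable1_diffP df.
by have /derivable1_diffP := differentiable_comp dg df.
Qed.

Lemma derivable_powC f n z : derivable f z 1 -> derivable (fun w => f w ^+ n) z 1.
Proof.
move=> df; elim: n => [|n IH].
  by under eq_fun do rewrite expr0; exact: derivable_cst.
under eq_fun do rewrite exprS.
by have := derivableM df IH; rewrite mulrfctE.
Qed.

Lemma unimodular_to_norm w : exists2 c : C, nc c = 1 & c * w = (nc w)%:C%C.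
Proof.
have [->|w0] := eqVneq w 0.
  by exists 1; rewrite ?Normc.normc1// mulr0 Normc.normc0.
have n0 : 0 < nc w by rewrite normc_gt0.
exists (w^-1 * (nc w)%:C%C); last by rewrite mulrAC mulVf// mul1r.
by rewrite Normc.normcM Normc.normcV normc_real gtr0_norm// mulVf// gt_eqF.
Qed.

(* Moving [z] to the center by an automorphism of the disk reduces the maximum
   principle to the mean value property at the center. *)
Lemma max_principle f z : (forall w, nc w < 1 -> derivable f w 1) ->
  (forall e : R, 0 < e -> exists2 r : R, r < 1 &
    forall w, r < nc w -> nc w < 1 -> nc (f w) <= 1 + e) ->
  nc z < 1 -> nc (f z) <= 1.
Proof.
move=> df fb z1; apply/ler_addgt0Pr => e e0.
have n1 : nc (1 : C) = 1 by rewrite Normc.normc1.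
have [a [b [a0 az]]] := adisk_trans n1 z1.
have [r r1 Hr] := fb _ e0.
have [c c1 cf] := unimodular_to_norm (f z).
pose g w := c * f (adisk 1 a b w).
have dg w : nc w < 1 -> derivable g w 1.
  move=> w1; apply: (@derivableM _ _ (cst c) (f \o adisk 1 a b)).
    exact: derivable_cst.
  apply: derivable_compC; first exact: adisk_derivable (ltW w1).
  by apply: df; exact: adisk_lt1.
have -> : nc (f z) = complex.Re (g 0) by rewrite /g az cf.
pose k := agap a b; have k0 : 0 < k by exact: agap_gt0.
(* By [adisk_nsq], a point with [1 - nsq w = q / 2] goes to one at which [1 - nsq] is at most
   [2 * a * q / k ^+ 2], which must stay below [1 - r ^+ 2]. The maximum with 0 is there because [r]
   may be negative. *)
pose q := Num.min 1 ((1 - Num.max r 0 ^+ 2) * k ^+ 2 / (8 * a)).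
have rr0 : 0 <= Num.max r 0 by rewrite le_max lexx orbT.
have rr1 : Num.max r 0 < 1 by rewrite gt_max r1 ltr01.
have q0 : 0 < q.
  rewrite lt_min ltr01 divr_gt0 ?mulr_gt0 ?exprn_gt0// subr_gt0.
  by rewrite expr_lt1.
(* |w|^2 = expR s >= 1 - q forces |adisk w| > r *)
pose s := ln (1 - q / 2) / 2.
have q1 : q <= 1 by rewrite ge_min lexx.
have s0 : s < 0 by rewrite ltr_pdivrMr// mul0r ln_lt0//; lra.
apply: (@Re_center_le _ g _ _ s) => //.
- by move=> w /andP[_]; exact: dg.
- move=> e1 e10; have [|d d0 H] := @derivable_ctsC _ g 0 _ e1 e10.
    by apply: dg; rewrite Normc.normc0.
  by exists d => // w wd; apply: H; rewrite subr0.
move=> t; set w := E s t.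
have w1 : nc w < 1 by rewrite normcE_E expR_lt1.
have nw : nsq w = 1 - q / 2.
  rewrite nsqE normcE_E -expRM_natl /s mulrC divfK ?pnatr_eq0// lnK// posrE; lra.
apply: le_trans (ler_norm _) _; apply: le_trans (normr_Re_le _) _.
rewrite /g Normc.normcM c1 mul1r; apply: Hr; last exact: adisk_lt1.
apply: (@le_lt_trans _ _ (Num.max r 0)); first by rewrite le_max lexx.
rewrite ltNge normc_leP// -ltNge -subr_gt0.
have -> : nsq (adisk 1 a b w) - Num.max r 0 ^+ 2 =
  (1 - Num.max r 0 ^+ 2) - (1 - nsq (adisk 1 a b w)) by ring.
rewrite adisk_nsq// ?ltW// nw subr_gt0.
have kd : k ^+ 2 <= nsq (aden 1 a b w).
  by rewrite nsqE ler_pXn2r ?nnegrE ?normc_ge0 ?(ltW k0)// aden_ge// ltW.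
have k20 : 0 < k ^+ 2 by rewrite exprn_gt0.
rewrite ltr_pdivrMr ?(lt_le_trans k20)//.
have r20 : 0 < 1 - Num.max r 0 ^+ 2 by rewrite subr_gt0 expr_lt1.
have qk : q <= (1 - Num.max r 0 ^+ 2) * k ^+ 2 / (8 * a) by rewrite ge_min lexx orbT.
move: qk; rewrite ler_pdivlMr ?mulr_gt0// => qk.
by nra.
Qed.

(** In logarithms, [(n + 2) * ln x <= (n + 1) * ln y] gives [ln x <= ln y] as [n] grows: one spare
    factor is lost in the limit. *)
Lemma power_le_le (x y : R) : 0 <= x -> 0 <= y ->
  (forall n, x ^+ n.+2 <= y ^+ n.+1) -> x <= y.
Proof.
move=> x0 y0 H; rewrite leNgt; apply/negP => yx.
have xp : 0 < x by exact: le_lt_trans yx.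
have [y00|yn] := eqVneq y 0.
  by have := H 0%N; rewrite y00 expr1 leNgt exprn_gt0.
have yp : 0 < y by rewrite lt_def yn.
have l0 : 0 < ln x - ln y by rewrite subr_gt0 ltr_ln ?posrE.
have [n] : exists n, - ln x / (ln x - ln y) < n.+1%:R.
  by exists (Num.truncn (- ln x / (ln x - ln y))); exact: truncnS_gt.
rewrite ltr_pdivrMr//.
have := H n; rewrite -ler_ln ?posrE ?exprn_gt0// !lnXn// -[ln x *+ _]mulr_natl -[ln y *+ _]mulr_natl.
by rewrite -[n.+2]addn1 natrD mulrDl mul1r mulrBr; lra.
Qed.

(** For [phi z / z] itself the maximum principle would call for the removal of a singularity at the
    center. A spare power of [phi] makes the quotient vanish there, and the loss disappears as the
    power grows. *)
Lemma schwarz phi z : holomorphic_self_map phi -> phi 0 = 0 ->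
  nc z < 1 -> nc (phi z) <= nc z.
Proof.
move=> [phiD dphi] phi0 z1.
have nphi w : nc w < 1 -> nc (phi w) < 1 by move=> /diskE/phiD/diskE.
apply: power_le_le; rewrite ?normc_ge0// => n.
(* [phi^(n+2) / w^(n+1) = w (phi / w)^(n+2)] is holomorphic also at [0]. *)
pose f w := phi w ^+ n.+2 / w ^+ n.+1.
have [->|z0] := eqVneq z 0; first by rewrite phi0 Normc.normc0 !exprS !mul0r.
suff : nc (f z) <= 1.
  rewrite /f Normc.normcM Normc.normcV !normcX ler_pdivrMr ?mul1r//.
  by rewrite exprn_gt0// normc_gt0.
apply: max_principle => //.
- move=> w w1; have [->|w0] := eqVneq w 0; last first.
    apply: (@derivableM _ _ (fun w => phi w ^+ n.+2) (fun w => (w ^+ n.+1)^-1)).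
      by apply: derivable_powC; apply: dphi; apply/diskE.
    apply: (@derivableV _ _ (fun w : C => w ^+ n.+1)); first by rewrite expf_neq0.
    by apply: (@derivable_powC id); exact: derivable_id.
  have /dphi : disk R 0 by apply/diskE; rewrite Normc.normc0.
  rewrite /derivable -/('D_1 phi 0); set D := 'D_1 phi 0 => HD.
  apply/cvg_ex; exists (D ^+ n.+2) => /=.
  have {}HD : h^-1 * phi h @[h --> (0 : C)^'] --> D.
    apply: cvg_trans HD; apply: near_eq_cvg; near=> h.
    by rewrite /= /shift /= phi0 subr0 addr0 scaler1.
  have HX m : (h^-1 * phi h) ^+ m @[h --> (0 : C)^'] --> D ^+ m.
    elim: m => [|m IH]; first by under eq_fun do rewrite expr0; exact: cvg_cst.
    have := cvgM HD IH; rewrite -exprS => HM.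
    have SE : (fun h : C => (h^-1 * phi h) ^+ m.+1) =
        (fun h => h^-1 * phi h) \* (fun h => (h^-1 * phi h) ^+ m).
      by apply/funext => h; rewrite /= exprS.
    by rewrite SE; exact: HM.
  apply: cvg_trans (HX n.+2); apply: near_eq_cvg; near=> h.
  have h0 : h != 0 by near: h; exists 1 => /=.
  have fh : (h^-1 * phi h) ^+ n.+2 = h^-1 * (f h - f 0).
    rewrite /f phi0 [0 ^+ n.+2]exprS !mul0r subr0 exprMn mulrC.
    by rewrite exprVn [h ^+ n.+2]exprS invfM mulrCA mulrA.
  by rewrite fh /shift /= addr0 scaler1.
- move=> e e0; pose r := expR (- (ln (1 + e) / n.+1%:R)).
  have l0 : 0 < ln (1 + e) by rewrite ln_gt0// ltrDl.
  have rn : r ^+ n.+1 = (1 + e)^-1.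
    by rewrite -expRM_natl mulrN mulrC divfK ?pnatr_eq0// expRN lnK// posrE; lra.
  exists r; first by rewrite expR_lt1 oppr_lt0 divr_gt0.
  move=> w rw w1; have w0 : 0 < nc w by rewrite (lt_trans _ rw)// expR_gt0.
  rewrite /f Normc.normcM Normc.normcV !normcX ler_pdivrMr ?exprn_gt0//.
  apply: (@le_trans _ _ 1).
    by rewrite exprn_ile1 ?normc_ge0// ltW// nphi.
  rewrite -[leLHS](@mulfV _ (1 + e)); last by rewrite gt_eqF//; lra.
  rewrite ler_pM2l; last by lra.
  by rewrite -rn lerXn2r ?nnegrE ?normc_ge0 ?expR_ge0// ltW.
Unshelve. all: by end_near. Qed.

(** The Schwarz lemma for [phi] and for its inverse gives [|phi z| = |z|], so [phi z / z] has
    modulus 1, with limit [D] at the center. Turned by [c] it takes the value 1 there, which is the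
    maximum of its real part; the equality case of the mean value property makes it constant. *)
Lemma automorphism_rotation phi : disk_automorphism phi -> phi 0 = 0 ->
  exists2 c : C, nc c = 1 & forall z, nc z < 1 -> phi z = c * z.
Proof.
move=> [hphi [psi [hpsi phiK psiK]]] phi0.
have D0 : disk R 0 by apply/diskE; rewrite Normc.normc0.
have psi0 : psi 0 = 0 by rewrite -{1}phi0 phiK// inE.
have npz z : nc z < 1 -> nc (phi z) = nc z.
  move=> z1; apply/eqP; rewrite eq_le schwarz//=.
  rewrite -{1}[z]phiK; last by rewrite inE; exact/diskE.
  by apply: schwarz => //; apply/diskE/(hphi.1); exact/diskE.
have [_ dphi] := hphi; have [D HD] := derivable_littleoC (dphi _ D0).
(* Since [phi 0 / 0 = 0], the second summand gives [g] the value [D] at the center. *)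
pose g z : C := phi z / z + (z == 0)%:R * D.
have g0 : g 0 = D by rewrite /g phi0 mul0r eqxx mul1r add0r.
have gz z : z != 0 -> g z = phi z / z.
  by move=> z0; rewrite /g (negPf z0) mul0r addr0.
have ng z : z != 0 -> nc z < 1 -> nc (g z) = 1.
  move=> z0 z1; rewrite gz// Normc.normcM Normc.normcV npz// mulfV//.
  by rewrite gt_eqF// normc_gt0.
have ctsg e : 0 < e -> exists2 d : R, 0 < d & forall z, nc z < d -> nc (g z - g 0) < e.
  move=> e0; have [|d d0 Hd] := HD (e / 2); first by rewrite divr_gt0.
  exists d => // z zd; have [->|z0] := eqVneq z 0; first by rewrite subrr Normc.normc0.
  have := Hd z; rewrite phi0 !subr0 => /(_ zd).
  have -> : phi z - D * z = (g z - g 0) * z by rewrite g0 gz// mulrBl divfK.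
  rewrite Normc.normcM ler_pM2r ?normc_gt0// => /le_lt_trans; apply.
  by rewrite ltr_pdivrMr// ltr_pMr// ltr1n.
have nD : nc D = 1.
  apply/eqP; rewrite -subr_eq0 -normr_eq0 eq_le normr_ge0 andbT.
  apply/ler_addgt0Pr => e e0; rewrite add0r; have [d d0 Hd] := ctsg _ e0.
  pose x := Num.min d 1 / 2; have x0 : 0 < x by rewrite divr_gt0// lt_min d0 ltr01.
  have xd : x < d /\ x < 1.
    by rewrite /x; case: (leP d 1) => ?; split; lra.
  have nx : nc x%:C%C = x by rewrite normc_real gtr0_norm.
  have x1 : nc (g x%:C%C) = 1.
    by rewrite ng ?nx ?xd.2// -normc_gt0 nx.
  have := Hd x%:C%C; rewrite nx g0 => /(_ xd.1) gx.
  have h1 : 1 <= nc (g x%:C%C - D) + nc D.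
    by rewrite -x1; apply: le_trans (le_normcD _ _); rewrite subrK.
  have h2 : nc D <= nc (g x%:C%C - D) + 1.
    by rewrite -x1 normcB; apply: le_trans (le_normcD _ _); rewrite subrK.
  by rewrite ler_norml; lra.
have [c c1 cD] := unimodular_to_norm D.
pose h z := c * g z.
have dh z : 0 < nc z < 1 -> derivable h z 1.
  move=> /andP[z0 z1]; have zn : z != 0 by rewrite -normc_gt0.
  apply: (@derivableM _ _ (cst c) g); first exact: derivable_cst.
  apply: (@near_eq_derivable _ _ _ (fun z => phi z * z^-1)).
    have /derivable_ctsC : derivable (id : C -> C) z 1 by exact: derivable_id.
    move=> /(_ _ z0)[d d0 Hd]; apply/nbhs_ballP; exists d%:C%C; first by rewrite /= ltcR.
    move=> w; rewrite -ball_normE /= normcE ltcR => wz.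
    rewrite gz//; apply/eqP => w0; move: (Hd w).
    by rewrite normcB wz => /(_ isT); rewrite /= w0 ?sub0r ?subr0 ?normcN ltxx.
  apply: (@derivableM _ _ phi (fun z => z^-1)); first by apply: dphi; exact/diskE.
  by apply: (@derivableV _ _ id) => //; exact: derivable_id.
have ctsh e : 0 < e -> exists2 d : R, 0 < d & forall z, nc z < d -> nc (h z - h 0) < e.
  move=> /ctsg[d d0 Hd]; exists d => // z zd.
  by rewrite /h -mulrBr Normc.normcM c1 mul1r; exact: Hd.
have h0 : h 0 = 1 by rewrite /h g0 cD nD.
exists D => // z z1; have [->|z0] := eqVneq z 0; first by rewrite phi0 mulr0.
have [t t2 zE] := polar z0.
have s0 : ln (nc z) < 0 by rewrite ln_lt0// normc_gt0 z0.
have nh t' : nc (h (E (ln (nc z)) t')) = 1.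
  have nE : nc (E (ln (nc z)) t') = nc z by rewrite normcE_E lnK// posrE normc_gt0.
  by rewrite /h Normc.normcM c1 mul1r ng// ?nE// -normc_gt0 nE normc_gt0.
have : complex.Re (h z) = 1.
  rewrite {1}zE; apply: (@Re_center_eq _ h dh ctsh _ 1 s0) => //.
    by move=> t'; rewrite -(nh t'); apply: le_trans (ler_norm _) (normr_Re_le _).
  by rewrite h0.
have : nc (h z) = 1 by rewrite {1}zE nh.
move=> nhz Rhz; have {nhz Rhz} hz : h z = 1.
  have /eqP : complex.Im (h z) ^+ 2 = 0.
    by have := nsqE (h z); rewrite /nsq nhz Rhz !expr1n; lra.
  rewrite sqrf_eq0 => /eqP Ihz.
  by apply/eqP; rewrite eq_complex /= Rhz Ihz !eqxx.
have c0 : c != 0 by rewrite -normc_gt0 c1.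
have : c * g z = c * D by rewrite -/(h z) hz -h0 /h g0.
by move=> /(mulfI c0); rewrite gz// => <-; rewrite divfK.
Qed.

Lemma automorphism_comp phi chi : disk_automorphism phi -> disk_automorphism chi ->
  disk_automorphism (phi \o chi).
Proof.
move=> [[p1 p2] [psi [[s1 s2] pK sK]]] [[q1 q2] [psi' [[t1 t2] qK tK]]].
split; first split.
- by move=> z /q1/p1.
- by move=> z z1; apply: derivable_compC; [exact: q2|apply: p2; exact: q1].
exists (psi' \o psi); split.
- split; first by move=> z /s1/t1.
  by move=> z z1; apply: derivable_compC; [exact: s2|apply: t2; exact: s1].
- by move=> z; rewrite inE => z1 /=; rewrite pK ?qK// inE//; exact: q1.
- by move=> z; rewrite inE => z1 /=; rewrite tK ?sK// inE//; exact: s1.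
Qed.

Variable om : C.
Hypothesis om1 : nc om = 1.

Lemma adisk_cancel (a b : R) z : 0 < a -> nc z <= 1 ->
  adisk om a^-1 (- b / a) (adisk om a b z) = z.
Proof.
move=> a0 z1; rewrite adisk_comp ?invr_gt0// mulVf ?gt_eqF//.
by rewrite mulNr mulrC subrr adisk_id.
Qed.

Lemma adisk_cancelV (a b : R) z : 0 < a -> nc z <= 1 ->
  adisk om a b (adisk om a^-1 (- b / a) z) = z.
Proof.
move=> a0 z1; rewrite adisk_comp ?invr_gt0// mulfV ?gt_eqF//.
by rewrite mulrC divfK ?gt_eqF// addNr adisk_id.
Qed.

Lemma adisk_automorphism (a b : R) : 0 < a -> disk_automorphism (adisk om a b).
Proof.
have self a' b' : 0 < a' -> holomorphic_self_map (adisk om a' b').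
  move=> a0; split; first by move=> z /diskE z1; apply/diskE; exact: adisk_lt1.
  by move=> z /diskE z1; apply: adisk_derivable => //; exact: ltW.
move=> a0; split; first exact: self.
exists (adisk om a^-1 (- b / a)); split.
- by apply: self; rewrite invr_gt0.
- by move=> z; rewrite inE => /diskE/ltW z1; rewrite adisk_cancel.
- by move=> z; rewrite inE => /diskE/ltW z1; rewrite adisk_cancelV.
Qed.

(* Composing with a map sending [phi 0] back to [0] leaves a rotation. *)
Lemma automorphismE phi : disk_automorphism phi -> exists a b c,
  [/\ 0 < a, nc c = 1 & forall z, nc z < 1 -> phi z = adisk om a b (c * z)].
Proof.
move=> aphi; have D0 : nc (0 : C) < 1 by rewrite Normc.normc0.
have np z : nc z < 1 -> nc (phi z) < 1 by move=> /diskE/(aphi.1.1)/diskE.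
have [a [b [a0 ab]]] := adisk_trans om1 (np _ D0).
have ai0 : 0 < a^-1 by rewrite invr_gt0.
have [|c c1 Hc] := @automorphism_rotation (adisk om a^-1 (- b / a) \o phi)
    (automorphism_comp (adisk_automorphism _ ai0) aphi).
  by rewrite /= -ab adisk_cancel// ltW.
exists a, b, c; split => // z z1; rewrite -Hc//= adisk_cancelV// ltW//.
exact: np.
Qed.

End schwarz.

Lemma expr_unbounded {R : realType} (A a : R) : 1 < a ->
  exists N, forall n, (N <= n)%N -> A < a ^+ n.
Proof.
move=> a1; have l0 : 0 < ln a by rewrite ln_gt0.
have a0 : 0 < a by rewrite (lt_trans _ a1).
exists (Num.truncn (A / ln a)).+1 => n Nn.
rewrite -[a]lnK ?posrE// -expRM_natl; apply: lt_le_trans (expR_ge1Dx _).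
have : A / ln a < n%:R by apply: lt_le_trans (truncnS_gt _) _; rewrite ler_nat.
by rewrite ltr_pdivrMr//; lra.
Qed.

(** * Boundary values, fixed points and orbits of the automorphisms *)

Section boundary.
Context {R : realType}.
Local Notation C := (plane R).
Local Notation nc := (@Normc.normc R).
Implicit Types (z w : C) (phi F : C -> C) (a b x p : R).

(** Properness makes the limit in [disk_ext] unique; radial points show that the disk accumulates at
    [z]. *)
Lemma within_disk_proper z : nc z = 1 -> ProperFilter (within (disk R) (nbhs z)).
Proof.
move=> nz; apply: (@within_nbhs_proper C (disk R) z) => B.
move/nbhs_ballP => [e /= e0 He].
move: e0; rewrite ltcE /= => /andP[/eqP e1 e0].
pose d := Num.min 1 (complex.Re e / 2).
have d0 : 0 < d by rewrite lt_min ltr01 divr_gt0.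
have d1 : d <= 1 by rewrite ge_min lexx.
have de : d < complex.Re e.
  by apply: (@le_lt_trans _ _ (complex.Re e / 2)); [rewrite ge_min lexx orbT|lra].
exists ((1 - d)%:C%C * z); split.
  apply/diskE; rewrite Normc.normcM nz mulr1 normc_real ger0_norm; lra.
apply: He; rewrite -ball_normE /= normcE ltcE /= e1 eqxx /=.
have -> : z - (1 - d)%:C%C * z = d%:C%C * z.
  by rewrite (rmorphB (real_complex R)) rmorph1; ring.
by rewrite Normc.normcM nz mulr1 normc_real gtr0_norm.
Qed.

Lemma disk_extE phi F z : (forall w, nc w < 1 -> phi w = F w) ->
  derivable F z 1 -> nc z <= 1 -> disk_ext phi z = F z.
Proof.
move=> phiF dF z1; rewrite /disk_ext normcE -(rmorph1 (real_complex R)) ltcR.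
case: ifPn => [|]; first exact: phiF.
rewrite -leNgt => z1'; have nz : nc z = 1 by apply/le_anti; rewrite z1 z1'.
have PF := within_disk_proper nz.
apply: (@cvg_lim C); first exact: norm_hausdorff.
have cF : F @ within (disk R) (nbhs z) --> F z.
  apply: cvg_within_filter.
  by apply: differentiable_continuous; apply/derivable1_diffP.
apply: cvg_trans cF; apply: near_eq_cvg.
by apply: filterS (withinT (disk R) (nbhs_filter z)) => w /diskE w1; rewrite phiF.
Qed.

Variable om : C.
Hypothesis om1 : nc om = 1.

Lemma cayley_addi z : z != om -> cayley om z + 'i%C = 2 * 'i%C * om / (om - z).
Proof.
move=> zo; have z0 : om - z != 0 by rewrite subr_eq0 eq_sym.
by rewrite /cayley; field.
Qed.

Lemma normc_i : nc ('i%C : C) = 1.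
Proof. by rewrite /= expr0n expr1n add0r sqrtr1. Qed.

(** Turns convergence to [om] into divergence of the Cayley coordinate. *)
Lemma cayley_dist z : z != om -> nc (om - z) = 2 / nc (cayley om z + 'i%C).
Proof.
move=> zo; have z0 : om - z != 0 by rewrite subr_eq0 eq_sym.
rewrite cayley_addi// !Normc.normcM Normc.normcV normc_i om1 !mulr1.
have -> : nc (2 : C) = 2.
  by have := @normc_real R 2; rewrite rmorph_nat => ->; rewrite ger0_norm.
by rewrite invfM invrK mulrA mulfV// mul1r.
Qed.

(* Inverse Cayley transform on the real line: [om (x - i) / (x + i)]. *)
Definition gam x : C :=
  om * ((x ^+ 2 - 1) / (x ^+ 2 + 1) -i* (2 * x / (x ^+ 2 + 1)))%C.

Let x21 x : x ^+ 2 + 1 != 0.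
Proof. by rewrite gt_eqF// ltr_wpDl// sqr_ge0. Qed.

Lemma normc_gam x : nc (gam x) = 1.
Proof.
have /eqP : nsq (gam x) = 1.
  by rewrite /gam nsqM nsq_om// mul1r /nsq /=; field.
rewrite nsqE sqrf_eq1 => /orP[/eqP//|/eqP n].
by have := normc_ge0 (gam x); rewrite n; lra.
Qed.

Let gam_den x : om - gam x = om * (2 / (x ^+ 2 + 1) +i* (2 * x / (x ^+ 2 + 1)))%C.
Proof.
rewrite /gam -{1}[om]mulr1 -mulrBr; congr (_ * _); have := x21 x => ?.
by apply/eqP; rewrite eq_complex /=; apply/andP; split; apply/eqP; field.
Qed.

Lemma gam_neq x : gam x != om.
Proof.
rewrite eq_sym -subr_eq0 gam_den; apply: mulf_neq0; first exact: om_neq0.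
by rewrite eq_complex /= negb_and mulf_neq0 ?invr_eq0.
Qed.

Lemma cayley_gam x : cayley om (gam x) = x%:C%C.
Proof.
have d0 : om - gam x != 0 by rewrite subr_eq0 eq_sym gam_neq.
rewrite /cayley; apply: (mulIf d0); rewrite divfK// gam_den.
have -> : om + gam x = om * (2 * x ^+ 2 / (x ^+ 2 + 1) -i* (2 * x / (x ^+ 2 + 1)))%C.
  rewrite /gam -{1}[om]mulr1 -mulrDr; congr (_ * _); have := x21 x => ?.
  by apply/eqP; rewrite eq_complex /=; apply/andP; split; apply/eqP; field.
rewrite ![_ * (om * _)]mulrCA; congr (_ * _); have := x21 x => ?.
by apply/eqP; rewrite eq_complex /=; apply/andP; split; apply/eqP; field.
Qed.

Lemma cayley_circle z : nc z = 1 -> z != om -> cayley om z = (complex.Re (cayley om z))%:C%C.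
Proof.
by move=> z1 zo; rewrite cayleyE// [nsq z]nsqE z1 expr1n subrr mul0r.
Qed.

Lemma gam_cayley z : nc z = 1 -> z != om -> gam (complex.Re (cayley om z)) = z.
Proof.
move=> z1 zo; apply: (cayley_inj om1) => //; first exact: gam_neq.
by rewrite cayley_gam -cayley_circle.
Qed.

Lemma adisk_gam a b x : 0 < a -> adisk om a b (gam x) = gam (a * x + b).
Proof.
move=> a0; have g1 : nc (gam x) <= 1 by rewrite normc_gam.
have [h1 h2] := cayley_adisk om1 b a0 g1 (gam_neq x).
apply: (cayley_inj om1) => //; first exact: gam_neq.
by rewrite h2 !cayley_gam rmorphD rmorphM.
Qed.

(** An automorphism is a rotation by [c] followed by some [adisk], which is injective and fixes
    [om]; so [c * om = om] and [c = 1]. *)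
Lemma automorphism_fixing phi : disk_automorphism phi -> disk_ext phi om = om ->
  exists a b, 0 < a /\ forall z, nc z < 1 -> phi z = adisk om a b z.
Proof.
move=> aphi; have [a [b [c [a0 c1 Hc]]]] := automorphismE om1 aphi.
have nco : nc (c * om) = 1 by rewrite Normc.normcM c1 om1 mulr1.
have dA : derivable (fun w : C => adisk om a b (c * w)) om 1.
  apply: derivable_compC.
    by apply: (@derivableM _ _ (cst c) id); [exact: derivable_cst|exact: derivable_id].
  by apply: adisk_derivable => //; rewrite nco.
have -> := disk_extE Hc dA ltac:(by rewrite om1).
move=> /(congr1 (adisk om a^-1 (- b / a))).
rewrite adisk_cancel ?nco// adisk_om ?invr_gt0// => co.
have c11 : c = 1 by apply: (mulIf (om_neq0 om1)); rewrite mul1r.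
rewrite c11 in Hc.
by exists a, b; split => // z /Hc; rewrite mul1r.
Qed.

Section affine_representation.
Variables (phi : C -> C) (a b : R).
Hypotheses (a0 : 0 < a) (phiE : forall z, nc z < 1 -> phi z = adisk om a b z).

Lemma disk_ext_adisk z : nc z <= 1 -> disk_ext phi z = adisk om a b z.
Proof. by move=> z1; apply: disk_extE => //; exact: adisk_derivable. Qed.

Lemma normc_leE z : (`|z| <= 1) = (nc z <= 1).
Proof. by rewrite normcE -(rmorph1 (real_complex R)) lecR. Qed.

Lemma fixed_pointsE z : fixed_points phi z <->
  z = om \/ [/\ nc z <= 1, z != om & a%:C%C * cayley om z + b%:C%C = cayley om z].
Proof.
rewrite /fixed_points /= normc_leE; split => [[z1]|[->|[z1 zo H]]].
- rewrite disk_ext_adisk// => zz; have [->|zo] := eqVneq z om; first by left.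
  by right; split => //; have [_ <-] := cayley_adisk om1 b a0 z1 zo; rewrite zz.
- by rewrite om1; split => //; rewrite disk_ext_adisk ?om1// adisk_om.
- split => //; rewrite disk_ext_adisk//.
  have [h1 h2] := cayley_adisk om1 b a0 z1 zo.
  by apply: (cayley_inj om1) => //; rewrite h2 H.
Qed.

Lemma fixed_points_translation : a = 1 -> b != 0 -> fixed_points phi = [set om].
Proof.
move=> a1 b0; apply/seteqP; split => z; rewrite fixed_pointsE; last by left.
move=> [//|[_ _]]; rewrite a1 mul1r => /eqP.
by rewrite addrC -subr_eq0 addrK => /eqP[/eqP]; rewrite (negPf b0).
Qed.

Lemma fixed_points_homothety : a != 1 ->
  fixed_points phi = [set om; gam (b / (1 - a))].
Proof.
move=> a1; have a10 : 1 - a != 0 by rewrite subr_eq0 eq_sym.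
apply/seteqP; split => z; rewrite fixed_pointsE.
  move=> [->|[z1 zo H]]; [by left|right].
  apply: (cayley_inj om1) => //; first exact: gam_neq.
  rewrite cayley_gam rmorphM fmorphV; apply: (mulIf (_ : (1 - a)%:C%C != 0)).
    by rewrite eq_complex /= negb_and a10.
  rewrite divfK; last by rewrite eq_complex /= negb_and a10.
  rewrite rmorphB rmorph1 mulrBr mulr1 -{1}H mulrC; ring.
move=> [->|->]; [by left|right]; split; rewrite ?normc_gam ?gam_neq//.
by rewrite cayley_gam -rmorphM -rmorphD; congr (_%:C)%C; field.
Qed.

Lemma iter_disk n z : nc z < 1 -> nc (iter n phi z) < 1.
Proof.
by move=> z1; elim: n => //= n IH; rewrite phiE//; exact: adisk_lt1.
Qed.

Lemma cayley_iter n z : a != 1 -> nc z < 1 ->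
  cayley om (iter n phi z) =
  (a ^+ n)%:C%C * (cayley om z - (b / (1 - a))%:C%C) + (b / (1 - a))%:C%C.
Proof.
move=> a1 z1; have a10 : 1 - a != 0 by rewrite subr_eq0 eq_sym.
elim: n => [|n IH]; first by rewrite expr0 mul1r subrK.
have n1 := iter_disk n z1.
have no : iter n phi z != om by apply/eqP => no; move: n1; rewrite no om1 ltxx.
rewrite /= phiE//; have [_ ->] := cayley_adisk om1 b a0 (ltW n1) no.
rewrite IH exprS (rmorphM (real_complex R) a); set p := b / (1 - a).
have -> : b%:C%C = p%:C%C - a%:C%C * p%:C%C :> C.
  by rewrite -rmorphM -rmorphB; congr (_%:C)%C; rewrite /p; field.
ring.
Qed.

(** The fixed point [b / (1 - a)] being real, each step multiplies the imaginary part of the Cayley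
    coordinate by [a], so the coordinate diverges. *)
Lemma iter_cvg_expanding z : 1 < a -> nc z < 1 ->
  iter n phi z @[n --> \oo] --> om.
Proof.
move=> a1 z1; have a1' : a != 1 by rewrite gt_eqF.
apply/cvgrPdist_lt => e; rewrite ltcE /= => /andP[/eqP e1 e0].
have zo : z != om by apply/eqP => no; move: z1; rewrite no om1 ltxx.
pose y := complex.Im (cayley om z).
have y0 : 0 < y.
  rewrite /y cayleyE//= divr_gt0// ?subr_gt0.
    by move: z1; rewrite normc_ltP// expr1n.
  by rewrite nsqE exprn_gt0// normc_gt0 subr_eq0 eq_sym.
have [N HN] := expr_unbounded (2 / (complex.Re e * y)) a1.
exists N => // n /= Nn; rewrite normcE ltcE /= e1 eqxx /=.
have n1 := iter_disk n z1.
have no : iter n phi z != om by apply/eqP => no; move: n1; rewrite no om1 ltxx.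
rewrite cayley_dist// cayley_iter//.
have ny : a ^+ n * y < nc ((a ^+ n)%:C%C * (cayley om z - (b / (1 - a))%:C%C) +
    (b / (1 - a))%:C%C + 'i%C).
  apply: lt_le_trans (normr_Im_le _); apply: lt_le_trans (ler_norm _).
  by rewrite /y; case: (cayley om z) => u v /=; lra.
have any0 : 0 < a ^+ n * y by rewrite mulr_gt0// exprn_gt0.
rewrite ltr_pdivrMr; last exact: lt_trans ny.
apply: lt_trans (_ : complex.Re e * (a ^+ n * y) < _); last by rewrite ltr_pM2l.
by have := HN n Nn; rewrite ltr_pdivrMr ?mulr_gt0// mulrCA.
Qed.

(** The Cayley coordinates of the orbit stay bounded. This excludes the hyperbolic maps that repel
    from [om]. *)
Lemma iter_cvg_contracting : a < 1 -> ~ iter n phi 0 @[n --> \oo] --> om.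
Proof.
move=> a1 /cvgrPdist_lt; have a1' : a != 1 by rewrite lt_eqF.
have D0 : nc (0 : C) < 1 by rewrite Normc.normc0.
pose B := nc (cayley om 0 - (b / (1 - a))%:C%C) + nc ((b / (1 - a))%:C%C : C) + 1.
have B0 : 0 < B by rewrite ltr_wpDl// addr_ge0// normc_ge0.
move=> /(_ (2 / B)%:C%C) []; first by rewrite ltcR divr_gt0.
move=> N _ /(_ N (leqnn N)); rewrite normcE ltcR; apply/negP; rewrite -leNgt.
have n1 := iter_disk N D0.
have no : iter N phi 0 != om by apply/eqP => no; move: n1; rewrite no om1 ltxx.
rewrite cayley_dist//.
have c0 : 0 < nc (cayley om (iter N phi 0) + 'i%C).
  rewrite normc_gt0 cayley_addi//; apply: mulf_neq0; last first.
    by rewrite invr_eq0 subr_eq0 eq_sym.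
  apply: mulf_neq0; last exact: om_neq0.
  by apply: mulf_neq0; rewrite ?pnatr_eq0// -normc_gt0 normc_i.
rewrite ler_pM2l// lef_pV2 ?posrE// cayley_iter//.
apply: le_trans (le_normcD _ _) _; rewrite normc_i lerD2r.
apply: le_trans (le_normcD _ _) _; rewrite lerD2r Normc.normcM normc_real.
rewrite ler_piMl ?normc_ge0// ger0_norm ?exprn_ge0 ?(ltW a0)//.
by rewrite exprn_ile1// ltW.
Qed.

End affine_representation.

End boundary.

(** * Comparison of measures on the line through distribution functions *)

Section measure_comparison.
Context {R : realType}.
Implicit Types (F G : R -> R).

Definition is_cdf (m : set (measurableTypeR R) -> \bar R) F :=
  forall x y : R, x <= y -> m `]x, y]%classic = (F y - F x)%:E.

Section cumulative_of.
Variable F : R -> R.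
Hypotheses (F_nd : {homo F : x y / x <= y}) (F_ct : continuous F).
(** [F] itself; the proof arguments allow the structure of cumulative function to be attached to
    it. *)
Definition cumulative_of of {homo F : x y / x <= y} & continuous F := F.
HB.instance Definition _ := isCumulative.Build R _ R
  (cumulative_of F_nd F_ct) F_nd (right_continuousW F_ct).
Definition stieltjes : {measure set (measurableTypeR R) -> \bar R} :=
  lebesgue_stieltjes_measure (cumulative_of F_nd F_ct).

Lemma stieltjes_cdf : is_cdf stieltjes F.
Proof.
move=> x y xy; transitivity (wlength F `]x, y]%classic).
  by apply: (measurable_mu_extE (wlength (cumulative_of F_nd F_ct))); exact: is_ocitv.
by rewrite wlength_itv_bnd.
Qed.

Lemma cdf_unique (m : {measure set (measurableTypeR R) -> \bar R}) :
  is_cdf m F -> forall A, measurable A -> stieltjes A = m A.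
Proof.
move=> mF; apply: lebesgue_stieltjes_measure_unique => X /ocitvP[->|].
  by rewrite !measure0.
by move=> [[x y] /= xy ->]; rewrite mF ?ltW// [LHS]stieltjes_cdf// ltW.
Qed.
End cumulative_of.

(* If [G - F] is nondecreasing, the measure with distribution function [G] is
   the sum of those with distribution functions [F] and [G - F]. *)
Lemma cdf_le F G (m n : {measure set (measurableTypeR R) -> \bar R}) :
  continuous F -> continuous G ->
  {homo (fun x => G x - F x) : x y / x <= y} -> {homo G : x y / x <= y} ->
  is_cdf m F -> is_cdf n G -> forall A, measurable A -> (m A <= n A)%E.
Proof.
move=> cF cG dnd Gnd mF nG A mA.
have cd : continuous (fun x => G x - F x).
  by move=> x; apply: cvgB; [exact: cG|exact: cF].
rewrite -(cdf_unique Gnd cG nG)//.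
pose s : {measure set (measurableTypeR R) -> \bar R} := measure_add m (stieltjes dnd cd).
have sE B : s B = (m B + stieltjes dnd cd B)%E by exact: measure_addE.
rewrite (@cdf_unique G Gnd cG s)//.
  by rewrite sE leeDl.
move=> x y xy; rewrite sE mF// stieltjes_cdf// -EFinD.
by congr EFin; ring.
Qed.

End measure_comparison.

(** * The line coordinate on the circle without [omega] *)

Section circle_coordinates.
Context {R : realType}.
Local Notation C := (plane R).
Local Notation nc := (@Normc.normc R).
Variable omega : circle R.
Let om : C := \val omega.
Implicit Types (z : circle R) (x y t a b : R).

Lemma normc_val z : nc (\val z) = 1.
Proof.
have := valP z; rewrite inE /unit_circle /= => /eqP.
by rewrite normcE -(rmorph1 (real_complex R)) (inj_eq (@complexI R)) => /eqP.
Qed.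

Let om1 : nc om = 1 := normc_val omega.

Definition base_angle : R := s2val (cid2 (unit_polar om1)).

Lemma base_angle_itv : 0 <= base_angle < 2 * pi.
Proof. exact: (s2valP (cid2 (unit_polar om1))). Qed.

Lemma base_angleE : om = (cos base_angle +i* sin base_angle)%C.
Proof. exact: (s2valP' (cid2 (unit_polar om1))). Qed.

(** An argument of [gam om x], because [(x - i) / (x + i)] has argument [pi + 2 * atan x]. *)
Definition angle x : R := base_angle + pi + 2 * atan x.

Definition of_line x : circle R := expi (angle x).

(* [Re (cayley om z)], with junk value [0] at [omega] since [0^-1 = 0]. *)
Definition to_line z : R :=
  2 * (complex.Re (\val z) * complex.Im om - complex.Im (\val z) * complex.Re om) *
  (nsq (om - \val z))^-1.

Lemma to_lineE z : to_line z = complex.Re (cayley om (\val z)).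
Proof.
have [zo|zo] := eqVneq (\val z) om; last by rewrite cayleyE.
rewrite /to_line /cayley zo subrr invr0 mulr0 /=.
by rewrite /nsq /= !expr0n addr0 invr0 mulr0.
Qed.

Lemma val_of_line x : \val (of_line x) = gam om x.
Proof.
rewrite /of_line /expi /angle /gam base_angleE /=; set u := atan x.
have k0 : 0 < 1 + x ^+ 2 by rewrite ltr_pwDl// sqr_ge0.
have cu : cos u ^+ 2 = (1 + x ^+ 2)^-1.
  by rewrite cos_atan exprVn sqr_sqrtr// ltW.
have su : sin u = x * cos u.
  rewrite -[in RHS](atanK x) -/u /tan divfK// /u cos_atan invr_eq0.
  by rewrite gt_eqF// sqrtr_gt0.
have c2 : cos (2 * u) = (1 - x ^+ 2) / (1 + x ^+ 2).
  rewrite mulr_natl cos_mulr2n cu; field; by rewrite gt_eqF.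
have s2 : sin (2 * u) = 2 * x / (1 + x ^+ 2).
  by rewrite mulr_natl sin_mulr2n su mulrCA -expr2 cu; field; rewrite gt_eqF.
rewrite [_ + pi + _]addrAC cosDpi sinDpi cosD sinD c2 s2.
apply/eqP; rewrite eq_complex /=; apply/andP.
by split; apply/eqP; field; rewrite addrC gt_eqF.
Qed.

Lemma of_line_neq x : of_line x != omega.
Proof.
by apply/eqP => /(congr1 val); rewrite val_of_line; apply/eqP; exact: gam_neq.
Qed.

Lemma of_lineK : cancel of_line to_line.
Proof. by move=> x; rewrite to_lineE val_of_line cayley_gam. Qed.

Lemma to_lineK z : z != omega -> of_line (to_line z) = z.
Proof.
move=> zo; apply: val_inj; rewrite val_of_line to_lineE gam_cayley//.
exact: normc_val.
Qed.

Lemma lt_angle : {mono angle : x y / x < y}.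
Proof.
apply: leW_mono; apply: le_mono => x y xy.
by rewrite /angle ltrD2l ltr_pM2l// lt_atan.
Qed.

Lemma le_angle : {mono angle : x y / x <= y}.
Proof. by apply: le_mono => x y; rewrite lt_angle. Qed.

Lemma angle_itv x : base_angle < angle x < base_angle + 2 * pi.
Proof.
rewrite /angle; have := atan_ltpi2 x; have := atan_gtNpi2 x.
by move=> h1 h2; apply/andP; split; lra.
Qed.

Lemma angle_to_line t : base_angle < t < base_angle + 2 * pi ->
  angle (to_line (expi t)) = t.
Proof.
move=> /andP[t1 t2]; pose x := tan ((t - base_angle - pi) / 2).
have tx : t = angle x.
  rewrite /angle /x tanK; last by rewrite in_itv /=; apply/andP; split; lra.
  by field.
by rewrite {1}tx -[expi _]/(of_line x) of_lineK.
Qed.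

Lemma expi2pi t : expi (t + 2 * pi) = expi t.
Proof. by apply: val_inj; rewrite /= mulr_natl cosD2pi sinD2pi. Qed.

Lemma measurable_of_line : measurable_fun setT (of_line : measurableTypeR R -> circle R).
Proof.
apply: (measurableT_comp (@measurable_expi R)).
apply: continuous_measurable_fun => x; apply: cvgD; first exact: cvg_cst.
by apply: cvgM; [exact: cvg_cst|exact: continuous_atan].
Qed.

Lemma measurable_val : measurable_fun setT (\val : circle R -> borel_plane R).
Proof.
apply: (@measurability _ _ (circle R) (borel_plane R) _ _ (@open (plane R))) => //.
move=> _ [U oU <-].
by rewrite setTI; apply: sub_sigma_algebra; exists U.
Qed.

Lemma measurable_to_line : measurable_fun setT (to_line : circle R -> measurableTypeR R).
Proof.
have mRe : measurable_fun setT (fun z : circle R => complex.Re (\val z)).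
  exact: (measurableT_comp (@measurable_Re R) measurable_val).
have mIm : measurable_fun setT (fun z : circle R => complex.Im (\val z)).
  exact: (measurableT_comp (@measurable_Im R) measurable_val).
have nE z : (nsq (om - \val z))^-1 = ((complex.Re om - complex.Re (\val z)) ^+ 2 +
    (complex.Im om - complex.Im (\val z)) ^+ 2) `^ (-1).
  by rewrite powR_inv1 ?addr_ge0 ?sqr_ge0//; case: om (\val z) => [? ?] [? ?].
rewrite /to_line; under eq_fun do rewrite nE.
apply: measurable_funM.
  apply: measurable_funM => //; apply: measurable_funB; exact: measurable_funM.
apply: (measurableT_comp (measurable_powR _)).
by apply: measurable_funD; apply: measurable_funX; apply: measurable_funB.
Qed.

End circle_coordinates.

Section pushforward_measure.
Context {R : realType} d1 d2 (T1 : measurableType d1) (T2 : measurableType d2).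
Variables (m : {measure set T1 -> \bar R}) (f : T1 -> T2).
Hypothesis mf : measurable_fun setT f.

Definition image_measure : {measure set T2 -> \bar R} :=
  measure_function_pushforward__canonical__measure_function_Measure m mf.
End pushforward_measure.

(** * The arc measure as the Cauchy distribution on the line *)

Section arc_in_coordinates.
Context {R : realType}.
Variable omega : circle R.
Local Notation mu := (@arc_measure R).
Local Notation lambda := (@lebesgue_measure R).
Local Notation to_line := (to_line omega).
Local Notation of_line := (of_line omega).
Local Notation angle := (angle omega).
Local Notation base := (base_angle omega).
Implicit Types (x y t a b : R).

Let pi0 : 0 < pi :> R := pi_gt0 R.

Lemma arc_measureE (A : set (circle R)) :
  mu A = ((2 * pi)^-1%:E * lambda (@expi R @^-1` A `&` `[0%R, (2 * pi)%R[%classic))%E.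
Proof. by []. Qed.

Let angle_lt_base t x : 0 <= t < base -> (x < to_line (expi t)) = (angle x < t + 2 * pi).
Proof.
move=> /andP[t0 tb]; rewrite -(lt_angle omega) -expi2pi angle_to_line//.
by have /andP[? ?] := base_angle_itv omega; apply/andP; split; lra.
Qed.

Let angle_le_base t y : 0 <= t < base -> (to_line (expi t) <= y) = (t + 2 * pi <= angle y).
Proof.
move=> /andP[t0 tb]; rewrite -(le_angle omega) -expi2pi angle_to_line//.
by have /andP[? ?] := base_angle_itv omega; apply/andP; split; lra.
Qed.

Let angle_gt_base t x : base < t < 2 * pi -> (x < to_line (expi t)) = (angle x < t).
Proof.
move=> /andP[t0 tb]; rewrite -(lt_angle omega) angle_to_line//.
by have /andP[? ?] := base_angle_itv omega; apply/andP; split; lra.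
Qed.

Let angle_ge_base t y : base < t < 2 * pi -> (to_line (expi t) <= y) = (t <= angle y).
Proof.
move=> /andP[t0 tb]; rewrite -(le_angle omega) angle_to_line//.
by have /andP[? ?] := base_angle_itv omega; apply/andP; split; lra.
Qed.

(** The arc measure uses angles in [[0, 2 * pi[], whereas [angle] ranges over an interval of that
    length starting at [base]; angles below [base] must be turned once before comparison with
    [angle x]. *)
Let preim x y := [set t | [/\ 0 <= t < 2 * pi, t != base &
  x < to_line (expi t) <= y]].

Let preimE x y t : preim x y t <->
  (base < t < 2 * pi /\ angle x < t <= angle y) \/
  (0 <= t < base /\ angle x < t + 2 * pi <= angle y).
Proof.
have /andP[b0 b2] := base_angle_itv omega.
split=> [[/andP[t0 t2] tb H]|].
  have [tlb|tgb|tb'] := ltgtP t base; last by rewrite tb' eqxx in tb.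
    by right; rewrite -angle_lt_base -?angle_le_base ?t0.
  by left; rewrite -angle_gt_base -?angle_ge_base ?tgb.
move=> [[h1 h2]|[h1 h2]].
  split; last by rewrite angle_gt_base// angle_ge_base.
    by case/andP: h1 => ? ->; rewrite andbT; lra.
  by rewrite gt_eqF//; case/andP: h1.
split; last by rewrite angle_lt_base// angle_le_base.
  by case/andP: h1 => -> ? /=; lra.
by rewrite lt_eqF//; case/andP: h1.
Qed.

(** Depending on the place of [2 * pi] relative to [angle x] and [angle y], the preimage is an
    interval, an interval moved back by one turn, or an interval cut into two pieces. *)
Let lambda_preim x y : x < y -> lambda (preim x y) = (angle y - angle x)%:E.
Proof.
move=> xy; have := lt_angle omega x y; rewrite xy => axy.
have /andP[x1 x2] := angle_itv omega x; have /andP[y1 y2] := angle_itv omega y.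
have /andP[b0 b2] := base_angle_itv omega.
have [yl|yg] := ltP (angle y) (2 * pi).
  have -> : preim x y = `]angle x, angle y]%classic.
    apply/seteqP; split => t; rewrite preimE /= in_itv /=.
      by move=> [[_ //]|[/andP[? ?] /andP[? ?]]]; lra.
    by move=> /andP[? ?]; left; split; apply/andP; split; lra.
  by rewrite lebesgue_measure_itv /= lte_fin axy.
have [xg|xl] := leP (2 * pi) (angle x).
  have -> : preim x y = `]angle x - 2 * pi, angle y - 2 * pi]%classic.
    apply/seteqP; split => t; rewrite preimE /= in_itv /=.
      by move=> [[/andP[? ?] /andP[? ?]]|[/andP[? ?] /andP[? ?]]]; apply/andP; split; lra.
    by move=> /andP[? ?]; right; split; apply/andP; split; lra.
  rewrite lebesgue_measure_itv /= lte_fin ltrD2r axy -EFinB; congr EFin; ring.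
have -> : preim x y = `]angle x, 2 * pi[%classic `|` `[0, angle y - 2 * pi]%classic.
  apply/seteqP; split => t; rewrite preimE /= !in_itv /=.
    by move=> [[/andP[? ?] /andP[? ?]]|[/andP[? ?] /andP[? ?]]]; [left|right];
      apply/andP; split; lra.
  by move=> [/andP[? ?]|/andP[? ?]]; [left|right]; split; apply/andP; split; lra.
rewrite measureU//; last first.
  apply/seteqP; split => t //=; rewrite !in_itv /= => -[/andP[? ?] /andP[? ?]].
  lra.
rewrite /= !lebesgue_measure_itv /= !lte_fin xl subr_gt0 -EFinB.
move: yg; rewrite le_eqVlt => /predU1P[->|yg].
  by rewrite ltxx adde0.
rewrite yg -EFinB -EFinD; congr EFin; ring.
Qed.

Lemma to_line_cdf : is_cdf (pushforward mu to_line) (fun x => atan x / pi).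
Proof.
move=> x y; rewrite le_eqVlt => /predU1P[->|xy].
  by rewrite subrr set_itvoc0 /pushforward preimage_set0 measure0.
rewrite /pushforward arc_measureE.
set S := (X in lambda X).
have mS : measurable S.
  apply: measurableI => //; rewrite -[X in measurable X]setTI.
  apply: measurable_expi => //; rewrite -[X in measurable X]setTI.
  exact: measurable_to_line.
(* The angle [base] belongs to [omega], where [to_line] has a junk value; it is removed as a null
   set. *)
have -> : lambda S = lambda (preim x y).
  have mb : measurable [set base] by exact: measurable_set1.
  rewrite (@measureDI _ _ _ lambda S [set base])// [X in (_ + X)%E](_ : _ = 0%E).
    rewrite adde0; congr (lambda _); apply/seteqP; split => t /=.
      rewrite /S /= !in_itv /= => -[[h1 h2] /eqP h3].
      by rewrite /preim.
    by move=> [h1 /eqP h2 h3]; split; [split; rewrite /= in_itv|].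
  apply/eqP; rewrite eq_le measure_ge0 andbT -(lebesgue_measure_set1 base).
  by apply: le_measure; rewrite ?inE//; exact: measurableI.
rewrite lambda_preim// -EFinM; congr EFin; rewrite /angle.
move: (base_angle omega) (atan x) (atan y) (pi : R) pi0 => u v w p p0.
by field; rewrite gt_eqF.
Qed.

Lemma arc_measure_omega : mu [set omega] = 0%E.
Proof.
rewrite arc_measureE; set S := (X in lambda X).
have /andP[b0 b2] := base_angle_itv omega.
have -> : S = [set base].
  apply/seteqP; split => t /=; rewrite /S /= in_itv /=.
    move=> [te /andP[t0 t2]].
    have [tlb|tgb|//] := ltgtP t base.
      have := of_line_neq omega (to_line (expi (t + 2 * pi))).
      rewrite /of_line angle_to_line; last by apply/andP; split; lra.
      by rewrite expi2pi te eqxx.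
    have := of_line_neq omega (to_line (expi t)).
    rewrite /of_line angle_to_line; last by apply/andP; split; lra.
    by rewrite te eqxx.
  move=> ->; split; last by rewrite b0.
  by apply: val_inj; rewrite /= -base_angleE.
by rewrite lebesgue_measure_set1 mule0.
Qed.

Lemma measurable_omega : measurable [set omega].
Proof.
have m1 : measurable ([set \val omega] : set (borel_plane R)).
  rewrite -[X in measurable X]setCK; apply: measurableC; apply: sub_sigma_algebra.
  apply/closed_openC; apply: accessible_closed_set1.
  by apply: hausdorff_accessible; exact: norm_hausdorff.
have := @measurable_val R measurableT _ m1; rewrite setTI.
congr measurable; apply/seteqP; split => z /=; last by move=> ->.
exact: val_inj.
Qed.

Lemma to_lineK_ae : {ae mu, forall z, of_line (to_line z) = z}.
Proof.
exists [set omega]; split; [exact: measurable_omega|exact: arc_measure_omega|].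
by move=> z /= H; apply: contrapT => /eqP zo; apply: H; exact: to_lineK.
Qed.

(** A bound for [a * (1 + x ^+ 2) / (a ^+ 2 + (x - b) ^+ 2)], the density of the image of the Cauchy
    distribution under [x |-> a * x + b] with respect to the Cauchy distribution. *)
Definition dilation a b : R := 2 * a + (1 + 2 * b ^+ 2) / a.

(** Reduced by [cdf_le] to an inequality between the derivatives of two distribution functions. It
    is the source of the boundedness of the operators on L2. *)
Lemma affine_measure_le a b (A : set (measurableTypeR R)) : 0 < a -> measurable A ->
  (pushforward mu to_line ((fun x => a * x + b)%R @^-1` A) <=
   (dilation a b)%:E * pushforward mu to_line A)%E.
Proof.
move=> a0 mA.
have k0 : 0 <= dilation a b.
  by rewrite addr_ge0 ?divr_ge0 ?mulr_ge0 ?(ltW a0)// addr_ge0// mulr_ge0// sqr_ge0.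
have mS : measurable_fun setT (fun x : measurableTypeR R => a * x + b : measurableTypeR R).
  by apply: measurable_funD => //; apply: measurable_funM.
pose n0 : {measure set (measurableTypeR R) -> \bar R} :=
  image_measure mu (measurable_to_line omega).
pose n1 : {measure set (measurableTypeR R) -> \bar R} := image_measure n0 mS.
pose n2 : {measure set (measurableTypeR R) -> \bar R} := mscale (NngNum k0) n0.
pose F1 x := atan ((x - b) / a) / pi; pose F2 x := dilation a b * (atan x / pi).
have ct1 : continuous F1.
  move=> x; apply: cvgM; last exact: cvg_cst.
  apply: (@continuous_comp _ _ _ (fun x => (x - b) / a) atan); last exact: continuous_atan.
  by apply: cvgM; [apply: cvgB; [exact: cvg_id|exact: cvg_cst]|exact: cvg_cst].
have ct2 : continuous F2.
  move=> x; apply: cvgM; first exact: cvg_cst.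
  by apply: cvgM; [exact: continuous_atan|exact: cvg_cst].
have at_nd : {homo (@atan R) : x y / x <= y}.
  by apply: ltW_homo; exact: lt_atan.
suff : (n1 A <= n2 A)%E by [].
apply: (@cdf_le _ F1 F2) => //.
- move=> x y xy; rewrite -subr_ge0 /F1 /F2.
  pose D z : R := (dilation a b * (1 + z ^+ 2)^-1 - (1 + ((z - b) / a) ^+ 2)^-1 * a^-1) / pi.
  pose h z : R := dilation a b * (atan z / pi) - atan ((z - b) / a) / pi.
  have dA (z : R) : is_derive z 1 (fun z : R => (z - b) / a) a^-1.
    have -> : (fun z : R => (z - b) / a) = a^-1 *: (id - cst b).
      by apply/funext => w; rewrite mulrC.
    apply: is_derive_eq; by rewrite subr0 /GRing.scale /= mulr1.
  have dD (z : R) : is_derive z 1 h (D z).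
    have -> : h = dilation a b *: (pi^-1 *: atan) - pi^-1 *: (atan \o (fun z => (z - b) / a)).
      by apply/funext => w; rewrite /h !fctE /GRing.scale /= ; ring.
    apply: is_derive_eq; rewrite /D /GRing.scale /=; ring.
  have D0 z : 0 <= D z.
    rewrite /D; have q0 : 0 < a ^+ 2 + (z - b) ^+ 2 by rewrite ltr_pwDl ?sqr_ge0// exprn_gt0.
    have z0 : 0 < 1 + z ^+ 2 by rewrite ltr_pwDl// sqr_ge0.
    have -> : (1 + ((z - b) / a) ^+ 2)^-1 * a^-1 = a / (a ^+ 2 + (z - b) ^+ 2).
      by field; rewrite !gt_eqF// -(pmulr_lgt0 _ (exprn_gt0 2 a0)) mulrDl mul1r exprMn exprVn divfK// gt_eqF// exprn_gt0.
    rewrite divr_ge0 ?(ltW pi0)// subr_ge0 ler_pdivrMr// mulrAC ler_pdivlMr//.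
    (* This expands [1 + z ^+ 2 <= 1 + 2 * b ^+ 2 + 2 * (z - b) ^+ 2], whose defect is
       [(z - 2 * b) ^+ 2]. *)
    have -> : dilation a b * (a ^+ 2 + (z - b) ^+ 2) = a * (1 + z ^+ 2) +
      (2 * a * a ^+ 2 + (1 + 2 * b ^+ 2) / a * (z - b) ^+ 2 + a * (z - 2 * b) ^+ 2).
      by rewrite /dilation; field; rewrite gt_eqF.
    have b20 : 0 <= 1 + 2 * b ^+ 2 by rewrite addr_ge0// mulr_ge0// sqr_ge0.
    have t1 : 0 <= 2 * a * a ^+ 2 by rewrite mulr_ge0 ?sqr_ge0// mulr_ge0 ?ltW.
    have t2 : 0 <= (1 + 2 * b ^+ 2) / a * (z - b) ^+ 2.
      by rewrite mulr_ge0 ?sqr_ge0// divr_ge0// ltW.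
    have t3 : 0 <= a * (z - 2 * b) ^+ 2 by rewrite mulr_ge0 ?sqr_ge0// ltW.
    by rewrite lerDl addr_ge0 ?t3// addr_ge0.
  have [c _ E] : exists2 c, c \in `[x, y] & h y - h x = D c * (y - x).
    apply: MVT_segment => //.
    by apply: continuous_subspaceT => w; apply: cvgB; [exact: ct2|exact: ct1].
  suff : 0 <= h y - h x by [].
  by rewrite E mulr_ge0// subr_ge0.
- by move=> x y xy; rewrite ler_wpM2l// ler_pM2r ?invr_gt0// at_nd.
- move=> x y xy.
  have pE : (fun t : R => a * t + b) @^-1` `]x, y] = `](x - b) / a, (y - b) / a]%classic.
    apply/seteqP; split => t /=; rewrite !in_itv /= ltr_pdivrMr// ler_pdivlMr//;
      by rewrite ltrBlDr lerBrDr [t * a]mulrC.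
  have xy' : (x - b) / a <= (y - b) / a by rewrite ler_pM2r ?invr_gt0// lerD2r.
  by rewrite -(to_line_cdf xy') -pE.
- move=> x y xy; have := to_line_cdf xy; rewrite /F2 -mulrBr EFinM => <-.
  by [].
Qed.

End arc_in_coordinates.

(** * Measurability of complex-valued functions *)

Section complex_measurable.
Context {R : realType} d (T : measurableType d).
Local Notation C := (plane R).
Local Notation nc := (@Normc.normc R).
Implicit Types (f g h : T -> C).

Definition cmeas f :=
  measurable_fun setT (fun z => complex.Re (f z)) /\
  measurable_fun setT (fun z => complex.Im (f z)).

(** From components to Borel: an open set of the plane is a countable union of squares with rational
    center and half-width, and squares are tested on components. *)
Lemma cmeasP f : cmeas f <-> measurable_fun setT (f : T -> borel_plane R).
Proof.
split=> [[mRe mIm]|mf]; last first.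
  split; [exact: (measurableT_comp (@measurable_Re R) mf)|].
  exact: (measurableT_comp (@measurable_Im R) mf).
apply: (@measurability _ _ T (borel_plane R) _ _ (@open (plane R))) => //.
move=> _ [U oU <-]; rewrite setTI.
pose box (i : rat * rat * rat) := [set w : C |
  `|complex.Re w - ratr i.1.1| < ratr i.2 /\ `|complex.Im w - ratr i.1.2| < ratr i.2].
pose S i := if pselect (box i `<=` U) then
  [set z | `|complex.Re (f z) - ratr i.1.1| < ratr i.2] `&`
  [set z | `|complex.Im (f z) - ratr i.1.2| < ratr i.2] else set0.
have -> : f @^-1` U = \bigcup_i S i.
  apply/seteqP; split => [z /= Uz|z [i _]]; last first.
    by rewrite /S; case: pselect => // sub [h1 h2]; apply: sub.
  move/nbhs_ballP : (open_nbhs_nbhs (conj oU Uz)) => [e /= e0 He].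
  move: e0; rewrite ltcE /= => /andP[/eqP e1 e0].
  have [r [r0 r1]] : exists r : rat, (0 : R) < ratr r /\ ratr r < complex.Re e / 4.
    have e4 : 0 < complex.Re e / 4 by rewrite divr_gt0.
    have [r] := rat_in_itvoo e4.
    by rewrite in_itv /= => /andP[? ?]; exists r.
  have near x : exists p : rat, `|x - ratr p| < ratr r :> R.
    have xr : x - ratr r < x + ratr r :> R by lra.
    have [p] := rat_in_itvoo xr.
    by rewrite in_itv /= => /andP[? ?]; exists p; rewrite ltr_norml; apply/andP; split; lra.
  have [p Hp] := near (complex.Re (f z)); have [q Hq] := near (complex.Im (f z)).
  exists (p, q, r) => //; rewrite /S; case: pselect => // -[] w [] /= w1 w2.
  apply: He; rewrite -ball_normE /= normcE ltcE /= e1 eqxx /=.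
  apply: le_lt_trans (normc_le_Re_Im _) _.
  move: Hp Hq w1 w2; case: (f z) w => [a b] [c k] /=.
  rewrite !ltr_norml => /andP[? ?] /andP[? ?] /andP[? ?] /andP[? ?].
  have h1 : `|a - c| <= 2 * ratr r by rewrite ler_norml; apply/andP; split; lra.
  have h2 : `|b - k| <= 2 * ratr r by rewrite ler_norml; apply/andP; split; lra.
  lra.
have -> : \bigcup_i S i = \bigcup_p \bigcup_q \bigcup_r S (p, q, r).
  apply/seteqP; split => [z [[[p q] r] _ Sz]|z [p _ [q _ [r _ Sz]]]].
    by exists p => //; exists q => //; exists r.
  by exists (p, q, r).
apply: bigcupT_measurable_rat => p; apply: bigcupT_measurable_rat => q.
apply: bigcupT_measurable_rat => r.
rewrite /S; case: pselect => sub; last exact: measurable0.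
apply: measurableI.
  rewrite -[X in measurable X]setTI.
  have -> : [set z | `|complex.Re (f z) - ratr p| < ratr r] =
     (fun z => complex.Re (f z)) @^-1` `]ratr p - ratr r, ratr p + ratr r[%classic.
    by apply/seteqP; split => z /=; rewrite in_itv /= ltr_distl.
  exact: mRe.
rewrite -[X in measurable X]setTI.
have -> : [set z | `|complex.Im (f z) - ratr q| < ratr r] =
   (fun z => complex.Im (f z)) @^-1` `]ratr q - ratr r, ratr q + ratr r[%classic.
  by apply/seteqP; split => z /=; rewrite in_itv /= ltr_distl.
exact: mIm.
Qed.

Lemma cmeas_cst (c : C) : cmeas (fun=> c).
Proof. by split; exact: measurable_cst. Qed.

Lemma cmeasD f g : cmeas f -> cmeas g -> cmeas (fun z => f z + g z).
Proof.
move=> [f1 f2] [g1 g2]; split.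
  rewrite (_ : (fun _ => _) = (fun z => complex.Re (f z) + complex.Re (g z))).
    exact: measurable_funD.
  by apply/funext => z; case: (f z) (g z) => [? ?] [? ?].
rewrite (_ : (fun _ => _) = (fun z => complex.Im (f z) + complex.Im (g z))).
  exact: measurable_funD.
by apply/funext => z; case: (f z) (g z) => [? ?] [? ?].
Qed.

Lemma cmeasM f g : cmeas f -> cmeas g -> cmeas (fun z => f z * g z).
Proof.
move=> [f1 f2] [g1 g2]; split.
  rewrite (_ : (fun _ => _) = (fun z => complex.Re (f z) * complex.Re (g z) -
      complex.Im (f z) * complex.Im (g z))).
    by apply: measurable_funB; exact: measurable_funM.
  by apply/funext => z; case: (f z) (g z) => [? ?] [? ?].
rewrite (_ : (fun _ => _) = (fun z => complex.Re (f z) * complex.Im (g z) +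
    complex.Im (f z) * complex.Re (g z))).
  by apply: measurable_funD; exact: measurable_funM.
by apply/funext => z; case: (f z) (g z) => [? ?] [? ?].
Qed.

Lemma cmeasB f g : cmeas f -> cmeas g -> cmeas (fun z => f z - g z).
Proof.
move=> mf mg; rewrite (_ : (fun _ => _) = (fun z => f z + (-1) * g z)).
  by apply: cmeasD => //; apply: cmeasM => //; exact: cmeas_cst.
by apply/funext => z; rewrite mulN1r.
Qed.

Lemma cmeas_real (u : T -> R) : measurable_fun setT u -> cmeas (fun z => (u z)%:C%C).
Proof. by move=> mu_; split => //=; exact: measurable_cst. Qed.

Lemma cmeas_if (b : T -> bool) f g : measurable_fun setT b -> cmeas f -> cmeas g ->
  cmeas (fun z => if b z then f z else g z).
Proof.
move=> mb [f1 f2] [g1 g2]; split.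
  rewrite (_ : (fun _ => _) = (fun z => if b z then complex.Re (f z) else complex.Re (g z))).
    exact: measurable_fun_ifT.
  by apply/funext => z; case: (b z).
rewrite (_ : (fun _ => _) = (fun z => if b z then complex.Im (f z) else complex.Im (g z))).
  exact: measurable_fun_ifT.
by apply/funext => z; case: (b z).
Qed.

Lemma cmeas_sqnorm f : cmeas f -> measurable_fun setT (fun z => (nc (f z) ^+ 2)%:E).
Proof.
move=> [f1 f2]; apply/measurable_EFinP.
rewrite (_ : (fun _ => _) = (fun z => complex.Re (f z) ^+ 2 + complex.Im (f z) ^+ 2)).
  by apply: measurable_funD; exact: measurable_funX.
by apply/funext => z; rewrite -nsqE.
Qed.

End complex_measurable.

Lemma cmeas_comp {R : realType} d d' (T : measurableType d) (T' : measurableType d')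
  (f : T' -> plane R) (s : T -> T') : cmeas f -> measurable_fun setT s ->
  cmeas (fun z => f (s z)).
Proof.
by move=> /cmeasP mf ms; apply/cmeasP; exact: (measurableT_comp mf ms).
Qed.

(** * The squared L2 distance between functions *)

Section squared_distance.
Context {R : realType} d (T : measurableType d).
Variable m : {measure set T -> \bar R}.
Local Notation C := (plane R).
Local Notation nc := (@Normc.normc R).
Implicit Types (f g h k : T -> C).
Local Open Scope ereal_scope.

(** Squares avoid the root and allow integrals, possibly infinite, to be compared directly; the
    price is a factor 2 in the triangle inequality. *)
Definition sqd f g : \bar R := \int[m]_z (nc (f z - g z)%R ^+ 2)%:E.

Lemma sqd_ge0 f g : 0 <= sqd f g.
Proof. by apply: integral_ge0 => z _; rewrite lee_fin sqr_ge0. Qed.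

Lemma sqdC f g : sqd f g = sqd g f.
Proof. by apply: eq_integral => z _; rewrite normcB. Qed.

Lemma sqdxx f : sqd f f = 0.
Proof.
by rewrite /sqd; under eq_integral do rewrite subrr Normc.normc0 expr0n;
  rewrite integral0.
Qed.

Lemma sqr_normcD (a b : C) :
  (nc (a + b) ^+ 2 <= 2 * nc a ^+ 2 + 2 * nc b ^+ 2)%R.
Proof.
apply: le_trans (_ : ((nc a + nc b) ^+ 2 <= _)%R).
  by rewrite ler_pXn2r ?nnegrE ?addr_ge0 ?normc_ge0// le_normcD.
by have := sqr_ge0 (nc a - nc b); lra.
Qed.

Lemma sqd_le2 f g h k : cmeas f -> cmeas g -> cmeas h -> cmeas k ->
  (forall z, f z - g z = (f z - h z) + (k z - g z))%R ->
  sqd f g <= 2%:E * sqd f h + 2%:E * sqd k g.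
Proof.
move=> mf mg mh mk E.
have m1 := cmeas_sqnorm (cmeasB mf mh); have m2 := cmeas_sqnorm (cmeasB mk mg).
have n1 z : 0 <= (nc (f z - h z)%R ^+ 2)%:E by rewrite lee_fin sqr_ge0.
have n2 z : 0 <= (nc (k z - g z)%R ^+ 2)%:E by rewrite lee_fin sqr_ge0.
rewrite /sqd -!ge0_integralZl//.
rewrite -ge0_integralD//; last 4 first.
- by move=> z _; rewrite mule_ge0.
- exact: measurable_funeM.
- by move=> z _; rewrite mule_ge0.
- exact: measurable_funeM.
apply: ge0_le_integral => //.
- by move=> z _; rewrite lee_fin sqr_ge0.
- exact: cmeas_sqnorm (cmeasB mf mg).
- by apply: emeasurable_funD; exact: measurable_funeM.
by move=> z _; rewrite E -!EFinM -EFinD lee_fin sqr_normcD.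
Qed.

Lemma sqd_triangle g f h : cmeas f -> cmeas g -> cmeas h ->
  sqd f h <= 2%:E * sqd f g + 2%:E * sqd g h.
Proof. by move=> mf mg mh; apply: sqd_le2 => // z; rewrite addrA subrK. Qed.

Lemma sqd_add f g h k : cmeas f -> cmeas g -> cmeas h -> cmeas k ->
  sqd (fun z => f z + h z)%R (fun z => g z + k z)%R <=
  2%:E * sqd f g + 2%:E * sqd h k.
Proof.
move=> mf mg mh mk.
have -> : sqd f g = sqd (fun z => f z + h z)%R (fun z => g z + h z)%R.
  by apply: eq_integral => z _; congr (_ ^+ _)%:E; congr nc; ring.
have -> : sqd h k = sqd (fun z => g z + h z)%R (fun z => g z + k z)%R.
  by apply: eq_integral => z _; congr (_ ^+ _)%:E; congr nc; ring.
by apply: sqd_triangle; exact: cmeasD.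
Qed.

Lemma eq_sqd_ae f f' g g' : cmeas f -> cmeas f' -> cmeas g -> cmeas g' ->
  {ae m, forall z, f z = f' z} -> {ae m, forall z, g z = g' z} ->
  sqd f g = sqd f' g'.
Proof.
move=> mf mf' mg mg' ff' gg'; apply: ae_eq_integral => //.
- exact: cmeas_sqnorm (cmeasB mf mg).
- exact: cmeas_sqnorm (cmeasB mf' mg').
by apply: filterS2 ff' gg' => z -> ->.
Qed.

End squared_distance.

(** * Squared distance and classes in L2 *)

Section L2_squared_distance.
Context {R : realType}.
Local Notation C := (plane R).
Local Notation nc := (@Normc.normc R).
Local Notation mu := (@arc_measure R).
Implicit Types (f g : circle R -> C) (u v w : L2 R).
Local Open Scope ereal_scope.

Lemma L2norm_sqd f : L2norm f = sqd mu f (fun=> 0%R) `^ 2^-1.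
Proof.
rewrite /L2norm unlock /= /sqd; congr (_ `^ _); apply: eq_integral => z _ /=.
by rewrite subr0 ger0_norm ?normc_ge0// powR_mulrn ?normc_ge0.
Qed.

Lemma L2edist_sqd f g : L2edist f g = sqd mu f g `^ 2^-1.
Proof.
rewrite /L2edist L2norm_sqd; congr (_ `^ _); apply: eq_integral => z _.
by rewrite subr0.
Qed.

Lemma L2norm_fin_sqd f : (L2norm f < +oo) = (sqd mu f (fun=> 0%R) < +oo).
Proof.
rewrite L2norm_sqd; apply/idP/idP; last exact: poweR_lty.
by apply: lty_poweRy; rewrite invr_eq0 pnatr_eq0.
Qed.

Lemma cmeas_L2 u : cmeas u.
Proof.
by apply/cmeasP; exact: (@measurable_funP _ _ _ _ setT (repr (\val u))).
Qed.

Lemma sqd_L2_fin u : sqd mu u (fun=> 0%R) < +oo.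
Proof. by rewrite -L2norm_fin_sqd; exact: L2norm_fin (valP u). Qed.

Lemma sqd_L2_fin_num u v : sqd mu u v \is a fin_num.
Proof.
rewrite ge0_fin_numE ?sqd_ge0//.
have := L2edist_fin u v; rewrite L2edist_sqd ge0_fin_numE ?poweR_ge0// => /lty_poweRy.
by apply; rewrite invr_eq0 pnatr_eq0.
Qed.

Lemma L2dist_sqr u v : (L2dist u v ^+ 2)%:E = sqd mu u v.
Proof.
rewrite /L2dist L2edist_sqd fine_poweR powR12_sqrt ?fine_ge0 ?sqd_ge0//.
by rewrite sqr_sqrtr ?fine_ge0 ?sqd_ge0// fineK// sqd_L2_fin_num.
Qed.

Lemma L2dist_ge0 u v : (0 <= L2dist u v)%R.
Proof. by rewrite /L2dist fine_ge0// L2edist_sqd poweR_ge0. Qed.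

Lemma L2dist_lt u v (e : R) : (0 < e)%R ->
  (L2dist u v < e)%R = (sqd mu u v < (e ^+ 2)%:E).
Proof.
by move=> e0; rewrite -L2dist_sqr lte_fin ltr_pXn2r// nnegrE ?L2dist_ge0// ltW.
Qed.

Lemma L2class_ae f : cmeas f -> sqd mu f (fun=> 0%R) < +oo ->
  {ae mu, forall z, L2class f z = f z}.
Proof.
move=> /cmeasP mf ff; have := L2classE mf; rewrite L2norm_fin_sqd => /(_ ff).
by apply: filterS => z /(_ I).
Qed.

Lemma L2_eq_ae u v : {ae mu, forall z, u z = v z} -> u = v.
Proof.
move=> uv; apply: L2dist_positivity; apply/eqP; rewrite -sqrf_eq0.
have : (L2dist u v ^+ 2)%:E = 0.
  rewrite L2dist_sqr -(sqdxx mu v); apply: eq_sqd_ae => //; try exact: cmeas_L2.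
  exact: nearW.
by move=> [->].
Qed.

Lemma bounded_sqd_fin f (M : R) : (forall z, nc (f z) <= M)%R -> cmeas f ->
  sqd mu f (fun=> 0%R) < +oo.
Proof.
move=> fM mf; apply: (@le_lt_trans _ _ (\int[mu]_z (M ^+ 2)%:E)).
  apply: ge0_le_integral => //.
  - by move=> z _; rewrite lee_fin sqr_ge0.
  - by apply: cmeas_sqnorm; apply: cmeasB => //; exact: cmeas_cst.
  move=> z _; rewrite subr0 lee_fin ler_pXn2r ?nnegrE ?normc_ge0//.
  exact: le_trans (normc_ge0 _) (fM z).
by rewrite integral_cst//= arc_measureT mule1 ltry.
Qed.

End L2_squared_distance.

(** * Affine maps acting on the circle, and masses of subsets of the line *)

Section affine_circle.
Context {R : realType}.
Variable omega : circle R.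
Local Notation C := (plane R).
Local Notation nc := (@Normc.normc R).
Local Notation mu := (@arc_measure R).
Local Notation to_line := (to_line omega).
Local Notation of_line := (of_line omega).
Implicit Types (a b c x y r p : R) (f g : circle R -> C) (z : circle R).

Definition affc a b z : circle R := of_line (a * to_line z + b).

Lemma measurable_affc a b : measurable_fun setT (affc a b : circle R -> circle R).
Proof.
apply: (measurableT_comp (measurable_of_line omega)).
apply: measurable_funD => //; apply: measurable_funM => //.
exact: measurable_to_line.
Qed.

Lemma affc_comp a b c d z : affc c d (affc a b z) = affc (c * a) (c * b + d) z.
Proof. by rewrite /affc of_lineK; congr (of_line _); ring. Qed.

Local Open Scope ereal_scope.

(** The integral is transported to the line, where [affine_measure_le] compares the measures, and
    brought back; the two coordinate maps are mutually inverse off the null point [omega]. *)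
Lemma integral_affc_le a b (h : circle R -> \bar R) : (0 < a)%R ->
  (forall z, 0 <= h z) -> measurable_fun setT h ->
  \int[mu]_z h (affc a b z) <= (dilation a b)%:E * \int[mu]_z h z.
Proof.
move=> a0 h0 mh; have mk := measurable_to_line omega.
have k0 : (0 <= dilation a b)%R.
  by rewrite addr_ge0 ?divr_ge0 ?mulr_ge0 ?(ltW a0)// addr_ge0// mulr_ge0// sqr_ge0.
have mS : measurable_fun setT (fun x : measurableTypeR R => (a * x + b)%R : measurableTypeR R).
  by apply: measurable_funD => //; apply: measurable_funM.
pose n0 : {measure set (measurableTypeR R) -> \bar R} := image_measure mu mk.
pose n1 : {measure set (measurableTypeR R) -> \bar R} := image_measure n0 mS.
pose n2 : {measure set (measurableTypeR R) -> \bar R} := mscale (NngNum k0) n0.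
pose H (x : measurableTypeR R) := h (of_line x).
have mH : measurable_fun setT H by apply: (measurableT_comp mh); exact: measurable_of_line.
have H0 x : 0 <= H x by exact: h0.
have push0 (G : measurableTypeR R -> \bar R) : (forall x, 0 <= G x) ->
    measurable_fun setT G -> \int[n0]_x G x = \int[mu]_z G (to_line z).
  by move=> G0 mG; rewrite /n0 (ge0_integral_pushforward mk) //=.
have -> : \int[mu]_z h (affc a b z) = \int[n1]_x H x.
  rewrite /n1 (ge0_integral_pushforward mS)//= -[LHS]/(\int[mu]_z (H (a * to_line z + b)%R)).
  by rewrite preimage_setT (push0 (fun x => H (a * x + b)%R))//; exact: measurableT_comp.
apply: le_trans (ge0_le_measure_integral (m2 := n2) _ measurableT H0 mH) _.
  by move=> A mA; exact: affine_measure_le.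
rewrite /n2 ge0_integral_mscale//=; apply: lee_wpmul2l; first by rewrite lee_fin.
rewrite push0// le_eqVlt; apply/orP; left; apply/eqP; apply: ae_eq_integral => //.
- by apply: measurableT_comp => //; exact: mH.
- by apply: filterS (to_lineK_ae omega) => z /= + _; rewrite /H => ->.
Qed.

Lemma cmeas_affc a b f : cmeas f -> cmeas (fun z => f (affc a b z)).
Proof. by move=> mf; apply: cmeas_comp => //; exact: measurable_affc. Qed.

Lemma sqd_affc_le a b f g : (0 < a)%R -> cmeas f -> cmeas g ->
  sqd mu (fun z => f (affc a b z)) (fun z => g (affc a b z)) <=
  (dilation a b)%:E * sqd mu f g.
Proof.
move=> a0 mf mg; apply: (integral_affc_le b (h := fun z => (nc (f z - g z)%R ^+ 2)%:E)) => //.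
  by move=> z; rewrite lee_fin sqr_ge0.
exact: cmeas_sqnorm (cmeasB mf mg).
Qed.

(** The preceding bound, applied to the indicator of a null set. *)
Lemma ae_affc a b (P : circle R -> Prop) : (0 < a)%R ->
  {ae mu, forall z, P z} -> {ae mu, forall z, P (affc a b z)}.
Proof.
move=> a0 [N [mN N0 PN]].
have mNa : measurable (affc a b @^-1` N).
  by rewrite -[X in measurable X]setTI; exact: measurable_affc.
exists (affc a b @^-1` N); split => //; last by move=> z /= Pz; exact: PN.
have := integral_affc_le b (h := fun z => (\1_N z)%:E) a0.
have -> : \int[mu]_z (\1_N (affc a b z))%:E = mu (affc a b @^-1` N).
  transitivity (\int[mu]_z (\1_(affc a b @^-1` N) z)%:E) => //.
  by rewrite integral_indic// setIT.
have -> : \int[mu]_z (\1_N z)%:E = 0 by rewrite integral_indic// setIT.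
rewrite mule0 => H.
apply/eqP; rewrite eq_le measure_ge0 andbT; apply: H.
  by move=> z; rewrite lee_fin.
by apply/measurable_EFinP.
Qed.

Lemma mu_interval x y : (x <= y)%R ->
  mu [set z | (x < to_line z <= y)%R] = ((atan y - atan x) / pi)%:E.
Proof.
move=> xy; rewrite mulrBl -(to_line_cdf omega xy); congr (mu _).
Qed.

Lemma measurable_to_line_set (A : set R) : measurable A ->
  measurable [set z | A (to_line z)].
Proof.
by move=> mA; have := @measurable_to_line R omega measurableT A mA; rewrite setTI.
Qed.

Lemma mu_tail (e : R) : (0 < e)%R -> exists2 A : R, (0 < A)%R &
  mu [set z | (A < `|to_line z|)%R] <= e%:E.
Proof.
move=> e0; have pi0 := pi_gt0 R.
(* The tail beyond [tan (pi / 2 - u)] has mass [2 * u / pi]; the cap [pi / 4] keeps [A] positive. *)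
pose u : R := Num.min (pi * e / 2)%R (pi / 4)%R.
have u0 : (0 < u)%R by rewrite lt_min !divr_gt0 ?mulr_gt0.
have u1 : (u <= pi / 4)%R by rewrite ge_min lexx orbT.
have u2 : (u <= pi * e / 2)%R by rewrite ge_min lexx.
pose A := tan (pi / 2 - u)%R.
have atA : atan A = (pi / 2 - u)%R.
  by rewrite tanK// in_itv /=; apply/andP; split; lra.
have A0 : (0 < A)%R.
  rewrite ltNge; apply/negP => A0.
  have : (atan A <= atan 0)%R by have := ltW_homo (@lt_atan R); apply.
  rewrite atan0 atA; lra.
exists A => //.
pose S := [set z | (- A < to_line z <= A)%R].
have mS : measurable S.
  have := measurable_to_line_set (measurable_itv `](- A)%R, A]).
  by congr measurable; apply/seteqP; split => z /=; rewrite in_itv.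
have mSE : mu S = (1 - 2 * u / pi)%:E.
  rewrite mu_interval ?atanN ?atA; last lra.
  by congr EFin; move: (pi : R) pi0 => p p0; field; rewrite gt_eqF.
apply: (@le_trans _ _ (mu (~` S))).
  apply: le_measure; rewrite ?inE.
  - have := measurable_to_line_set (measurableU _ _ (measurable_itv `]-oo, (- A)%R[) (measurable_itv `]A, +oo[)).
    congr measurable; apply/seteqP; split => z /=; rewrite !in_itv /= andbT ltr_normr ltrNr.
      by move=> [->|->]; rewrite ?orbT.
    by move=> /orP[->|->]; [right|left].
  - exact: measurableC.
  - by move=> z /= zA /andP[z1 z2]; move: zA; rewrite ltNge ler_norml z2 ltW.
have -> : mu (~` S) = 1 - mu S by exact: (@probability_setC _ _ _ (@arc_measure R)).
rewrite mSE -EFinB lee_fin opprB addrC subrK ler_pdivrMr// mulrC; lra.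
Qed.

Lemma mu_near p r : (0 < r)%R -> mu [set z | (`|to_line z - p| < r)%R] <= r%:E.
Proof.
move=> r0; have pi0 := pi_gt0 R.
have pr : (p - r <= p + r)%R by lra.
apply: (@le_trans _ _ (mu [set z | (p - r < to_line z <= p + r)%R])).
  apply: le_measure; rewrite ?inE.
  - have := measurable_to_line_set (measurable_itv `](p - r)%R, (p + r)%R[).
    by congr measurable; apply/seteqP; split => z /=; rewrite in_itv /= ltr_distl.
  - have := measurable_to_line_set (measurable_itv `](p - r)%R, (p + r)%R]).
    by congr measurable; apply/seteqP; split => z /=; rewrite in_itv.
  - by move=> z /=; rewrite ltr_distl => /andP[-> /ltW ->].
rewrite mu_interval// lee_fin ler_pdivrMr//.
have [c _ ->] : exists2 c, c \in `[(p - r)%R, (p + r)%R] &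
    (atan (p + r) - atan (p - r) = (1 + c ^+ 2)^-1 * (p + r - (p - r)))%R.
  apply: MVT_segment => //.
  by apply: continuous_subspaceT => w; exact: continuous_atan.
have -> : (p + r - (p - r) = 2 * r)%R by ring.
have p2 : (2 <= pi :> R)%R by exact: pi_ge2.
have c1 : ((1 + c ^+ 2)^-1 <= 1)%R.
  by rewrite invf_le1 ?lerDl ?sqr_ge0// ltr_pwDl// sqr_ge0.
apply: le_trans (_ : (1 * (2 * r) <= _)%R); first by rewrite ler_wpM2r// mulr_ge0 ?ltW.
by rewrite mul1r mulrC ler_pM2l.
Qed.

Lemma sqd_small f g (M : R) (A : set (circle R)) : cmeas f -> cmeas g ->
  (forall z, nc (f z) <= M)%R -> (forall z, nc (g z) <= M)%R -> measurable A ->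
  (forall z, ~ A z -> f z = g z) -> sqd mu f g <= ((2 * M) ^+ 2)%:E * mu A.
Proof.
move=> mf mg fM gM mA fg.
have -> : ((2 * M) ^+ 2)%:E * mu A = \int[mu]_z (((2 * M) ^+ 2)%:E * (\1_A z)%:E).
  rewrite ge0_integralZl//; last 2 first.
  - by apply/measurable_EFinP.
  - by rewrite lee_fin sqr_ge0.
  by rewrite integral_indic// setIT.
apply: ge0_le_integral => //.
- by move=> z _; rewrite lee_fin sqr_ge0.
- exact: cmeas_sqnorm (cmeasB mf mg).
- by apply: measurable_funeM; apply/measurable_EFinP.
move=> z _; rewrite -EFinM lee_fin indicE.
have [zA|zA] := boolP (z \in A); last first.
  by rewrite fg ?subrr ?Normc.normc0 ?mulr0 ?expr0n//; rewrite notin_setE in zA.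
have M0 : (0 <= M)%R by exact: le_trans (normc_ge0 _) (fM z).
rewrite mulr1 ler_pXn2r ?nnegrE ?normc_ge0 ?mulr_ge0//.
apply: le_trans (le_normcD _ _) _; rewrite normcN.
by have := fM z; have := gM z; lra.
Qed.

End affine_circle.

(** * Step functions on the line and their affine changes of variable *)

Section step_functions.
Context {R : realType}.
Variable omega : circle R.
Local Notation C := (plane R).
Local Notation nc := (@Normc.normc R).
Local Notation mu := (@arc_measure R).
Local Notation to_line := (to_line omega).
Local Notation affc := (affc omega).
Implicit Types (a b x y r p e : R) (f g : circle R -> C) (z : circle R).

(** Rational values and breakpoints make the family countable, as the Baire argument requires. With
    half-lines as building blocks, an affine change of variable only moves the breakpoints. *)
Definition step (s : seq (rat * rat * rat)) x : C :=
  \sum_(i <- s) (ratr i.1.1 +i* ratr i.1.2)%C * (x <= ratr i.2)%R%:R.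

Lemma step_nil x : step [::] x = 0.
Proof. by rewrite /step big_nil. Qed.

Lemma step_cons i s x :
  step (i :: s) x = (ratr i.1.1 +i* ratr i.1.2)%C * (x <= ratr i.2)%R%:R + step s x.
Proof. by rewrite /step big_cons. Qed.

Lemma step_cat s t x : step (s ++ t) x = step s x + step t x.
Proof. by rewrite /step big_cat. Qed.

Lemma step_scale (c : rat * rat) s x :
  step [seq ((c.1 * i.1.1 - c.2 * i.1.2, c.1 * i.1.2 + c.2 * i.1.1), i.2) | i <- s] x =
  (ratr c.1 +i* ratr c.2)%C * step s x.
Proof.
rewrite /step big_map big_distrr /=; apply: eq_bigr => i _; rewrite mulrA; congr (_ * _).
by rewrite rmorphB rmorphD !rmorphM.
Qed.

Lemma step_bounded s : exists2 M : R, 0 <= M & forall x, nc (step s x) <= M.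
Proof.
elim: s => [|i s [M M0 HM]].
  by exists 0 => // x; rewrite step_nil Normc.normc0.
exists (nc (ratr i.1.1 +i* ratr i.1.2)%C + M); first by rewrite addr_ge0// normc_ge0.
move=> x; rewrite step_cons; apply: le_trans (le_normcD _ _) _; apply: lerD => //.
case: (x <= _); first by rewrite mulr1.
by rewrite mulr0 Normc.normc0 normc_ge0.
Qed.

Lemma cmeas_step d (T : measurableType d) (k : T -> R) s : measurable_fun setT k ->
  cmeas (fun t : T => step s (k t)).
Proof.
move=> mk; elim: s => [|i s IH].
  by under eq_fun do rewrite step_nil; exact: cmeas_cst.
under eq_fun do rewrite step_cons.
apply: cmeasD => //; apply: cmeasM; first exact: cmeas_cst.
have -> : (fun t : T => (k t <= ratr i.2)%R%:R : C) =
    (fun t => if k t <= ratr i.2 then 1 else 0 : C).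
  by apply/funext => t; case: ifP.
by apply: cmeas_if; [exact: measurable_fun_ler|exact: cmeas_cst|exact: cmeas_cst].
Qed.

Lemma atan_lip x y : `|atan x - atan y| <= `|x - y|.
Proof.
wlog xy : x y / x <= y => [H|].
  by have [/H//|/ltW/H] := leP x y; rewrite distrC [leRHS]distrC.
have [c _ E] : exists2 c, c \in `[x, y] & atan y - atan x = (1 + c ^+ 2)^-1 * (y - x).
  apply: MVT_segment => //.
  by apply: continuous_subspaceT => w; exact: continuous_atan.
rewrite distrC E normrM [leRHS]distrC ler_piMl// ger0_norm.
  by rewrite invf_le1 ?lerDl ?sqr_ge0// ltr_pwDl// sqr_ge0.
by rewrite invr_ge0 addr_ge0// sqr_ge0.
Qed.

Lemma mu_halflines x y :
  measurable [set z | (to_line z <= x) != (to_line z <= y)] /\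
  (mu [set z | ((to_line z <= x) != (to_line z <= y))%R] <= `|x - y|%:E)%E.
Proof.
wlog xy : x y / x <= y => [H|].
  have [/H//|/ltW/H] := leP x y; rewrite distrC.
  have -> // : [set z | (to_line z <= y) != (to_line z <= x)] =
    [set z | (to_line z <= x) != (to_line z <= y)].
  by apply/seteqP; split => z /=; rewrite eq_sym.
have -> : [set z | (to_line z <= x) != (to_line z <= y)] =
    [set z | x < to_line z <= y].
  by apply/seteqP; split => z /=; case: (leP _ x) => h1; case: (leP _ y) => h2 //=; lra.
split.
  have := measurable_to_line_set omega (measurable_itv `]x, y]).
  by congr measurable; apply/seteqP; split => z /=; rewrite in_itv.
rewrite mu_interval// lee_fin ler_pdivrMr ?pi_gt0//.
have := atan_lip y x; rewrite distrC [X in _ <= X]distrC.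
have p2 := @pi_ge2 R; have := normr_ge0 (x - y).
move=> h1 h2; apply: le_trans (_ : `|atan y - atan x| <= _); first exact: ler_norm.
by rewrite distrC; apply: le_trans h2 _; nra.
Qed.

Lemma sqd_halflines (c : C) x y :
  (sqd mu (fun z => (c * (to_line z <= x)%R%:R)%R) (fun z => (c * (to_line z <= y)%R%:R)%R) <=
   ((2 * nc c) ^+ 2 * `|x - y|)%R%:E)%E.
Proof.
have [mE E1] := mu_halflines x y.
have mh t : cmeas (fun z => c * (to_line z <= t)%R%:R).
  apply: cmeasM; first exact: cmeas_cst.
  have -> : (fun z => (to_line z <= t)%R%:R : C) = (fun z => if to_line z <= t then 1 else 0 : C).
    by apply/funext => z; case: ifP.
  apply: cmeas_if; [|exact: cmeas_cst|exact: cmeas_cst].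
  by apply: measurable_fun_ler => //; exact: measurable_to_line.
have bh t z : nc (c * (to_line z <= t)%R%:R) <= nc c.
  case: (to_line z <= t); first by rewrite mulr1.
  by rewrite mulr0 Normc.normc0 normc_ge0.
apply: (le_trans (sqd_small (mh x) (mh y) (bh x) (bh y) mE _)).
  by move=> z /negP; rewrite negbK => /eqP ->.
by rewrite [leRHS]EFinM; apply: lee_wpmul2l => //; rewrite lee_fin sqr_ge0.
Qed.

(** A breakpoint [q] moves to [(q - b) / a], and the mass between two breakpoints is at most their
    distance. *)
Lemma step_affc_continuous s a0 b0 e : 0 < a0 -> 0 < e -> exists2 d : R, 0 < d &
  forall a b, `|a - a0| < d -> `|b - b0| < d -> 0 < a /\
    (sqd mu (fun z => step s (to_line (affc a b z)))
           (fun z => step s (to_line (affc a0 b0 z))) < e%:E)%E.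
Proof.
move=> a00; have half a : `|a - a0| < a0 / 2 -> a0 / 2 < a.
  by rewrite ltr_norml => /andP[]; lra.
have ms a b s' : cmeas (fun z => step s' (to_line (affc a b z))).
  apply: cmeas_step; apply: (measurableT_comp (measurable_to_line omega)).
  exact: measurable_affc.
elim: s e => [|i s IH] e e0.
  exists (a0 / 2); first by rewrite divr_gt0.
  move=> a b /half aa _; split; first lra.
  rewrite (_ : (fun z => _) = (fun z => step [::] (to_line (affc a0 b0 z)))).
    by rewrite sqdxx lte_fin.
  by apply/funext => z; rewrite !step_nil.
have [|d1 d10 H1] := IH (e / 4); first by rewrite divr_gt0.
pose c : C := (ratr i.1.1 +i* ratr i.1.2)%C; pose q : R := ratr i.2.
pose K := (2 * nc c) ^+ 2 * ((a0 + `|q - b0|) / (a0 / 2 * a0)).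
have K0 : 0 <= K.
  rewrite mulr_ge0 ?sqr_ge0// divr_ge0// ?addr_ge0 ?(ltW a00)//.
  by rewrite mulr_ge0 ?divr_ge0 ?ltW.
pose d := Num.min (Num.min d1 (a0 / 2)) (e / (8 * (K + 1))).
have d0 : 0 < d.
  by rewrite !lt_min d10 divr_gt0//= divr_gt0// mulr_gt0// ltr_wpDl.
exists d => // a b; rewrite !lt_min => /andP[/andP[ad1 aa] ae] /andP[/andP[bd1 ba] be].
have a2 := half _ aa; have ap : 0 < a by lra.
split => //; have [_ H] := H1 _ _ ad1 bd1.
pose t := (q - b) / a; pose t0 := (q - b0) / a0.
have hE a' b' : 0 < a' -> (fun z => step (i :: s) (to_line (affc a' b' z))) =
    (fun z => c * (to_line z <= (q - b') / a')%R%:R + step s (to_line (affc a' b' z))).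
  move=> a'0; apply/funext => z; rewrite step_cons; congr (_ * _ + _).
  by rewrite [in RHS]ler_pdivlMr// [in RHS]lerBrDr /affc of_lineK [_ * a']mulrC.
have mh x : cmeas (fun z => c * (to_line z <= x)%R%:R).
  apply: cmeasM; first exact: cmeas_cst.
  have -> : (fun z => (to_line z <= x)%R%:R : C) = (fun z => if to_line z <= x then 1 else 0 : C).
    by apply/funext => z; case: ifP.
  apply: cmeas_if; [|exact: cmeas_cst|exact: cmeas_cst].
  by apply: measurable_fun_ler => //; exact: measurable_to_line.
rewrite !hE//; apply: le_lt_trans (sqd_add _ (mh _) (mh _) (ms _ _ _) (ms _ _ _)) _.
have ad : `|a - a0| <= d by rewrite ltW// !lt_min ad1 aa.
have bd : `|b - b0| <= d by rewrite ltW// !lt_min bd1 ba.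
have tt : `|t - t0| <= d * ((a0 + `|q - b0|) / (a0 / 2 * a0)).
  have -> : t - t0 = ((b0 - b) * a0 + (q - b0) * (a0 - a)) / (a * a0).
    by rewrite /t /t0; field; rewrite !gt_eqF.
  rewrite normrM normfV mulrA; apply: ler_pM; rewrite ?invr_ge0//.
    apply: le_trans (ler_normD _ _) _; rewrite !normrM mulrDr; apply: lerD.
      by rewrite (gtr0_norm a00) ler_pM2r// distrC.
    by rewrite mulrC [`|a0 - a|]distrC ler_wpM2r.
  rewrite gtr0_norm ?mulr_gt0// lef_pV2 ?posrE ?mulr_gt0 ?divr_gt0//.
  by rewrite ler_pM2r// ltW.
have q1 : (2 * nc c) ^+ 2 * `|t - t0| <= e / 8.
  apply: le_trans (ler_wpM2l (sqr_ge0 _) tt) _.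
  have -> : (2 * nc c) ^+ 2 * (d * ((a0 + `|q - b0|) / (a0 / 2 * a0))) = K * d.
    by rewrite /K; ring.
  have dK : d <= e / (8 * (K + 1)) by rewrite ge_min lexx orbT.
  have K1 : 0 < K + 1 by rewrite ltr_wpDl.
  apply: le_trans (ler_wpM2l K0 dK) _.
  have -> : K * (e / (8 * (K + 1))) = e / 8 * (K / (K + 1)) by field; rewrite gt_eqF.
  by apply: ler_piMr; [rewrite divr_ge0// ltW|rewrite ler_pdivrMr// mul1r lerDl].
have h1 := le_trans (sqd_halflines c t t0) (_ : _ <= (e / 8)%:E)%E.
have {}h1 := h1 ltac:(by rewrite lee_fin).
apply: (@le_lt_trans _ _ (2%:E * (e / 8)%:E + 2%:E * (e / 4)%:E)%E).
  by apply: leeD; [exact: lee_wpmul2l|apply: lee_wpmul2l => //; exact: ltW].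
by rewrite -!EFinM -EFinD lte_fin; lra.
Qed.

End step_functions.

(** * Approximation of indicators by step functions *)

Section step_dense.
Context {R : realType}.
Variable omega : circle R.
Local Notation C := (plane R).
Local Notation nc := (@Normc.normc R).
Local Notation mu := (@arc_measure R).
Local Notation to_line := (to_line omega).
Local Notation of_line := (of_line omega).
Implicit Types (a b x y r p e : R) (f g : circle R -> C) (z : circle R).

Definition step_approx f := forall e, 0 < e ->
  exists s, (sqd mu f (fun z => step s (to_line z)) < e%:E)%E.

Let mstep s : cmeas (fun z => step s (to_line z)) := cmeas_step s (measurable_to_line omega).

Lemma step_approx_lim f : cmeas f ->
  (forall e, 0 < e -> exists g, [/\ cmeas g, step_approx g & (sqd mu f g < e%:E)%E]) ->
  step_approx f.
Proof.
move=> mf H e e0; have e4 : 0 < e / 4 by rewrite divr_gt0.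
have [g [mg Dg fg]] := H _ e4; have [s gs] := Dg _ e4; exists s.
apply: le_lt_trans (sqd_triangle _ mf mg (mstep s)) _.
apply: (@lt_le_trans _ _ (2%:E * (e / 4)%:E + 2%:E * (e / 4)%:E)%E).
  by apply: lteD; rewrite lte_pmul2l.
by rewrite -!EFinM -EFinD lee_fin; lra.
Qed.

Lemma step_approxD f g : cmeas f -> cmeas g -> step_approx f -> step_approx g ->
  step_approx (fun z => f z + g z).
Proof.
move=> mf mg Df Dg e e0; have e4 : 0 < e / 4 by rewrite divr_gt0.
have [s fs] := Df _ e4; have [t gt] := Dg _ e4; exists (s ++ t).
have -> : (fun z => step (s ++ t) (to_line z)) =
    (fun z => step s (to_line z) + step t (to_line z)).
  by apply/funext => z; rewrite step_cat.
apply: le_lt_trans (sqd_add _ mf (mstep _) mg (mstep _)) _.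
apply: (@lt_le_trans _ _ (2%:E * (e / 4)%:E + 2%:E * (e / 4)%:E)%E).
  by apply: lteD; rewrite lte_pmul2l.
by rewrite -!EFinM -EFinD lee_fin; lra.
Qed.

Lemma sqd_scale (c : C) f g : cmeas f -> cmeas g ->
  sqd mu (fun z => (c * f z)%R) (fun z => (c * g z)%R) = ((nc c ^+ 2)%:E * sqd mu f g)%E.
Proof.
move=> mf mg; rewrite /sqd -ge0_integralZl//; last 3 first.
- exact: cmeas_sqnorm (cmeasB mf mg).
- by move=> z _; rewrite lee_fin sqr_ge0.
- by rewrite lee_fin sqr_ge0.
by apply: eq_integral => z _; rewrite -EFinM -exprMn -Normc.normcM mulrBr.
Qed.

Lemma rat_near x e : 0 < e -> exists q : rat, `|x - ratr q| < e.
Proof.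
move=> e0; have xe : x - e < x + e by lra.
have [q] := rat_in_itvoo xe; rewrite in_itv /= => /andP[? ?].
by exists q; rewrite ltr_norml; apply/andP; split; lra.
Qed.

Lemma ratc_near (c : C) e : 0 < e ->
  exists q : rat * rat, nc (c - (ratr q.1 +i* ratr q.2)%C) < e.
Proof.
move=> e0; have e2 : 0 < e / 2 by rewrite divr_gt0.
have [p hp] := rat_near (complex.Re c) e2; have [q hq] := rat_near (complex.Im c) e2.
exists (p, q); apply: le_lt_trans (normc_le_Re_Im _) _.
by case: c hp hq => u v /= hp hq; rewrite [ltRHS]splitr ltrD.
Qed.

(** The coefficient has to become rational too; [s] is chosen first, since the precision [t]
    required of the coefficient depends on the bound [M] of [step s]. *)
Lemma step_approxZ (c : C) f : cmeas f -> step_approx f -> step_approx (fun z => c * f z).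
Proof.
move=> mf Df e e0; pose k := nc c ^+ 2 + 1.
have k0 : 0 < k by rewrite ltr_wpDl ?sqr_ge0.
have [|s fs] := Df (e / (8 * k)); first by rewrite divr_gt0// mulr_gt0.
have [M M0 HM] := @step_bounded R s.
pose t := Num.min 1 (e / (4 * (M ^+ 2 + 1))).
have M1 : 0 < M ^+ 2 + 1 by rewrite ltr_wpDl ?sqr_ge0.
have t0 : 0 < t by rewrite lt_min ltr01 divr_gt0// mulr_gt0.
have [q cq] := ratc_near c t0.
exists [seq ((q.1 * i.1.1 - q.2 * i.1.2, q.1 * i.1.2 + q.2 * i.1.1), i.2) | i <- s].
set c' : C := (ratr q.1 +i* ratr q.2)%C in cq.
have -> : (fun z => step [seq ((q.1 * i.1.1 - q.2 * i.1.2, q.1 * i.1.2 + q.2 * i.1.1), i.2) | i <- s] (to_line z)) =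
    (fun z => c' * step s (to_line z)).
  by apply/funext => z; rewrite step_scale.
have mc (b : C) : cmeas (fun z => b * step s (to_line z)).
  by apply: cmeasM => //; exact: cmeas_cst.
have mcf : cmeas (fun z => c * f z) by apply: cmeasM => //; exact: cmeas_cst.
apply: le_lt_trans (sqd_triangle _ mcf (mc c) (mc c')) _.
have h1 : (sqd mu (fun z => (c * f z)%R) (fun z => (c * step s (to_line z))%R) <= (e / 8)%:E)%E.
  rewrite sqd_scale//; apply: le_trans (lee_wpmul2l _ (ltW fs)) _.
    by rewrite lee_fin sqr_ge0.
  rewrite -EFinM lee_fin.
  have -> : nc c ^+ 2 * (e / (8 * k)) = e / 8 * (nc c ^+ 2 / k) by field; rewrite gt_eqF.
  by apply: ler_piMr; [rewrite divr_ge0// ltW|rewrite ler_pdivrMr// mul1r lerDl].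
have h2 : (sqd mu (fun z => (c * step s (to_line z))%R) (fun z => (c' * step s (to_line z))%R) < (e / 4)%:E)%E.
  apply: (@le_lt_trans _ _ (\int[mu]_z ((t * M) ^+ 2)%:E)%E).
    apply: ge0_le_integral => //.
    - by move=> z _; rewrite lee_fin sqr_ge0.
    - exact: cmeas_sqnorm (cmeasB (mc c) (mc c')).
    move=> z _; rewrite lee_fin -mulrBl Normc.normcM ler_pXn2r ?nnegrE ?mulr_ge0 ?normc_ge0 ?(ltW t0)//.
    by rewrite ler_pM ?normc_ge0// ltW.
  rewrite integral_cst//= arc_measureT mule1 lte_fin exprMn.
  have t1 : t <= 1 by rewrite ge_min lexx.
  have tM : t <= e / (4 * (M ^+ 2 + 1)) by rewrite ge_min lexx orbT.
  apply: le_lt_trans (_ : t * M ^+ 2 < _).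
    by rewrite ler_wpM2r ?sqr_ge0// expr2 ler_piMl// ltW.
  apply: le_lt_trans (ler_wpM2r (sqr_ge0 M) tM) _.
  have -> : e / (4 * (M ^+ 2 + 1)) * M ^+ 2 = e / 4 * (M ^+ 2 / (M ^+ 2 + 1)) by field; rewrite gt_eqF.
  rewrite -[ltRHS]mulr1 ltr_pM2l ?divr_gt0//.
  by rewrite ltr_pdivrMr// mul1r ltrDl.
apply: (@le_lt_trans _ _ (2%:E * (e / 8)%:E + 2%:E * (e / 4)%:E)%E).
  by apply: leeD; apply: lee_wpmul2l => //; exact: ltW.
by rewrite -!EFinM -EFinD lte_fin; lra.
Qed.

Lemma step_approx_ae f g : cmeas f -> cmeas g -> {ae mu, forall z, f z = g z} ->
  step_approx f -> step_approx g.
Proof.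
move=> mf mg fg Df e /Df[s fs]; exists s.
rewrite -(@eq_sqd_ae _ _ _ mu f g (fun z => step s (to_line z)) (fun z => step s (to_line z)))//.
exact: nearW.
Qed.

Definition cindic (A : set (circle R)) z : C := (\1_A z)%:C%C.

Lemma cmeas_cindic A : measurable A -> cmeas (cindic A).
Proof. by move=> mA; apply: cmeas_real; exact: measurable_indic. Qed.

Lemma normc_cindic A z : nc (cindic A z) <= 1.
Proof.
rewrite /cindic normc_real indicE; case: (z \in A); first by rewrite normr1.
by rewrite normr0.
Qed.

Lemma sqd_cindic A B : measurable A -> measurable B ->
  (sqd mu (cindic A) (cindic B) <= 4%:E * mu ((A `\` B) `|` (B `\` A)))%E.
Proof.
move=> mA mB; have -> : 4 = (2 * 1) ^+ 2 :> R by ring.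
apply: sqd_small.
- exact: cmeas_cindic.
- exact: cmeas_cindic.
- exact: normc_cindic.
- exact: normc_cindic.
- by apply: measurableU; exact: measurableD.
move=> z zAB; rewrite /cindic !indicE.
suff -> : (z \in A) = (z \in B) by [].
apply/idP/idP => /set_mem h; apply/mem_set; apply: contrapT => h'; apply: zAB.
  by left.
by right.
Qed.

Let line_set (B : set R) := [set z | B (to_line z)].

Let mline (B : set R) : measurable B -> measurable (line_set B).
Proof. exact: measurable_to_line_set. Qed.

(** The constant 1 is not of the form [step s], which vanishes beyond its last breakpoint; a far
    breakpoint suffices because tails have small mass. *)
Let approxT : step_approx (cindic setT).
Proof.
move=> e e0; have [|A A0 HA] := @mu_tail R omega (e / 8); first by rewrite divr_gt0.
have AA : A < A + 1 by rewrite ltrDl.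
have [q] := rat_in_itvoo AA; rewrite in_itv /= => /andP[Aq _].
exists [:: ((1, 0), q)].
pose T := [set z | A < `|to_line z|].
have mT : measurable T.
  have := mline (measurableC (measurable_itv `[- A, A])).
  by congr measurable; apply/seteqP; split => z /=; rewrite /T /line_set /= in_itv /= ltNge ler_norml => /negP.
have sE x : step [:: ((1, 0), q)] x = (x <= ratr q)%R%:R.
  by rewrite step_cons step_nil addr0 rmorph1 rmorph0 mul1r.
have b2 z : nc (step [:: ((1, 0), q)] (to_line z)) <= 1.
  rewrite sE; case: (to_line z <= _); first by rewrite Normc.normc1.
  by rewrite Normc.normc0.
apply: (le_lt_trans (sqd_small (cmeas_cindic measurableT) (mstep _) (@normc_cindic setT) b2 mT _)).
  move=> z /negP; rewrite -leNgt ler_norml => /andP[_ zA].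
  by rewrite sE /cindic indicT (le_trans zA (ltW Aq)).
rewrite mulr1; apply: (@le_lt_trans _ _ ((2 ^+ 2)%:E * (e / 8)%:E)%E).
  by apply: lee_wpmul2l => //; rewrite lee_fin sqr_ge0.
by rewrite -EFinM lte_fin; lra.
Qed.

Let approxC A : measurable A -> step_approx (cindic A) -> step_approx (cindic (~` A)).
Proof.
move=> mA DA; have -> : cindic (~` A) = (fun z => cindic setT z + (-1) * cindic A z).
  apply/funext => z; rewrite /cindic !indicE in_setC in_setT.
  by case: (z \in A) => /=; rewrite ?mulr1 ?mulr0 ?addr0// subrr.
apply: step_approxD => //; first exact: cmeas_cindic.
  by apply: cmeasM; [exact: cmeas_cst|exact: cmeas_cindic].
by apply: step_approxZ => //; exact: cmeas_cindic.
Qed.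

Let approx_ray x : step_approx (cindic (line_set `]-oo, x])).
Proof.
move=> e e0; have [|q xq] := @rat_near x (e / 8); first by rewrite divr_gt0.
exists [:: ((1, 0), q)].
have -> : cindic (line_set `]-oo, x]) = (fun z => 1 * (to_line z <= x)%R%:R).
  apply/funext => z; rewrite /cindic indicE mul1r.
  have -> : (z \in line_set `]-oo, x]) = (to_line z <= x).
    by apply/idP/idP; rewrite inE /line_set /= in_itv.
  by case: (to_line z <= x).
have -> : (fun z => step [:: ((1, 0), q)] (to_line z)) = (fun z => 1 * (to_line z <= ratr q)%R%:R).
  by apply/funext => z; rewrite step_cons step_nil addr0 rmorph1 rmorph0.
apply: le_lt_trans (sqd_halflines _ _ _ _) _; rewrite Normc.normc1 mulr1 lte_fin.
by have := normr_ge0 (x - ratr q); lra.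
Qed.

Let approxU A B : measurable A -> measurable B -> A `&` B = set0 ->
  step_approx (cindic A) -> step_approx (cindic B) -> step_approx (cindic (A `|` B)).
Proof.
move=> mA mB AB DA DB.
have -> : cindic (A `|` B) = (fun z => cindic A z + cindic B z).
  apply/funext => z; rewrite /cindic !indicE in_setU.
  have [zA|zA] := boolP (z \in A); have [zB|zB] := boolP (z \in B) => //=;
    rewrite ?addr0 ?add0r//.
  by move: zA zB => /set_mem zA /set_mem zB; have : (A `&` B) z by []; rewrite AB.
by apply: step_approxD => //; exact: cmeas_cindic.
Qed.

Let approx_bigcup (F : (set (circle R))^nat) : (forall n, measurable (F n)) ->
  trivIset setT F -> (forall n, step_approx (cindic (F n))) ->
  step_approx (cindic (\bigcup_k F k)).
Proof.
move=> mF tF DF.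
pose U n := \big[setU/set0]_(k < n) F k.
have mU n : measurable (U n) by apply: bigsetU_measurable.
have mUF : measurable (\bigcup_k F k) by exact: bigcupT_measurable.
have UF n : U n `<=` \bigcup_k F k by rewrite /U -bigcup_mkord => z [k _ Fz]; exists k.
have DU n : step_approx (cindic (U n)).
  elim: n => [|n IH].
    rewrite /U big_ord0 -setCT; exact: approxC.
  rewrite /U big_ord_recr /=; apply: (approxU (mU n) (mF n)) => //.
  rewrite /U -bigcup_mkord; apply/seteqP; split => z //= [[k /= kn Fk] Fn].
  move/trivIsetP : tF => /(_ k n I I); rewrite neq_ltn kn => /(_ isT) tF.
  by have : (F k `&` F n) z by []; rewrite tF.
apply: step_approx_lim; first exact: cmeas_cindic.
move=> e e0.
have fin A : measurable A -> mu A \is a fin_num.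
  by move=> mA; rewrite ge0_fin_numE ?measure_ge0// (le_lt_trans (@probability_le1 _ _ _ (@arc_measure R) A mA))// ltry.
have UE : \bigcup_k U k.+1 = \bigcup_k F k by rewrite /U bigcup_bigsetU_bigcup.
have : mu (U n.+1) @[n --> \oo] --> mu (\bigcup_k F k).
  rewrite -UE; apply: (@nondecreasing_cvg_mu _ _ _ mu (fun n => U n.+1)) => //.
    by rewrite UE.
  by apply/nondecreasing_seqP => n; rewrite /U [X in (_ <= X)%O]big_ord_recr /=; apply/subsetPset; left.
rewrite -[X in _ --> X]fineK ?fin// => /fine_cvgP[_] /cvgrPdist_lt /(_ (e / 4)) [].
  by rewrite divr_gt0.
move=> N _ /(_ N (leqnn N)) /= HN; exists (cindic (U N.+1)); split => //.
  exact: cmeas_cindic.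
apply: le_lt_trans (sqd_cindic mUF (mU _)) _.
have -> : (U N.+1 `\` \bigcup_k F k) = set0 by rewrite setD_eq0; exact: UF.
rewrite setU0; have -> : mu (\bigcup_k F k `\` U N.+1) = (mu (\bigcup_k F k) - mu (U N.+1))%E.
  rewrite -{2}(setIidr (UF N.+1)); apply: measureD => //.
  by rewrite -ge0_fin_numE// fin.
rewrite -(fineK (fin _ mUF)) -(fineK (fin _ (mU N.+1))) -EFinB -EFinM lte_fin.
by move: HN; rewrite ltr_norml => /andP[_]; lra.
Qed.

(** Dynkin's theorem: the rays generate the Borel sets of the line, and sets with approximable
    preimage are closed under complements and countable disjoint unions. *)
Let approx_line (B : set (measurableTypeR R)) : measurable B ->
  step_approx (cindic (line_set B)).
Proof.
move=> mB.
apply: (@dynkin_induction _ (measurableTypeR R) (@RGenOInfty.G R)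
   (fun B : set R => step_approx (cindic (line_set B)))).
- exact: RGenOInfty.measurableE.
- move=> _ _ [x ->] [y ->]; exists (Num.max x y).
  by apply/seteqP; split => t /=; rewrite !in_itv /= !andbT gt_max => /andP.
- exact: approxT.
- move=> _ [x ->].
  have -> : line_set `]x, +oo[ = ~` line_set `]-oo, x].
    apply/seteqP; split => z; rewrite /line_set /= !in_itv /= andbT ltNge.
      by move=> /negP.
    by move=> /negP.
  by apply: approxC; [exact: mline|exact: approx_ray].
- move=> S mS DS; have -> : line_set (~` S) = ~` line_set S by [].
  by apply: approxC => //; exact: mline.
- move=> F mF tF DF.
  have -> : line_set (\bigcup_k F k) = \bigcup_k line_set (F k) by [].
  apply: (approx_bigcup (fun n => mline (mF n))) => //.
  apply/trivIsetP => i j _ _ ij; apply/seteqP; split => z //= [zi zj].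
  move/trivIsetP : tF => /(_ i j I I ij) FF.
  by have : (F i `&` F j) (to_line z) by []; rewrite FF.
suff -> : <<s @RGenOInfty.G R >> = @measurable _ (measurableTypeR R) by [].
by apply/esym; exact: RGenOInfty.measurableE.
Qed.

Lemma step_approx_cindic A : measurable A -> step_approx (cindic A).
Proof.
move=> mA; have mB : measurable (of_line @^-1` A : set (measurableTypeR R)).
  by rewrite -[X in measurable X]setTI; exact: measurable_of_line.
apply: (step_approx_ae _ _ _ (approx_line mB)); [|exact: cmeas_cindic|].
  exact: cmeas_cindic (mline mB).
apply: filterS (to_lineK_ae omega) => z zE.
rewrite /cindic !indicE; suff -> : (z \in line_set (of_line @^-1` A)) = (z \in A) by [].
by apply/idP/idP; rewrite !inE /line_set /= zE.
Qed.

End step_dense.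

(** * Density of step functions in L2 *)

Section step_dense_L2.
Context {R : realType}.
Variable omega : circle R.
Local Notation C := (plane R).
Local Notation nc := (@Normc.normc R).
Local Notation mu := (@arc_measure R).
Implicit Types (e : R) (f : circle R -> C) (z : circle R).
Local Notation step_approx := (step_approx omega).

Import HBNNSimple.

Lemma step_approx0 : step_approx (fun=> 0).
Proof.
move=> e e0; exists [::].
have -> : (fun z => step [::] (to_line omega z)) = (fun=> 0).
  by apply/funext => z; rewrite step_nil.
by rewrite sqdxx lte_fin.
Qed.

Lemma step_approx_simple (g : {nnsfun circle R >-> R}) : step_approx (fun z => (g z)%:C%C).
Proof.
pose A y := g @^-1` [set y].
have mA y : measurable (A y) by exact: measurable_sfunP.
have mt y : cmeas (fun z => (y%:C%C : C) * cindic (A y) z).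
  by apply: cmeasM; [exact: cmeas_cst|exact: cmeas_cindic].
have [s gE] : exists s : seq R, forall z, (g z)%:C%C = \sum_(y <- s) (y%:C%C : C) * cindic (A y) z.
  exists (finmap.enum_fset (fset_set (range g))) => z.
  rewrite fimfunE fsbig_finite//= raddf_sum /=; apply: eq_bigr => y _.
  by rewrite rmorphM.
under eq_fun do rewrite gE.
suff : cmeas (fun z => \sum_(y <- s) (y%:C%C : C) * cindic (A y) z) /\
    step_approx (fun z => \sum_(y <- s) (y%:C%C : C) * cindic (A y) z) by case.
elim: s {gE} => [|y s [IH1 IH2]].
  under eq_fun do rewrite big_nil.
  by split; [exact: cmeas_cst|exact: step_approx0].
under eq_fun do rewrite big_cons.
split; first exact: cmeasD.
apply: step_approxD => //; apply: step_approxZ; first exact: cmeas_cindic.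
exact: step_approx_cindic.
Qed.

(** Simple functions increase to [h]; dominated convergence, with [h ^+ 2] dominating, makes the
    squared distances tend to 0. *)
Lemma step_approx_nonneg (h : circle R -> R) : measurable_fun setT h ->
  (forall z, 0 <= h z) -> (\int[mu]_z (h z ^+ 2)%:E < +oo)%E ->
  step_approx (fun z => (h z)%:C%C).
Proof.
move=> mh h0 hfin; apply: step_approx_lim; first exact: cmeas_real.
move=> e e0; have mhE : measurable_fun setT (EFin \o h) by exact/measurable_EFinP.
pose g n := nnsfun_approx measurableT mhE n.
have gc z : g k z @[k --> \oo] --> h z.
  have : (EFin \o g ^~ z) @ \oo --> (h z)%:E.
    by apply: cvg_nnsfun_approx => //= x _; rewrite lee_fin.
  by move/fine_cvgP => [].
have gh n z : g n z <= h z.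
  rewrite -(cvg_lim _ (gc z))//; apply: (@nondecreasing_cvgn_le R (fun k => g k z)).
    by move=> i j ij; have /lefP := nd_nnsfun_approx measurableT mhE ij; apply.
  by apply/cvg_ex; exists (h z).
pose F n z := ((h z - g n z) ^+ 2)%:E.
have mF n : measurable_fun setT (F n).
  by apply/measurable_EFinP; apply: measurable_funX; apply: measurable_funB.
have Fc : {ae mu, forall z, setT z -> F ^~ z @ \oo --> 0%E}.
  apply: nearW => z _; apply: cvg_EFin; first exact: nearW.
  rewrite [X in _ --> X](_ : _ = (h z - h z) * (h z - h z)); last by rewrite subrr mulr0.
  by apply: cvgM; apply: cvgB; [exact: cvg_cst|exact: gc|exact: cvg_cst|exact: gc].
have ih : mu.-integrable setT (fun z => (h z ^+ 2)%:E).
  apply/integrableP; split; first by apply/measurable_EFinP; exact: measurable_funX.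
  rewrite (_ : (\int[mu]_z _)%E = (\int[mu]_z (h z ^+ 2)%:E)%E)//.
  by apply: eq_integral => z _; rewrite gee0_abs// lee_fin sqr_ge0.
have Fh : {ae mu, forall z n, setT z -> (`|F n z| <= (h z ^+ 2)%:E)%E}.
  apply: nearW => z n _; rewrite gee0_abs ?lee_fin ?sqr_ge0//.
  by rewrite ler_pXn2r ?nnegrE ?subr_ge0 ?gh// gerBl.
have [_ _] := dominated_convergence measurableT mF (measurable_cst _) Fc ih Fh.
rewrite integral0 => /fine_cvgP[Ffin /cvgrPdist_lt /(_ _ e0) Fe].
have [N _ HN] := filterI Ffin Fe.
have [/= fN eN] := HN N (leqnn N).
exists (fun z => (g N z)%:C%C); split.
- by apply: cmeas_real.
- exact: step_approx_simple.
rewrite (_ : sqd _ _ _ = \int[mu]_z F N z)%E; last first.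
  apply: eq_integral => z _; rewrite -rmorphB normc_real /F; congr EFin.
  by rewrite real_normK// num_real.
move: eN; rewrite sub0r normrN ger0_norm ?fine_ge0 ?integral_ge0//; last first.
  by move=> z _; rewrite lee_fin sqr_ge0.
by move=> eN; rewrite -(fineK fN) lte_fin.
Qed.

Lemma step_approx_real (u : circle R -> R) : measurable_fun setT u ->
  (\int[mu]_z (u z ^+ 2)%:E < +oo)%E -> step_approx (fun z => (u z)%:C%C).
Proof.
move=> mu_ ufin.
have part (v : circle R -> R) : measurable_fun setT v -> (forall z, 0 <= v z <= `|u z|) ->
    step_approx (fun z => (v z)%:C%C).
  move=> mv vu; apply: step_approx_nonneg => //; first by move=> z; case/andP: (vu z).
  apply: le_lt_trans ufin; apply: ge0_le_integral => //.
  - by move=> z _; rewrite lee_fin sqr_ge0.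
  - by apply/measurable_EFinP; exact: measurable_funX.
  - by apply/measurable_EFinP; exact: measurable_funX.
  move=> z _; rewrite lee_fin -[leRHS]real_normK ?num_real//.
  by have /andP[v0 vz] := vu z; rewrite ler_pXn2r ?nnegrE.
have -> : (fun z => (u z)%:C%C) =
    (fun z => (Num.max (u z) 0)%:C%C + (-1) * (Num.max (- u z) 0)%:C%C : C).
  apply/funext => z; rewrite mulN1r -rmorphB /=; congr (_%:C)%C.
  by have [h|h] := leP (u z) 0; have [k|k] := leP (- u z) 0; lra.
have m1 : measurable_fun setT (fun z => Num.max (u z) 0) by exact: measurable_maxr.
have m2 : measurable_fun setT (fun z => Num.max (- u z) 0).
  by apply: measurable_maxr => //; exact: measurableT_comp.
apply: step_approxD; [exact: cmeas_real| |apply: part => //|].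
- by apply: cmeasM; [exact: cmeas_cst|exact: cmeas_real].
- move=> z; rewrite le_max lexx orbT /=; have [h|h] := leP (u z) 0 => //.
  exact: ler_norm.
apply: step_approxZ; first exact: cmeas_real.
apply: part => // z; rewrite le_max lexx orbT /=; have [h|h] := leP (- u z) 0 => //.
by rewrite -normrN ler_norm.
Qed.

Lemma step_approx_L2 f : cmeas f -> (sqd mu f (fun=> 0%R) < +oo)%E -> step_approx f.
Proof.
move=> [mRe mIm] ffin.
have part (u : circle R -> R) : measurable_fun setT u -> (forall z, `|u z| <= nc (f z)) ->
    step_approx (fun z => (u z)%:C%C).
  move=> mu_ uf; apply: step_approx_real => //; apply: le_lt_trans ffin.
  apply: ge0_le_integral => //.
  - by move=> z _; rewrite lee_fin sqr_ge0.
  - by apply/measurable_EFinP; exact: measurable_funX.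
  - by apply: cmeas_sqnorm; apply: cmeasB => //; exact: cmeas_cst.
  move=> z _; rewrite lee_fin subr0 -[leLHS]real_normK ?num_real//.
  by rewrite ler_pXn2r ?nnegrE ?normc_ge0.
have -> : f = (fun z => (complex.Re (f z))%:C%C + 'i%C * (complex.Im (f z))%:C%C).
  by apply/funext => z; exact: complexE.
apply: step_approxD.
- exact: cmeas_real.
- by apply: cmeasM; [exact: cmeas_cst|exact: cmeas_real].
- by apply: part => // z; exact: normr_Re_le.
apply: step_approxZ; first exact: cmeas_real.
by apply: part => // z; exact: normr_Im_le.
Qed.

End step_dense_L2.

(** * The operators given by affine maps and their joint continuity *)

Section affine_operator.
Context {R : realType}.
Variable omega : circle R.
Local Notation C := (plane R).
Local Notation mu := (@arc_measure R).
Local Notation affc := (affc omega).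
Implicit Types (a b e : R) (f g : L2 R).

Definition aff_op a b f : L2 R := L2class (fun z => f (affc a b z)).

Lemma cmeas_affc_L2 a b f : cmeas (fun z => f (affc a b z)).
Proof. by apply: cmeas_affc; exact: cmeas_L2. Qed.

Lemma aff_op_ae a b f : 0 < a -> {ae mu, forall z, aff_op a b f z = f (affc a b z)}.
Proof.
move=> a0; apply: L2class_ae; first exact: cmeas_affc_L2.
have /le_lt_trans := @sqd_affc_le R omega a b f (fun=> 0) a0 (cmeas_L2 f) (cmeas_cst _ 0).
apply.
have := sqd_L2_fin f; rewrite -ge0_fin_numE ?sqd_ge0// => /fineK <-.
by rewrite -EFinM ltry.
Qed.

Lemma aff_op_comp a b c d f : 0 < a -> 0 < c ->
  aff_op a b (aff_op c d f) = aff_op (c * a) (c * b + d) f.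
Proof.
move=> a0 c0; apply: L2_eq_ae.
have h1 := aff_op_ae b (aff_op c d f) a0.
have h2 := ae_affc omega b a0 (aff_op_ae d f c0).
have h3 := aff_op_ae (c * b + d) f (mulr_gt0 c0 a0).
apply: filterS2 h1 (filterI h2 h3) => z -> [-> ->].
by rewrite affc_comp.
Qed.

Lemma aff_op_id f : aff_op 1 0 f = f.
Proof.
apply: L2_eq_ae; apply: filterS2 (aff_op_ae 0 f ltr01) (to_lineK_ae omega) => z -> zE.
by rewrite /affc mul1r addr0 zE.
Qed.

(** A bound for the operators uniform in nearby parameters, without which joint continuity could not
    be deduced from that on step functions. *)
Lemma dilation_bounded a0 b0 : 0 < a0 -> exists2 D : R, 0 < D & forall a b,
  `|a - a0| < a0 / 2 -> `|b - b0| < 1 -> 0 < a /\ dilation a b <= D.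
Proof.
move=> a00; have b2 : 0 <= b0 ^+ 2 by exact: sqr_ge0.
have N0 : 0 < 1 + 2 * (2 * b0 ^+ 2 + 2) by lra.
exists (4 * a0 + (1 + 2 * (2 * b0 ^+ 2 + 2)) * (2 / a0)).
  by apply: addr_gt0; apply: mulr_gt0 => //; rewrite divr_gt0.
move=> a b; rewrite ltr_norml => /andP[a1 a2] bb; have ap : a0 / 2 < a by lra.
split; first by apply: lt_trans ap; rewrite divr_gt0.
have a'0 : 0 < a by apply: lt_trans ap; rewrite divr_gt0.
apply: lerD; first lra.
have bE : b ^+ 2 <= 2 * b0 ^+ 2 + 2.
  have s1 : (b - b0) ^+ 2 <= 1 by rewrite -real_normK ?num_real// expr_le1// ltW.
  by have := sqr_ge0 (b - 2 * b0); nra.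
have b20 := sqr_ge0 b.
apply: ler_pM; [lra|by rewrite invr_ge0 ltW|lra|].
by rewrite -[2 / a0]invf_div lef_pV2 ?posrE ?divr_gt0// ltW.
Qed.

(** On step functions the dependence on [(a, b)] is explicit; the local bound [D] carries it over to
    [f0] and, at the same time, to nearby [f]. *)
Lemma aff_op_continuous a0 b0 f0 e : 0 < a0 -> 0 < e -> exists2 d : R, 0 < d &
  forall a b f, `|a - a0| < d -> `|b - b0| < d -> L2dist f0 f < d ->
    0 < a /\ L2dist (aff_op a b f) (aff_op a0 b0 f0) < e.
Proof.
move=> a00 e0; have [D D0 HD] := dilation_bounded b0 a00.
have e2 : 0 < e ^+ 2 by rewrite exprn_gt0.
(* Each of the four links of the chain below is at most [e ^+ 2 / 32]. The doubling in three
   successive triangle inequalities adds up to 4, 10 and finally 22 such terms. *)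
pose k := e ^+ 2 / (32 * D); have k0 : 0 < k by rewrite divr_gt0// mulr_gt0.
have [s Hs] := @step_approx_L2 R omega f0 (cmeas_L2 f0) (sqd_L2_fin f0) _ k0.
have k'0 : 0 < e ^+ 2 / 32 by rewrite divr_gt0.
have [d1 d10 H1] := step_affc_continuous omega s b0 a00 k'0.
pose d := Num.min (Num.min d1 (a0 / 2)) (Num.min 1 (Num.sqrt k)).
have d0 : 0 < d by rewrite !lt_min d10 divr_gt0//= ltr01 sqrtr_gt0.
exists d => // a b f; rewrite !lt_min => /andP[/andP[ad1 ad2] _].
move=> /andP[/andP[bd1 _] /andP[b1 _]] /andP[_ /andP[_ fk]].
have [a1 Da] := HD _ _ ad2 b1; have [_ sd] := H1 _ _ ad1 bd1.
have [_ Da0] := HD a0 b0 ltac:(by rewrite subrr normr0 divr_gt0) ltac:(by rewrite subrr normr0).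
split => //; rewrite L2dist_lt//.
have ms a' b' : cmeas (fun z => step s (to_line omega (affc a' b' z))).
  by apply: (@cmeas_affc R omega a' b' (fun z => step s (to_line omega z)));
     exact: cmeas_step (measurable_to_line omega).
have mst : cmeas (fun z => step s (to_line omega z)) := cmeas_step s (measurable_to_line omega).
rewrite (@eq_sqd_ae _ _ _ mu _ (fun z => f (affc a b z)) _ (fun z => f0 (affc a0 b0 z)));
  [|exact: cmeas_L2|exact: cmeas_affc_L2|exact: cmeas_L2|exact: cmeas_affc_L2
   |exact: aff_op_ae|exact: aff_op_ae].
(* The chain of comparisons goes through [f0 o affc a b], [step s o affc a b] and
   [step s o affc a0 b0]. *)
have D_le (t : R) (x y : circle R -> C) a' b' : 0 < a' -> dilation a' b' <= D ->
    cmeas x -> cmeas y -> (sqd mu x y <= t%:E)%E ->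
    (sqd mu (fun z => x (affc a' b' z)) (fun z => y (affc a' b' z)) <= (D * t)%:E)%E.
  move=> a'0 Da' mx my xy; apply: le_trans (sqd_affc_le omega b' a'0 mx my) _.
  rewrite EFinM; apply: lee_pmul => //; [|exact: sqd_ge0].
  rewrite lee_fin /dilation addr_ge0 ?mulr_ge0 ?(ltW a'0)// ?invr_ge0 ?(ltW a'0)//.
  by rewrite addr_ge0// mulr_ge0// sqr_ge0.
have h1 : (sqd mu (fun z => f (affc a b z)) (fun z => f0 (affc a b z)) <= (D * k)%:E)%E.
  apply: D_le => //; try exact: cmeas_L2.
  rewrite -L2dist_sqr lee_fin -(sqr_sqrtr (ltW k0)).
  by rewrite ler_pXn2r ?nnegrE ?L2dist_ge0 ?sqrtr_ge0// L2distC ltW.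
have h2 : (sqd mu (fun z => f0 (affc a b z)) (fun z => step s (to_line omega (affc a b z))) <= (D * k)%:E)%E.
  by apply: (D_le k f0 (fun z => step s (to_line omega z))) => //; [exact: cmeas_L2|exact: ltW].
have h3 : (sqd mu (fun z => step s (to_line omega (affc a0 b0 z))) (fun z => f0 (affc a0 b0 z)) <= (D * k)%:E)%E.
  rewrite sqdC.
  by apply: (D_le k f0 (fun z => step s (to_line omega z))) => //; [exact: cmeas_L2|exact: ltW].
have Dk : D * k = e ^+ 2 / 32 by rewrite /k; field; rewrite gt_eqF.
rewrite Dk in h1 h2 h3.
have t1 := sqd_triangle mu (cmeas_affc_L2 a b f) (cmeas_affc_L2 a b f0) (cmeas_affc_L2 a0 b0 f0).
have t2 := sqd_triangle mu (cmeas_affc_L2 a b f0) (ms a b) (cmeas_affc_L2 a0 b0 f0).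
have t3 := sqd_triangle mu (ms a b) (ms a0 b0) (cmeas_affc_L2 a0 b0 f0).
have c3 : (sqd mu (fun z => step s (to_line omega (affc a b z))) (fun z => f0 (affc a0 b0 z)) <=
    (4 * (e ^+ 2 / 32))%:E)%E.
  apply: le_trans t3 _; apply: (@le_trans _ _ (2%:E * (e ^+ 2 / 32)%:E + 2%:E * (e ^+ 2 / 32)%:E)%E).
    by apply: leeD; apply: lee_wpmul2l => //; exact: ltW.
  by rewrite -!EFinM -EFinD lee_fin; clear; lra.
have c2 : (sqd mu (fun z => f0 (affc a b z)) (fun z => f0 (affc a0 b0 z)) <=
    (10 * (e ^+ 2 / 32))%:E)%E.
  apply: le_trans t2 _; apply: (@le_trans _ _ (2%:E * (e ^+ 2 / 32)%:E + 2%:E * (4 * (e ^+ 2 / 32))%:E)%E).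
    by apply: leeD; apply: lee_wpmul2l.
  by rewrite -!EFinM -EFinD lee_fin; clear; lra.
apply: le_lt_trans t1 _; apply: (@le_lt_trans _ _ (2%:E * (e ^+ 2 / 32)%:E + 2%:E * (10 * (e ^+ 2 / 32))%:E)%E).
  by apply: leeD; apply: lee_wpmul2l.
by rewrite -!EFinM -EFinD lte_fin; clear -e2; lra.
Qed.

End affine_operator.

(** * Baire's theorem in complete metric spaces *)

Section metric_baire.
Context {R : realType} (X : metricType R).
Local Notation dist := (@mdist R X).

(* Completeness, in the form needed: sequences with [dist (u n) (u n.+1) < 2^-n]
   converge. *)
Hypothesis complete : forall u : nat -> X,
  (forall n, dist (u n) (u n.+1) < 2^-1 ^+ n) ->
  exists l, forall e : R, 0 < e -> exists n, forall m, (n <= m)%N -> dist (u m) l < e.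

Lemma open_distP (U : set X) x : open U -> U x ->
  exists2 e : R, 0 < e & forall y, dist x y < e -> U y.
Proof.
move=> oU Ux; have /nbhs_ballP[e /= e0 He] := open_nbhs_nbhs (conj oU Ux).
by exists e => // y xy; apply: He; rewrite ballEmdist.
Qed.

Lemma open_dist_ball (x : X) (e : R) : open [set y | dist x y < e].
Proof.
rewrite openE => y /= xy; apply/nbhs_ballP; exists (e - dist x y) => /=; first by rewrite subr_gt0.
move=> z; rewrite ballEmdist /= => yz.
by apply: le_lt_trans (metric_triangle x y z) _; rewrite addrC -ltrBrDr.
Qed.

Lemma dense_distP (A : set X) : dense A <->
  forall x (e : R), 0 < e -> exists2 y, A y & dist x y < e.
Proof.
split=> [dA x e e0|H U [x Ux] oU].
  have [|y [/= xy Ay]] := dA [set y | dist x y < e] _ (open_dist_ball x e).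
    by exists x; rewrite /= mdistxx.
  by exists y.
have [e e0 He] := open_distP oU Ux; have [y Ay xy] := H x e e0.
by exists y; split => //; exact: He.
Qed.

Lemma metric_baire (F : nat -> set X) :
  (forall i, open (F i) /\ dense (F i)) -> dense (\bigcap_i F i).
Proof.
move=> odF; apply/dense_distP => x0 e0 e00.
(* The limit will only be known to lie within [q.2] of [q.1], boundary included; the factor 2 leaves
   room for it. *)
pose next n (p q : X * R) := [/\ 0 < q.2, q.2 <= p.2 / 2, dist p.1 q.1 < p.2 / 2 &
  forall y, dist q.1 y < 2 * q.2 -> F n y].
have /choice[f Hf] (np : nat * (X * R)) : exists q, 0 < np.2.2 -> next np.1 np.2 q.
  case: np => n [x r] /=; have [r0|r0] := ltP 0 r; last by exists (x, r); lra.
  have r20 : 0 < r / 2 by rewrite divr_gt0.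
  have [oF /dense_distP/(_ x _ r20)[y Fy xy]] := odF n.
  have [e ep He] := open_distP oF Fy.
  exists (y, Num.min (r / 2) (e / 2)) => _; split => //=.
  - by rewrite lt_min r20 divr_gt0.
  - by rewrite ge_min lexx.
  move=> z yz; apply: He; apply: lt_le_trans yz _.
  have : Num.min (r / 2) (e / 2) <= e / 2 by rewrite ge_min lexx orbT.
  lra.
pose r0 := Num.min (e0 / 2) 1.
have r00 : 0 < r0 by rewrite lt_min ltr01 divr_gt0.
pose fix s n := if n is m.+1 then f (m, s m) else (x0, r0).
have s0 n : 0 < (s n).2 by elim: n => //= n IH; have [] := Hf (n, s n) IH.
have ns n : next n (s n) (s n.+1) by exact: (Hf (n, s n) (s0 n)).
have small n : (s n).2 <= 2^-1 ^+ n.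
  elim: n => [|n IH]; first by rewrite expr0 /= ge_min lexx orbT.
  have [_ h _ _] := ns n; apply: le_trans h _.
  by rewrite exprS mulrC ler_pM2l ?invr_gt0.
have [l Hl] : exists l, forall e : R, 0 < e ->
    exists n, forall m, (n <= m)%N -> dist (s m).1 l < e.
  apply: (complete (u := fun n => (s n).1)) => n; have [_ _ h _] := ns n.
  apply: lt_le_trans h (le_trans _ (small n)); have := s0 n; lra.
have nested n m : dist (s n).1 (s (n + m)%N).1 <= (s n).2 - (s (n + m)%N).2.
  elim: m => [|m IH]; first by rewrite addn0 mdistxx subrr.
  rewrite addnS; have [_ h2 h3 _] := ns (n + m)%N.
  apply: le_trans (metric_triangle _ (s (n + m)%N).1 _) _.
  by move: h2 h3 IH; set p := s (n + m)%N; set q := s (n + m).+1; lra.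
have dl n : dist (s n).1 l <= (s n).2.
  apply/ler_addgt0Pr => e e_0; have [N HN] := Hl e e_0.
  apply: le_trans (metric_triangle _ (s (n + N)%N).1 _) _; apply: lerD.
    by apply: le_trans (nested n N) _; have := s0 (n + N)%N; lra.
  by apply/ltW/HN; exact: leq_addl.
exists l; last first.
  apply: le_lt_trans (dl 0%N) _; rewrite /= /r0.
  apply: (@le_lt_trans _ _ (e0 / 2)); first by rewrite ge_min lexx.
  lra.
move=> n _; have [_ _ _ h] := ns n; apply: h.
by apply: le_lt_trans (dl n.+1) _; have := s0 n.+1; lra.
Qed.

End metric_baire.

(** * Completeness of L2 *)

Section L2_complete.
Context {R : realType}.
Local Notation C := (plane R).
Local Notation nc := (@Normc.normc R).
Local Notation mu := (@arc_measure R).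

(* The weights [2 ^ j] make the bound uniform in [n]: by induction from
   [|a + b|^2 <= 2 |a|^2 + 2 |b|^2]. *)
Lemma telescope_bound (x : nat -> C) k n :
  nc (x (k + n)%N - x k) ^+ 2 <=
  2 / 2 ^+ k * \sum_(k <= j < k + n) 2 ^+ j * nc (x j.+1 - x j) ^+ 2.
Proof.
elim: n k => [|n IH] k.
  by rewrite addn0 subrr Normc.normc0 expr0n big_geq ?mulr0.
rewrite big_ltn; last by rewrite addnS ltnS leq_addr.
have -> : x (k + n.+1)%N - x k = (x k.+1 - x k) + (x (k.+1 + n)%N - x k.+1).
  by rewrite addSnnS; ring.
apply: le_trans (sqr_normcD _ _) _; rewrite mulrDr -addSnnS; apply: lerD.
  by rewrite [leRHS]mulrA divfK// expf_neq0.
apply: le_trans (ler_wpM2l _ (IH k.+1)) _ => //.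
by rewrite le_eqVlt; apply/orP; left; apply/eqP; rewrite exprS; field; rewrite expf_neq0.
Qed.

Lemma pow2_small (K e : R) : 0 < e -> exists k, forall m, (k <= m)%N -> 2 / 2 ^+ m * K < e.
Proof.
move=> e0; have [N HN] := @expr_unbounded R (2 * `|K| / e) 2 ltac:(by rewrite ltr1n).
exists N => m Nm; have p0 : 0 < 2 ^+ m :> R by rewrite exprn_gt0.
rewrite mulrAC ltr_pdivrMr//; apply: le_lt_trans (_ : 2 * `|K| < _).
  by rewrite ler_pM2l// ler_norm.
by rewrite [ltRHS]mulrC -ltr_pdivrMr// HN.
Qed.

Lemma sqr_cauchy_cvg (x : nat -> R) K :
  (forall k n, (x (k + n)%N - x k) ^+ 2 <= 2 / 2 ^+ k * K) ->
  x n @[n --> \oo] --> lim (x n @[n --> \oo]).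
Proof.
move=> xK; apply: cauchy_cvg; apply: cauchy_exP => e e0.
have [k Hk] := @pow2_small K (e ^+ 2) ltac:(by rewrite exprn_gt0).
exists (x k); exists k => // m /= km.
rewrite -ball_normE /= distrC -(@ltr_pXn2r _ 2) ?nnegrE ?(ltW e0)// real_normK ?num_real//.
by apply: le_lt_trans (Hk k (leqnn k)); rewrite -(subnKC km).
Qed.

(** The Riesz-Fischer argument: the squared increments weighted by [2 ^+ j] have integrals at most
    [2^-1 ^+ j], so their sum [G] is integrable. Where [G] is finite, [telescope_bound] gives
    pointwise convergence at the rate [2 / 2 ^+ k * G z], and this bound integrates to convergence
    in L2. *)
Lemma L2_fast_cauchy_cvg (u : nat -> L2 R) :
  (forall n, L2dist (u n) (u n.+1) < 2^-1 ^+ n) ->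
  exists l : L2 R, forall e : R, 0 < e ->
    exists n, forall m, (n <= m)%N -> L2dist (u m) l < e.
Proof.
move=> uC; pose D j z := nc (u j.+1 z - u j z) ^+ 2.
pose g j z := (2 ^+ j * D j z)%:E.
have g0 j z : (0 <= g j z)%E by rewrite lee_fin mulr_ge0// sqr_ge0.
have mg j : measurable_fun setT (g j).
  apply/measurable_EFinP; apply: measurable_funM => //.
  by apply/measurable_EFinP; apply: cmeas_sqnorm; apply: cmeasB; exact: cmeas_L2.
pose G z := (\sum_(0 <= j <oo) g j z)%E.
have G0 z : (0 <= G z)%E by apply: nneseries_ge0 => j _ _; exact: g0.
have mG : measurable_fun setT G by apply: ge0_emeasurable_sum => // j z _ _; exact: g0.
have ig j : (\int[mu]_z g j z <= (2^-1 ^+ j)%:E)%E.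
  rewrite /g; under eq_integral do rewrite EFinM.
  rewrite ge0_integralZl//; last 2 first.
  - by apply: cmeas_sqnorm; apply: cmeasB; exact: cmeas_L2.
  - by move=> z _; rewrite lee_fin sqr_ge0.
  rewrite -[X in (_ * X)%E]/(sqd mu (u j.+1) (u j)) -L2dist_sqr -EFinM lee_fin L2distC.
  apply: le_trans (_ : 2 ^+ j * (2^-1 ^+ j) ^+ 2 <= _).
    rewrite ler_pM2l ?exprn_gt0// ler_pXn2r ?nnegrE ?L2dist_ge0 ?exprn_ge0 ?invr_ge0//.
    by rewrite ltW.
  by rewrite expr2 mulrA -exprMn mulfV// expr1n mul1r.
have IG : (\int[mu]_z G z <= 2%:E)%E.
  rewrite integral_nneseries//; apply: lime_le.
    by apply: is_cvg_nneseries => j _ _; exact: integral_ge0.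
  apply: nearW => n; apply: le_trans (_ : (\sum_(0 <= j < n) (2^-1 ^+ j)%:E <= _)%E).
    exact: lee_sum.
  rewrite sumEFin lee_fin; suff -> : \sum_(0 <= j < n) 2^-1 ^+ j = 2 - 2 * 2^-1 ^+ n :> R.
    by rewrite gerBl mulr_ge0// exprn_ge0// invr_ge0.
  elim: n => [|n IH]; first by rewrite big_geq// expr0 mulr1 subrr.
  by rewrite big_nat_recr//= IH exprS; field; rewrite ?expf_neq0.
have Gpart z k n : (G z < +oo)%E ->
    \sum_(k <= j < k + n) 2 ^+ j * D j z <= fine (G z).
  move=> Gfin; rewrite -lee_fin fineK ?ge0_fin_numE// -sumEFin.
  apply: le_trans (_ : (\sum_(0 <= j < k + n) g j z <= _)%E).
    rewrite (@big_cat_nat _ _ _ k 0)//= ?leq_addr// leeDr// sume_ge0//.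
  by apply: nneseries_lim_ge => j _ _; exact: g0.
have bound z k n : (G z < +oo)%E ->
    nc (u (k + n)%N z - u k z) ^+ 2 <= 2 / 2 ^+ k * fine (G z).
  move=> Gfin; apply: le_trans (telescope_bound (fun j => u j z) k n) _.
  by apply: ler_wpM2l; [rewrite divr_ge0// exprn_ge0|exact: Gpart].
(* Off this set the sequences are replaced by 0, so that limits exist everywhere and measurability
   passes to them. *)
pose b z := (G z < +oo)%E.
have mb : measurable_fun setT b.
  apply: (measurable_fun_bool true); rewrite setTI.
  have -> : b @^-1` [set true] = G @^-1` `[-oo%E, +oo%E[%classic.
    by apply/seteqP; split => z /=; rewrite /b in_itv /= leNye.
  by rewrite -[X in measurable X]setTI; apply: mG => //; exact: emeasurable_itv.
pose re k z : R := if b z then complex.Re (u k z) else 0.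
pose im k z : R := if b z then complex.Im (u k z) else 0.
have mre k : measurable_fun setT (re k).
  by apply: measurable_fun_ifT => //; exact: (cmeas_L2 (u k)).1.
have mim k : measurable_fun setT (im k).
  by apply: measurable_fun_ifT => //; exact: (cmeas_L2 (u k)).2.
have part (q : C -> R) z : (forall c c' : C, `|q c - q c'| <= nc (c - c')) ->
    (fun k => if b z then q (u k z) else 0) n @[n --> \oo] -->
    lim ((fun k => if b z then q (u k z) else 0) n @[n --> \oo]).
  move=> qn; apply: (@sqr_cauchy_cvg _ (fine (G z))) => k n; case: ifPn => bz.
    apply: le_trans (bound z k n bz); rewrite -[leLHS]real_normK ?num_real//.
    by rewrite ler_pXn2r ?nnegrE ?normc_ge0.
  by rewrite subrr expr0n mulr_ge0 ?fine_ge0 ?divr_ge0 ?exprn_ge0.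
have cre z : re n z @[n --> \oo] --> lim (re n z @[n --> \oo]).
  apply: (part (@complex.Re R)) => c c'; apply: le_trans (normr_Re_le (c - c')).
  by case: c c' => [? ?] [? ?].
have cim z : im n z @[n --> \oo] --> lim (im n z @[n --> \oo]).
  apply: (part (@complex.Im R)) => c c'; apply: le_trans (normr_Im_le (c - c')).
  by case: c c' => [? ?] [? ?].
pose lre z := lim (re n z @[n --> \oo]); pose lim_ z := lim (im n z @[n --> \oo]).
pose l z : C := (lre z +i* lim_ z)%C.
have ml : cmeas l.
  split; first by apply: (@measurable_fun_cvg _ _ _ _ re) => // z _; exact: cre.
  by apply: (@measurable_fun_cvg _ _ _ _ im) => // z _; exact: cim.
have lbound z k : b z -> nc (l z - u k z) ^+ 2 <= 2 / 2 ^+ k * fine (G z).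
  move=> bz; rewrite -nsqE.
  have : (re (k + n)%N z - complex.Re (u k z)) ^+ 2 + (im (k + n)%N z - complex.Im (u k z)) ^+ 2
      @[n --> \oo] --> nsq (l z - u k z).
    have sh (x : nat -> R) y c : x n @[n --> \oo] --> y ->
        (x (k + n)%N - c) ^+ 2 @[n --> \oo] --> (y - c) ^+ 2.
      move=> xy; have xk : x (k + n)%N @[n --> \oo] --> y.
        have -> : (fun n => x (k + n)%N) = [sequence x (n + k)%N]_n.
          by apply/funext => n; rewrite addnC.
        by rewrite cvg_shiftn.
      by rewrite expr2; under eq_fun do rewrite expr2;
        apply: cvgM; apply: cvgB => //; exact: cvg_cst.
    have -> : nsq (l z - u k z) =
        (lre z - complex.Re (u k z)) ^+ 2 + (lim_ z - complex.Im (u k z)) ^+ 2.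
      by rewrite /l; case: (u k z).
    by apply: cvgD; apply: (sh (fun n => _ n z)); [exact: cre|exact: cim].
  move=> H; rewrite -(cvg_lim _ H)//; apply: limr_le; first by apply/cvg_ex; eexists; exact: H.
  apply: nearW => n; rewrite /re /im bz; apply: le_trans (bound z k n bz).
  by rewrite -nsqE; case: (u (k + n)%N z) (u k z) => [? ?] [? ?].
have Gae : {ae mu, forall z, b z}.
  have iG : mu.-integrable setT G.
    apply/integrableP; split => //; under eq_integral do rewrite gee0_abs//.
    by apply: le_lt_trans IG _; rewrite ltry.
  by apply: filterS (integrable_ae measurableT iG) => z /(_ I); rewrite ge0_fin_numE.
have lu k : (sqd mu l (u k) <= (4 / 2 ^+ k)%:E)%E.
  apply: (@le_trans _ _ (\int[mu]_z ((2 / 2 ^+ k)%:E * G z))%E); last first.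
    rewrite ge0_integralZl//.
    apply: le_trans (lee_wpmul2l _ IG) _; first by rewrite lee_fin divr_ge0// exprn_ge0.
    by rewrite -EFinM lee_fin le_eqVlt; apply/orP; left; apply/eqP; ring.
  apply: ae_ge0_le_integral => //.
  - by move=> z _; rewrite lee_fin sqr_ge0.
  - by apply: cmeas_sqnorm; apply: cmeasB => //; exact: cmeas_L2.
  - by move=> z _; rewrite mule_ge0// lee_fin divr_ge0// exprn_ge0.
  - exact: measurable_funeM.
  apply: filterS Gae => z bz _; rewrite -(fineK (_ : G z \is a fin_num)) ?ge0_fin_numE//.
  by rewrite -EFinM lee_fin lbound.
have lfin : (sqd mu l (fun=> 0%R) < +oo)%E.
  apply: le_lt_trans (sqd_triangle mu ml (cmeas_L2 (u 0%N)) (cmeas_cst _ 0)) _.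
  apply: lte_add_pinfty; apply: lte_mul_pinfty => //; last exact: sqd_L2_fin.
  by apply: le_lt_trans (lu 0%N) _; rewrite ltry.
exists (L2class l) => e e0; have e20 : 0 < e ^+ 2 by rewrite exprn_gt0.
have [k Hk] := pow2_small 2 e20; exists k => m km.
rewrite L2dist_lt// sqdC (@eq_sqd_ae _ _ _ mu _ l _ (u m))//; try exact: cmeas_L2.
- apply: le_lt_trans (lu m) _; rewrite lte_fin; apply: le_lt_trans (Hk m km).
  by rewrite le_eqVlt; apply/orP; left; apply/eqP; ring.
- exact: L2class_ae.
- exact: nearW.
Qed.

Lemma L2_baire (F : nat -> set (L2 R)) :
  (forall i, open (F i) /\ dense (F i)) -> dense (\bigcap_i F i).
Proof. exact: (metric_baire L2_fast_cauchy_cvg). Qed.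

End L2_complete.

(** * Windows, and density from coverings *)

Section windows.
Context {R : realType}.
Variable omega : circle R.
Local Notation C := (plane R).
Local Notation nc := (@Normc.normc R).
Local Notation mu := (@arc_measure R).
Local Notation to_line := (to_line omega).
Local Notation affc := (affc omega).
Implicit Types (a b e x y : R) (f g h : L2 R).

(** A possible hole of radius [inner] serves dilations, which leave points near their fixed point
    close to it; translations take [inner = 0]. *)
Record window := Window { center : R; inner : R; outer : R; slope : R; shift_ : R }.

Definition inside (w : window) y := inner w <= `|y - center w| <= outer w.

Definition pull (w : window) y := slope w * y + shift_ w.

Lemma measurable_inside w d (T : measurableType d) (k : T -> R) :
  measurable_fun setT k -> measurable_fun setT (fun z => inside w (k z)).
Proof.
move=> mk; apply: measurable_and; apply: measurable_fun_ler => //;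
  by apply: measurableT_comp => //; apply: measurable_funB.
Qed.

Lemma measurable_outside w a b : measurable [set z | ~~ inside w (a * to_line z + b)].
Proof.
have mk : measurable_fun setT (fun z => a * to_line z + b).
  apply: measurable_funD => //; apply: measurable_funM => //.
  exact: measurable_to_line.
have := measurable_inside w mk measurableT (_ : measurable [set false]).
rewrite setTI => /(_ I); congr measurable; apply/seteqP; split => z /=.
  by move=> ->.
by move/negbTE.
Qed.

Lemma measurable_tail b : measurable [set z | b < `|to_line z|].
Proof.
have mU := measurableU _ _ (measurable_itv `]-oo, (- b)[) (measurable_itv `]b, +oo[).
have := measurable_to_line_set omega mU.
congr measurable; apply/seteqP; split => z /=; rewrite !in_itv /= andbT ltr_normr ltrNr.
  by move=> [->|->]; rewrite ?orbT.
by move=> /orP[->|->]; [right|left].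
Qed.

(* [u] with a copy of [v], transported by the inverse of [pull], in each window. *)
Fixpoint glue (u v : R -> C) (ws : seq window) y : C :=
  if ws is w :: ws' then if inside w y then v (pull w y) else glue u v ws' y
  else u y.

Lemma glue_outside u v ws y : (forall w, List.In w ws -> ~~ inside w y) ->
  glue u v ws y = u y.
Proof.
elim: ws => //= w ws IH H; rewrite (negPf (H w _)); last by left.
by apply: IH => w' hw'; apply: H; right.
Qed.

Lemma glue_inside u v ws y w : List.In w ws -> inside w y ->
  (forall w', List.In w' ws -> inside w' y -> pull w' y = pull w y) ->
  glue u v ws y = v (pull w y).
Proof.
elim: ws => //= w' ws IH [->|hw] yw H; first by rewrite yw.
case: ifPn => [yw'|_]; first by rewrite H//; left.
by apply: IH => // w'' hw''; apply: H; right.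
Qed.

Lemma glue_bounded u v ws (M : R) : (forall y, nc (u y) <= M) ->
  (forall y, nc (v y) <= M) -> forall y, nc (glue u v ws y) <= M.
Proof. by move=> uM vM y; elim: ws => //= w ws IH; case: ifP. Qed.

Lemma cmeas_glue s t ws : cmeas (fun z => glue (step s) (step t) ws (to_line z)).
Proof.
have mk := measurable_to_line omega.
elim: ws => [|w ws IH] /=; first exact: cmeas_step.
apply: cmeas_if => //; first exact: measurable_inside.
apply: cmeas_step; apply: measurable_funD => //; exact: measurable_funM.
Qed.

(** [la] parametrizes maps whose iterate of order [n] is [x |-> A n la * x + B n la]. The two [eta]
    bounds say that [pull w] nearly undoes this iterate, which thus brings the copy in [w] back to
    the target. Agreement of the pulls on overlaps is asked instead of disjointness because [w] and
    [w'] may coincide. *)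
Definition covering (eta : R) (L : Type) (K : set L) (A B : nat -> L -> R) :=
  forall de b : R, 0 < de -> 0 < b -> exists ws : seq window,
  [/\ forall w w' y, List.In w ws -> List.In w' ws -> inside w y -> inside w' y ->
        pull w y = pull w' y,
      forall w y, List.In w ws -> inside w y -> b < `|y| &
      forall la, K la -> exists w n, [/\ List.In w ws, (0 < n)%N,
        `|slope w * A n la - 1| < eta, `|slope w * B n la + shift_ w| < eta &
        (mu [set z | ~~ inside w (A n la * to_line z + B n la)] <= de%:E)%E]].

Lemma step_aff_op t : cmeas (fun z => step t (to_line z)) /\
  (sqd mu (fun z => step t (to_line z)) (fun=> 0%R) < +oo)%E.
Proof.
have mt := cmeas_step t (measurable_to_line omega); split => //.
have [M _ HM] := @step_bounded R t.
by apply: (@bounded_sqd_fin _ _ M) => // z; exact: HM.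
Qed.

(** [eta] depends on the target and on [e] only, so it can fix the size of the parameter boxes
    before [f] and [r] are known. *)
Lemma covering_dense g e : 0 < e -> exists2 eta : R, 0 < eta &
  forall (L : Type) (K : set L) (A B : nat -> L -> R),
    (forall n la, K la -> 0 < A n la) -> covering eta K A B ->
  forall f r, 0 < r -> exists2 h, L2dist f h < r &
    forall la, K la -> exists2 n, (0 < n)%N & L2dist (aff_op omega (A n la) (B n la) h) g < e.
Proof.
move=> e0; have e20 : 0 < e ^+ 2 / 16 by rewrite divr_gt0// exprn_gt0.
have [t gt] := step_approx_L2 omega (cmeas_L2 g) (sqd_L2_fin g) e20.
have [eta eta0 Heta] := step_affc_continuous omega t 0 ltr01 e20.
exists eta => // L K A B A0 cov f r r0.
have r20 : 0 < r ^+ 2 / 4 by rewrite divr_gt0// exprn_gt0.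
have [s fs] := step_approx_L2 omega (cmeas_L2 f) (sqd_L2_fin f) r20.
have [M1 M10 HM1] := @step_bounded R s; have [M2 M20 HM2] := @step_bounded R t.
pose M := M1 + M2 + 1; have M0 : 0 < M by rewrite /M; clear -M10 M20; lra.
have sM y : nc (step s y) <= M by have := HM1 y; rewrite /M; clear -M20; lra.
have tM y : nc (step t y) <= M by have := HM2 y; rewrite /M; clear -M10; lra.
have M2M : 0 < (2 * M) ^+ 2 by rewrite exprn_gt0// mulr_gt0.
(* The first bound is for the mass beyond [b], where the new vector may differ from [step s]; the
   second is for the points that an iterate sends outside its window. Both masses enter through
   [sqd_small], with factor [(2 * M) ^+ 2]. *)
pose de := Num.min (r ^+ 2 / 8 / (2 * M) ^+ 2) (e ^+ 2 / 32 / (2 * M) ^+ 2).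
have de0 : 0 < de by rewrite lt_min !divr_gt0// exprn_gt0.
have [b b0 Hb] := mu_tail omega de0.
have [ws [wsD wsb wsK]] := cov _ _ de0 b0.
pose F y := glue (step s) (step t) ws y.
have mF : cmeas (fun z => F (to_line z)) by exact: cmeas_glue.
have FM y : nc (F y) <= M by exact: glue_bounded.
have Ffin : (sqd mu (fun z => F (to_line z)) (fun=> 0%R) < +oo)%E.
  by apply: (@bounded_sqd_fin _ _ M) => // z; exact: FM.
have [ms _] := step_aff_op s; have [mt _] := step_aff_op t.
have Hae := L2class_ae mF Ffin.
exists (L2class (fun z => F (to_line z))).
  rewrite L2dist_lt// (@eq_sqd_ae _ _ _ mu _ f _ (fun z => F (to_line z)))//;
    [|exact: cmeas_L2|exact: cmeas_L2|exact: cmeas_L2|exact: nearW].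
  apply: le_lt_trans (sqd_triangle mu (cmeas_L2 f) ms mF) _.
  have h2 : (sqd mu (fun z => step s (to_line z)) (fun z => F (to_line z)) <= (r ^+ 2 / 8)%:E)%E.
    apply: le_trans (sqd_small ms mF (fun z => sM _) (fun z => FM _) (_ : measurable [set z | b < `|to_line z|]) _) _.
    - exact: measurable_tail.
    - move=> z /= zb; rewrite /F glue_outside// => w hw; apply/negP => yw.
      by apply: zb; exact: wsb yw.
    apply: le_trans (lee_wpmul2l _ Hb) _; first by rewrite lee_fin ltW.
    rewrite -EFinM lee_fin mulrC -ler_pdivlMr// ge_min lexx//.
  apply: (@lt_le_trans _ _ (2%:E * (r ^+ 2 / 4)%:E + 2%:E * (r ^+ 2 / 4)%:E)%E); last first.
    by rewrite -!EFinM -EFinD lee_fin; clear; lra.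
  apply: lteD; rewrite lte_pmul2l//; apply: le_lt_trans h2 _; rewrite lte_fin; clear -r20; lra.
move=> la Kla; have [w [n [ww n0 sl sh wde]]] := wsK la Kla; exists n => //.
have An := A0 n la Kla; set a := A n la in An sl wde *; set b' := B n la in sh wde *.
rewrite L2dist_lt//.
rewrite (@eq_sqd_ae _ _ _ mu _ (fun z => F (to_line (affc a b' z))) _ g); last 6 first.
- exact: cmeas_L2.
- exact: (@cmeas_affc R omega a b' (fun z => F (to_line z))).
- exact: cmeas_L2.
- exact: cmeas_L2.
- apply: filterS2 (aff_op_ae omega b' (L2class (fun z => F (to_line z))) An) (ae_affc omega b' An Hae) => z -> ->.
  by [].
- exact: nearW.
have mFa := @cmeas_affc R omega a b' (fun z => F (to_line z)) mF.
have mta := @cmeas_affc R omega (slope w * a) (slope w * b' + shift_ w) (fun z => step t (to_line z)) mt.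
apply: le_lt_trans (sqd_triangle mu mFa mt (cmeas_L2 g)) _.
(* At points sent into the window [w], the glued function reads the pulled-back target, so the two
   functions agree there. *)
have h1 : (sqd mu (fun z => F (to_line (affc a b' z)))
    (fun z => step t (to_line (affc (slope w * a) (slope w * b' + shift_ w) z))) <= (e ^+ 2 / 32)%:E)%E.
  apply: le_trans (sqd_small mFa mta (fun z => FM _) (fun z => tM _) (measurable_outside w a b') _) _.
    move=> z /negP; rewrite negbK => zw; rewrite /affc !of_lineK /F.
    rewrite (glue_inside _ _ ww zw); last by move=> w' hw' zw'; exact: wsD.
    by congr step; rewrite /pull; ring.
  apply: le_trans (lee_wpmul2l _ wde) _; first by rewrite lee_fin ltW.
  by rewrite -EFinM lee_fin mulrC -ler_pdivlMr// ge_min lexx orbT.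
have [_ h2] : 0 < slope w * a /\ _ := Heta (slope w * a) (slope w * b' + shift_ w) sl
  ltac:(by rewrite subr0).
have h3 : (sqd mu (fun z => F (to_line (affc a b' z))) (fun z => step t (to_line z)) <= (3 * (e ^+ 2 / 16))%:E)%E.
  apply: le_trans (sqd_triangle mu mFa mta mt) _.
  have E10 : (fun z => step t (to_line z)) = (fun z => step t (to_line (affc 1 0 z))).
    by apply/funext => z; rewrite /affc of_lineK mul1r addr0.
  apply: (@le_trans _ _ (2%:E * (e ^+ 2 / 32)%:E + 2%:E * (e ^+ 2 / 16)%:E)%E).
    by apply: leeD; apply: lee_wpmul2l => //; rewrite E10 ltW.
  by rewrite -!EFinM -EFinD lee_fin; clear; lra.
apply: (@le_lt_trans _ _ (2%:E * (3 * (e ^+ 2 / 16))%:E + 2%:E * (e ^+ 2 / 16)%:E)%E).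
  by apply: leeD; apply: lee_wpmul2l => //; rewrite sqdC ltW.
by rewrite -!EFinM -EFinD lte_fin; clear -e20; lra.
Qed.

End windows.

(** * Harmonic grids, and the covering for translations *)

Section coverings.
Context {R : realType}.
Variable omega : circle R.
Local Notation to_line := (to_line omega).

Definition harmonic_sum k : R := \sum_(0 <= i < k) i.+1%:R^-1.

Lemma harmonic_sumS k : harmonic_sum k.+1 = harmonic_sum k + k.+1%:R^-1.
Proof. by rewrite /harmonic_sum big_nat_recr. Qed.

Lemma harmonic_sum_homo : {homo harmonic_sum : i j / (i <= j)%N >-> i <= j}.
Proof.
apply: (homo_leq lexx le_trans) => k.
by rewrite harmonic_sumS lerDl invr_ge0 ler0n.
Qed.

Lemma harmonic_sum0 : harmonic_sum 0 = 0.
Proof. by rewrite /harmonic_sum big_nil. Qed.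

Lemma harmonic_sum_ge0 k : 0 <= harmonic_sum k.
Proof. by rewrite -harmonic_sum0 harmonic_sum_homo. Qed.

Lemma harmonic_sum_unbounded T : exists k, T < harmonic_sum k.
Proof.
apply: contrapT => H; apply: (@dvg_harmonic R).
apply: nondecreasing_is_cvgn; first by move=> i j; exact: harmonic_sum_homo.
exists T => _ [k _ <-]; rewrite leNgt; apply/negP => Tk; apply: H; by exists k.
Qed.

Lemma harmonic_cover (c T : R) : 0 < c -> exists J : nat, forall t, 0 <= t <= T ->
  exists2 k, (k < J)%N & c * harmonic_sum k <= t < c * harmonic_sum k.+1.
Proof.
move=> c0; have [J HJ] := harmonic_sum_unbounded (T / c).
exists J => t /andP[t0 tT].
have ex : exists k, t < c * harmonic_sum k.
  by exists J; rewrite mulrC -ltr_pdivrMr//; apply: le_lt_trans HJ; rewrite ler_pM2r// invr_gt0.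
case: (ex_minnP ex) => [[|k]] tk kmin.
  by move: tk; rewrite harmonic_sum0 mulr0 ltNge t0.
exists k; last by rewrite tk andbT leNgt; apply/negP => /kmin; rewrite ltnn.
apply: kmin; rewrite mulrC -ltr_pdivrMr//; apply: le_lt_trans HJ.
by rewrite ler_pM2r// invr_gt0.
Qed.

Lemma In_map_iota (T : Type) (f : nat -> T) J w :
  List.In w [seq f k | k <- iota 0 J] <-> exists2 k, (k < J)%N & w = f k.
Proof.
have gen : forall s : seq nat, List.In w [seq f k | k <- s] <-> exists2 k, k \in s & w = f k.
  elim=> [|k s IH] /=; first by split => // -[].
  split.
    case=> [<-|/IH [i si ->]]; first by exists k; rewrite ?inE ?eqxx.
    by exists i; rewrite ?inE ?si ?orbT.
  case=> i; rewrite inE => /orP[/eqP-> ->|si wE]; first by left.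
  by right; apply/IH; exists i.
rewrite gen; split => -[k kJ ->]; exists k => //; first by move: kJ; rewrite mem_iota.
by rewrite mem_iota.
Qed.

Lemma pull_consistent (W : nat -> @window R) J :
  (forall i j y, (i < j)%N -> inside (W i) y -> ~~ inside (W j) y) ->
  forall w w' y, List.In w [seq W k | k <- iota 0 J] ->
    List.In w' [seq W k | k <- iota 0 J] -> inside w y -> inside w' y ->
    pull w y = pull w' y.
Proof.
move=> dis _ _ y /In_map_iota[i _ ->] /In_map_iota[j _ ->] yi yj.
have [ij|ji|->] := ltngtP i j; last by [].
- by have := dis _ _ _ ij yi; rewrite yj.
- by have := dis _ _ _ ji yj; rewrite yi.
Qed.

Lemma natmul_large (a M : R) : 0 < a -> exists2 N : nat, (0 < N)%N & M < N%:R * a.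
Proof.
move=> a0; exists (Num.trunc (Num.max M 0 / a)).+1 => //.
rewrite -ltr_pdivrMr//; apply: le_lt_trans (truncnS_gt _).
by rewrite ler_pM2r ?invr_gt0// le_max lexx.
Qed.

Section common_sequence.
Variables (b0 th : R) (N : nat).
Hypotheses (b00 : 0 < b0) (th0 : 0 < th) (N0 : (0 < N)%N).

(** The step from [grid k] to [grid k.+1] is [th / (N * k.+1)], the tolerance [th] divided by the
    order [N * k.+1] of the iterate used at [grid k]. *)
Definition grid k : R := b0 + th / N%:R * harmonic_sum k.

Lemma grid_ge k : b0 <= grid k.
Proof. by rewrite lerDl mulr_ge0 ?harmonic_sum_ge0// divr_ge0// ltW. Qed.

Lemma grid_homo i j : (i <= j)%N -> grid i <= grid j.
Proof.
by move=> ij; rewrite lerD2l ler_wpM2l ?harmonic_sum_homo// divr_ge0// ltW.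
Qed.

(** Order of the iterate times the parameter: the length of the resulting translation, or the
    logarithm of the ratio of the resulting dilation. *)
Definition level k : R := (N * k.+1)%:R * grid k.

Lemma level_ge k : N%:R * b0 <= level k.
Proof.
apply: ler_pM; [by []|exact: ltW| |exact: grid_ge].
by rewrite ler_nat leq_pmulr.
Qed.

(** The order alone increases by at least [N] while [grid] does not decrease. The gap does not
    depend on [th], so a large [N] separates the windows at any precision. *)
Lemma level_gap i j : (i < j)%N -> level i + N%:R * b0 <= level j.
Proof.
move=> ij; apply: (@le_trans _ _ ((N * j.+1)%:R * grid i)); last first.
  by rewrite ler_wpM2l// grid_homo// ltnW.
have -> : (N * j.+1)%:R * grid i = level i + ((N * j.+1)%:R - (N * i.+1)%:R) * grid i :> R.
  by rewrite /level; ring.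
rewrite lerD2l; apply: ler_pM; [by []|exact: ltW| |exact: grid_ge].
by rewrite lerBrDl -natrD ler_nat addnC -mulnS leq_mul2l ltnS ij orbT.
Qed.

Lemma grid_cover b1 : exists J : nat, forall be, b0 <= be <= b1 ->
  exists2 k, (k < J)%N & 0 <= (N * k.+1)%:R * be - level k < th.
Proof.
have c0 : 0 < th / N%:R by rewrite divr_gt0// ltr0n.
have [J HJ] := harmonic_cover (b1 - b0) c0; exists J => be /andP[h1 h2].
have [|k kJ /andP[k1 k2]] := HJ (be - b0); first by apply/andP; split; lra.
exists k => //; rewrite /level -mulrBr; apply/andP; split.
  by rewrite mulr_ge0// /grid; lra.
have Nk : 0 < (N * k.+1)%:R :> R by rewrite ltr0n muln_gt0 N0.
have -> : th = (N * k.+1)%:R * (th / N%:R * k.+1%:R^-1).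
  rewrite natrM; field; rewrite nat1r pnatr_eq0 /=; apply/eqP => N0'.
  by move: N0; rewrite -(ltr0n R) N0' ltxx.
rewrite ltr_pM2l// /grid; move: k2; rewrite harmonic_sumS mulrDr.
by move: (_ / _ * k.+1%:R^-1) (_ / _ * harmonic_sum k) => x y; lra.
Qed.

End common_sequence.

Lemma covering_translations (eta s b0 b1 : R) : `|s| = 1 -> 0 < b0 -> 0 < eta ->
  covering omega eta `[b0, b1]%classic (fun _ _ => 1) (fun n be => s * (n%:R * be)).
Proof.
move=> s1 b00 eta0 de b de0 bpos; have [A A0 HA] := mu_tail omega de0.
(* Twice the radius keeps successive windows disjoint; adding [b] puts them all beyond [b]. *)
have [N N0 HN] := natmul_large (2 * (A + eta) + b) b00.
have [J HJ] := grid_cover b0 eta0 N0 b1.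
(* The radius is [A], beyond which the mass is at most [de], plus the excess of the actual
   displacement over [level], less than [eta]. *)
pose W k : @window R :=
  Window (s * level b0 eta N k) 0 (A + eta) 1 (- (s * level b0 eta N k)).
have sd (x y : R) : `|s * x - s * y| = `|x - y| by rewrite -mulrBr normrM s1 mul1r.
exists [seq W k | k <- iota 0 J]; split.
- apply: pull_consistent => i j y ij /andP[_ yi]; apply/negP => /andP[_ yj].
  have := level_gap N b00 eta0 ij.
  have := ler_distD y (s * level b0 eta N j) (s * level b0 eta N i).
  rewrite sd distrC /= in yi yj *; move: yi yj => /= yi yj.
  have := ler_norm (level b0 eta N j - level b0 eta N i).
  have := distrC y (s * level b0 eta N j).
  have := distrC y (s * level b0 eta N i).
  lra.
- move=> _ y /In_map_iota[k _ ->] /andP[_ /= yk].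
  have := level_ge N b00 eta0 k.
  have := ler_normD (s * level b0 eta N k - y) y; rewrite subrK normrM s1 mul1r.
  have := ler_norm (level b0 eta N k); rewrite distrC in yk; lra.
- move=> be /=; rewrite in_itv /= => /HJ[k kJ /andP[k1 k2]].
  exists (W k), (N * k.+1)%N; split => //=.
  + by apply/In_map_iota; exists k.
  + by rewrite muln_gt0 N0.
  + by rewrite mulr1 subrr normr0.
  + by rewrite mul1r sd ger0_norm.
  apply: le_trans HA; apply: le_measure; rewrite ?inE.
  + by apply: measurable_outside.
  + exact: measurable_tail.
  move=> z /=; rewrite /inside /= normr_ge0 /= -ltNge mul1r -addrA => zA.
  have := ler_normD (to_line z) (s * ((N * k.+1)%:R * be) - s * level b0 eta N k).
  by rewrite sd (ger0_norm k1); lra.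
Qed.

End coverings.

(** * The covering for dilations *)

Section hyperbolic_covering.
Context {R : realType}.
Variable omega : circle R.
Local Notation mu := (@arc_measure R).
Local Notation to_line := (to_line omega).

(** Besides the tail, a neighborhood of the fixed point [p] has to be discarded; [d] and [A] serve
    all [p] near [p0] at once. *)
Lemma mu_annulus (p0 rho de : R) : 0 < de -> exists2 d : R, 0 < d & exists2 A : R, 0 < A &
  forall p, `|p - p0| <= rho ->
  (mu [set z | ~~ (d <= `|to_line z - p| <= A)%R] <= de%:E)%E.
Proof.
move=> de0; have d0 : 0 < de / 2 by rewrite divr_gt0.
have [A A0 HA] := mu_tail omega d0.
exists (de / 2) => //; exists (A + `|p0| + `|rho|); first by rewrite -addrA ltr_wpDr// addr_ge0.
move=> p pp0; have Hp := mu_near omega p d0.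
have mV : measurable [set z | `|to_line z - p| < de / 2].
  have := measurable_to_line_set omega (measurable_itv `](p - de / 2), (p + de / 2)[).
  by congr measurable; apply/seteqP; split => z /=; rewrite in_itv /= ltr_distl.
have mT := @measurable_tail R omega A.
rewrite [de in leRHS]splitr EFinD; apply: le_trans (leeD Hp HA).
apply: le_trans (measureU2 _ mV mT); apply: le_measure; rewrite ?inE.
- have := measurable_outside omega (Window p (de / 2) (A + `|p0| + `|rho|) 0 0) 1 0.
  by congr measurable; apply/seteqP; split => z /=; rewrite mul1r addr0.
- exact: measurableU.
move=> z /=; rewrite negb_and -!ltNge => /orP[zl|zl]; [by left|right].
rewrite /=; have := ler_normB (to_line z) p.
have := ler_normD (p - p0) p0; rewrite subrK; have := ler_norm rho; lra.
Qed.

(** The parameters are the logarithm of the ratio and the fixed point. Only the logarithm needs a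
    grid: after pulling back by [(E k)^-1], replacing the fixed point by [p0] costs at most
    [eta / 4], whatever the order of the iterate. *)
Lemma covering_dilations (eta p0 a0 a1 : R) : 0 < a0 -> 0 < eta ->
  covering omega eta
    [set la : R * R | la.1 \in `[a0, a1] /\ la.2 \in `[p0 - eta / 4, p0 + eta / 4]]
    (fun n la => expR (n%:R * la.1)) (fun n la => la.2 - expR (n%:R * la.1) * la.2).
Proof.
move=> a00 eta0 de b de0 bpos; set rho := eta / 4.
have rho0 : 0 < rho by rewrite divr_gt0.
have [d d0 [A A0 HA]] := mu_annulus p0 rho de0.
have q0 : 0 < 2 * (`|p0| + rho + 1) by have := normr_ge0 p0; lra.
(* The ratio exceeds that of the window by a factor [s] with [1 <= s < 1 + et1]. The second bound
   makes [(s - 1) * p] at most [eta / 2]; the first gives [s <= 2], whence [2 * A] in the outer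
   radius. *)
pose et1 := Num.min 1 (eta / (2 * (`|p0| + rho + 1))).
have et10 : 0 < et1 by rewrite lt_min ltr01 divr_gt0.
have et11 : et1 <= 1 by rewrite ge_min lexx.
have et1q : et1 * (2 * (`|p0| + rho + 1)) <= eta by rewrite -ler_pdivlMr// ge_min lexx orbT.
(* The tolerance is additive on exponents, so the factor [1 + et1] enters through its logarithm. *)
have th0 : 0 < ln (1 + et1) by rewrite ln_gt0// ltrDl.
(* The ratio [E j / E i] for [i < j] is at least [expR (N * a0)]; this [N] makes the inner radius of
   a window exceed the outer radii of the earlier ones, and [|p0| + b]. *)
have [N N0 HN] := natmul_large ((2 * A + 2 * rho + `|p0| + b) / d) a00.
have [J HJ] := grid_cover a0 th0 N0 a1.
set lv := level a0 (ln (1 + et1)) N.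
pose E k := expR (lv k).
(* All windows are centered at [p0], within [rho] of the true fixed point, hence the margins [rho].
   Slope and shift invert the dilation of ratio [E k] about [p0]. *)
pose W k : @window R := Window p0 (d * E k - rho) (2 * A * E k + rho) (E k)^-1 (p0 - p0 * (E k)^-1).
have E0 k : 0 < E k by exact: expR_gt0.
have Elarge x y : x + N%:R * a0 <= y -> 0 <= x ->
    (2 * A + 2 * rho + `|p0| + b) * expR x < d * expR y.
  move=> xy x0; have: expR x * expR (N%:R * a0) <= expR y by rewrite -expRD ler_expR.
  move=> h; apply: (lt_le_trans _ (ler_wpM2l (ltW d0) h)).
  rewrite [d * _]mulrCA [ltRHS]mulrC ltr_pM2r ?expR_gt0//.
  have := expR_ge1Dx (N%:R * a0); move: HN; rewrite ltr_pdivrMr//.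
  move: (N%:R * a0) (expR _) => u v h1 h2; apply: lt_le_trans h1 _; rewrite [leRHS]mulrC ler_pM2r//; lra.
have lv0 k : 0 <= lv k by apply: le_trans (level_ge N a00 th0 k); rewrite mulr_ge0// ltW.
have E1 k : 1 <= E k by rewrite -expR0 ler_expR.
exists [seq W k | k <- iota 0 J]; split.
- apply: pull_consistent => i j y ij /andP[_ /= yi]; apply/negP => /andP[/= yj _].
  have := Elarge _ _ (level_gap N a00 th0 ij) (lv0 i); rewrite -/lv -/(E i) -/(E j).
  have := E1 i; have := E0 j; have := normr_ge0 p0; move: yi yj.
  move: (E i) (E j) `|p0| `|y - p0| => u v w t h1 h2 h3 h4 h5 h6.
  have : 0 <= (2 * rho + w + b) * (u - 1) by apply: mulr_ge0; lra.
  have : 0 <= w + b by lra.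
  clear -h1 h2 h6; lra.
- move=> _ y /In_map_iota[k _ ->] /andP[/= yk _].
  have := @Elarge 0 (lv k); rewrite expR0 mulr1 add0r -/(E k) => /(_ (level_ge N a00 th0 k) (lexx 0)).
  have := ler_normB y p0; lra.
move=> -[al p] /= [al01]; rewrite in_itv /= -ler_distlC distrC => pp0.
move: al01; rewrite in_itv /= => /HJ[k kJ /andP[k1 k2]].
exists (W k), (N * k.+1)%N.
set al' := (N * k.+1)%:R * al in k1 k2 *.
have sE : expR al' = E k * expR (al' - lv k) by rewrite /E -expRD addrC subrK.
set s := expR (al' - lv k) in sE.
have s1 : 1 <= s by rewrite -expR0 ler_expR.
have s2 : s < 1 + et1 by rewrite -[ltRHS]lnK ?posrE ?addr_gt0// ltr_expR.
have mE : (E k)^-1 * E k = 1 by rewrite mulVf// gt_eqF.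
have m0 : 0 < (E k)^-1 by rewrite invr_gt0.
have m1 : (E k)^-1 <= 1 by rewrite invf_le1.
have pE : `|p| <= `|p0| + rho by have := ler_normD (p - p0) p0; rewrite subrK; lra.
split => /=.
- by apply/In_map_iota; exists k.
- by rewrite muln_gt0 N0.
- rewrite sE mulrA mE mul1r ger0_norm ?subr_ge0//.
  apply: le_lt_trans (ltW _ : _ <= et1) _; first by clear -s2; lra.
  have := normr_ge0 p0; clear -et1q et10 rho0; nra.
- rewrite sE.
  have -> : (E k)^-1 * (p - E k * s * p) + (p0 - p0 * (E k)^-1) =
     (E k)^-1 * (p - p0) - (p - p0) - (s - 1) * p.
     by rewrite mulrBr !mulrA mE; ring.
  apply: le_lt_trans (ler_normB _ _) _.
  have h1 : `|(E k)^-1 * (p - p0) - (p - p0)| <= rho.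
    have -> : (E k)^-1 * (p - p0) - (p - p0) = - ((1 - (E k)^-1) * (p - p0)) by ring.
    rewrite normrN normrM ger0_norm ?subr_ge0// -[leRHS]mul1r.
    by apply: ler_pM => //; clear -m0 m1 pp0; lra.
  have h2 : `|(s - 1) * p| <= et1 * (`|p0| + rho).
    by rewrite normrM ger0_norm ?subr_ge0//; apply: ler_pM => //; clear -s1 s2; lra.
  have : rho = eta / 4 by [].
  by move: et1q h1 h2; rewrite mulrCA mulrDr mulr1; lra.
apply: le_trans (HA p pp0); apply: le_measure; rewrite ?inE.
- exact: (measurable_outside omega (W k)).
- have := measurable_outside omega (Window p d A 0 0) 1 0.
  by congr measurable; apply/seteqP; split => z /=; rewrite mul1r addr0.
move=> z /=; apply: contra; rewrite /inside /= sE => /andP[z1 z2].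
set x := to_line z in z1 z2 *.
have -> : E k * s * x + (p - E k * s * p) - p0 = E k * s * (x - p) + (p - p0) by ring.
have tE : `|E k * s * (x - p)| = E k * s * `|x - p| by rewrite normrM ger0_norm// mulr_ge0// ltW// (lt_le_trans ltr01).
have l1 : d * E k <= E k * s * `|x - p|.
  rewrite [d * _]mulrC -mulrA ler_pM2l// -[d]mul1r; apply: ler_pM => //; exact: ltW.
have l2 : E k * s * `|x - p| <= 2 * A * E k.
  rewrite [leRHS]mulrC -mulrA ler_pM2l//; apply: ler_pM => //; clear -s1 s2 et11 z2; lra.
have := ler_normD (E k * s * (x - p)) (p - p0).
have := ler_normB (E k * s * (x - p) + (p - p0)) (p - p0); rewrite addrK.
rewrite tE => t1 t2; clear -t1 t2 l1 l2 pp0; apply/andP; split; lra.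
Qed.

End hyperbolic_covering.

(** * Composition operators with attractive fixed point [omega] *)

Section attractive_operators.
Context {R : realType}.
Variable omega : circle R.
Local Notation C := (plane R).
Local Notation nc := (@Normc.normc R).
Local Notation mu := (@arc_measure R).
Local Notation om := (\val omega : C).
Implicit Types (a b : R) (phi : C -> C).

Let om1 : nc om = 1 := normc_val omega.

Lemma circle_map_affc phi a b z : 0 < a ->
  (forall w, nc w < 1 -> phi w = adisk om a b w) -> z != omega ->
  circle_map phi z = affc omega a b z.
Proof.
move=> a0 phiE zo; rewrite /circle_map (disk_ext_adisk om1 a0 phiE) ?normc_val//.
rewrite -[in adisk _ _ _ _](to_lineK zo) val_of_line adisk_gam//.
by rewrite -val_of_line valKd.
Qed.

(** [circle_map phi] and [affc] agree off [omega]; a change at that single null point affects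
    neither measurability nor the class in L2. *)
Lemma composition_operator_affine phi a b : 0 < a ->
  (forall w, nc w < 1 -> phi w = adisk om a b w) ->
  composition_operator phi = aff_op omega a b.
Proof.
move=> a0 phiE; apply/funext => f.
have phiA z : z != omega -> f (circle_map phi z) = f (affc omega a b z).
  by move=> zo; rewrite (circle_map_affc a0 phiE zo).
have mA : cmeas (fun z => f (affc omega a b z)) by exact: cmeas_affc_L2.
have ae : {ae mu, forall z, f (circle_map phi z) = f (affc omega a b z)}.
  exists [set omega]; split; [exact: measurable_omega|exact: arc_measure_omega|].
  by move=> z /= H; apply: contrapT => /eqP zo; apply: H; exact: phiA.
have mphi : cmeas (f \o circle_map phi).
  have -> : f \o circle_map phi = fun z =>
      if z == omega then f (circle_map phi omega) else f (affc omega a b z).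
    by apply/funext => z /=; case: eqVneq => [->//|]; exact: phiA.
  apply: (cmeas_if _ (cmeas_cst _ _) mA).
  apply: (measurable_fun_bool true) => //; rewrite setTI.
  rewrite [X in measurable X](_ : _ = [set omega]); first exact: measurable_omega.
  by apply/seteqP; split => z /=; [move/eqP|move=> ->; rewrite eqxx].
have m0 := @cmeas_cst R _ (circle R) 0.
have fin : (sqd mu (f \o circle_map phi) (fun=> 0%R) < +oo)%E.
  rewrite (eq_sqd_ae mphi mA m0 m0 ae); last exact: nearW.
  apply: le_lt_trans (sqd_affc_le omega b a0 (cmeas_L2 f) m0) _.
  have := sqd_L2_fin f; rewrite -ge0_fin_numE ?sqd_ge0// => /fineK <-.
  by rewrite -EFinM ltry.
apply: L2_eq_ae; apply: filterS2 (L2class_ae mphi fin) (filterI ae (aff_op_ae omega b f a0)).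
by move=> z -> [phiz affz]; rewrite affz -phiz.
Qed.

(** The identity fixes too many points. A map with [a != 1] has a second fixed point, so it is not
    parabolic, and if [a < 1] the orbit of the center stays away from [om]. *)
Lemma attractive_affine phi : disk_automorphism phi -> attractive_fixed_point phi omega ->
  exists a b, [/\ (a = 1 /\ b != 0) \/ 1 < a, 0 < a &
    forall w, nc w < 1 -> phi w = adisk om a b w].
Proof.
move=> aphi att.
have /automorphism_fixing : disk_ext phi om = om.
  have : fixed_points phi om by case: att => [->|[[z _ ->]] _]//; left.
  by case.
move=> /(_ om1 aphi)[a [b [a0 phiE]]]; exists a, b; split => //.
have fixed_id x : a = 1 -> b = 0 -> fixed_points phi (gam om x).
  move=> a1 b0; apply/(fixed_pointsE om1 a0 phiE); right; split.
  - by rewrite normc_gam.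
  - exact: gam_neq.
  - by rewrite a1 b0 mul1r addr0.
have [a1|] := eqVneq a 1.
  left; split => //; apply/eqP => b0; have f0 := fixed_id 0 a1 b0.
  case: att => [par|[[z zo par] _]].
    by move: f0; rewrite par /= => /eqP; apply/negP; exact: gam_neq.
  have gz x : gam om x = \val z.
    have := fixed_id x a1 b0; rewrite par /= => -[/eqP|//].
    by rewrite (negPf (gam_neq om1 x)).
  have /(congr1 (cayley om)) : gam om 0 = gam om 1 by rewrite !gz.
  by rewrite !cayley_gam// => /complexI/eqP; rewrite eq_sym oner_eq0.
move=> a1; right; case: att => [par|[_ att]].
  have : fixed_points phi (gam om (b / (1 - a))).
    by rewrite (fixed_points_homothety om1 a0 phiE a1); right.
  by rewrite par /= => /eqP; rewrite (negPf (gam_neq om1 _)).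
rewrite lt_neqAle eq_sym a1 leNgt; apply/negP => /(iter_cvg_contracting om1 a0 phiE); apply.
by apply: att; apply/diskE; rewrite Normc.normc0.
Qed.

Lemma adisk_attractive a b : (a = 1 /\ b != 0) \/ 1 < a ->
  attractive_fixed_point (adisk om a b) omega.
Proof.
move=> [[a1 b0]|a1].
  left; apply: (@fixed_points_translation _ om om1 _ a b) => //.
  by rewrite a1.
have a0 : 0 < a by apply: lt_trans a1.
right; split; last first.
  by move=> z /diskE z1; apply: (@iter_cvg_expanding _ om om1 _ a b).
exists (of_line omega (b / (1 - a))); first exact: of_line_neq.
rewrite val_of_line; apply: (@fixed_points_homothety _ om om1 _ a b) => //.
by rewrite gt_eqF.
Qed.

(** Both directions matter: if some affine operator did not come from an automorphism, the common
    set could be larger than the [Gdelta] set built from all parameters. *)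
Lemma attractive_operatorsE (T : L2 R -> L2 R) :
  (exists2 phi, disk_automorphism phi /\ attractive_fixed_point phi omega &
    composition_operator phi = T) <->
  exists a b, ((a = 1 /\ b != 0) \/ 1 < a) /\ T = aff_op omega a b.
Proof.
split=> [[phi [aphi att] <-]|[a [b [ab ->]]]].
  have [a [b [ab a0 phiE]]] := attractive_affine aphi att.
  by exists a, b; split => //; exact: composition_operator_affine.
have a0 : 0 < a by case: ab => [[->]|/(lt_trans _)->].
exists (adisk om a b); last exact: composition_operator_affine.
split; last exact: adisk_attractive.
exact: adisk_automorphism.
Qed.

Lemma iter_translation b n f : iter n (aff_op omega 1 b) f = aff_op omega 1 (n%:R * b) f.
Proof.
elim: n => [|n IH]; first by rewrite /= mul0r aff_op_id.
rewrite iterS IH (aff_op_comp omega _ _ _ ltr01 ltr01).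
by have -> : 1 * b + n%:R * b = n.+1%:R * b; [rewrite -natr1; ring|rewrite mulr1].
Qed.

Lemma iter_dilation a b n f : 0 < a -> a != 1 ->
  let p := b / (1 - a) in
  iter n (aff_op omega a b) f = aff_op omega (a ^+ n) (p - a ^+ n * p) f.
Proof.
move=> a0 a1 p; have a10 : 1 - a != 0 by rewrite subr_eq0 eq_sym.
elim: n => [|n IH]; first by rewrite /= expr0 mul1r subrr aff_op_id.
have bE : a ^+ n * b + (p - a ^+ n * p) = p - a ^+ n.+1 * p.
  have -> : b = p * (1 - a) by rewrite /p divfK.
  by rewrite exprSr; ring.
by rewrite iterS IH aff_op_comp ?exprn_gt0// -exprSr bE.
Qed.

End attractive_operators.

(** * Openness of the target sets *)

Section targets.
Context {R : realType}.
Variable omega : circle R.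
Local Notation mu := (@arc_measure R).

(** The order [n] varies with [la]; the one found at [la0] still serves for all [la] and [h] near
    [la0] and [h0]. *)
Lemma open_targets (L : topologicalType) (K : set L) (A B : nat -> L -> R) g e :
  compact K -> (forall n, continuous (A n)) -> (forall n, continuous (B n)) ->
  (forall n la, 0 < A n la) ->
  open [set h | forall la, K la ->
    exists2 n, (0 < n)%N & L2dist (aff_op omega (A n la) (B n la) h) g < e].
Proof.
move=> /compact_near_coveringP cK cA cB A0; rewrite openE => h0 Hh0.
have := cK _ (nbhs h0) (fun h la => exists2 n, (0 < n)%N &
  L2dist (aff_op omega (A n la) (B n la) h) g < e) _; apply => la0 Kla0.
have [n n0 Hn] := Hh0 la0 Kla0.
have r0 : 0 < e - L2dist (aff_op omega (A n la0) (B n la0) h0) g by rewrite subr_gt0.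
have [d d0 Hd] := aff_op_continuous omega (B n la0) h0 (A0 n la0) r0.
near=> la h; exists n; first exact: n0.
have [||| _ near_h] := Hd (A n la) (B n la) h.
- near: la; rewrite -nbhs_nearE; move/cvgrPdist_lt: (cA n la0) => /(_ _ d0).
  by apply: filterS => x; rewrite distrC.
- near: la; move/cvgrPdist_lt: (cB n la0) => /(_ _ d0).
  by apply: filterS => x; rewrite distrC.
- near: h; apply: (open_nbhs_nbhs (conj (@open_dist_ball R (L2 R) h0 d) _)).
  by rewrite /= mdistxx.
apply: le_lt_trans (L2dist_triangle (aff_op omega (A n la0) (B n la0) h0) _ _) _.
by rewrite -ltrBrDr.
Unshelve. all: by end_near. Qed.

Lemma dense_step (f : L2 R) e : 0 < e -> exists s,
  L2dist f (L2class (fun z => step s (to_line omega z))) < e.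
Proof.
move=> e0; have e20 : 0 < e ^+ 2 by rewrite exprn_gt0.
have [s Hs] := @step_approx_L2 R omega f (cmeas_L2 f) (sqd_L2_fin f) _ e20.
exists s; rewrite L2dist_lt//; have [ms fs] := @step_aff_op R omega s.
rewrite (@eq_sqd_ae R _ _ mu f f _ (fun z => step s (to_line omega z)))//.
- exact: cmeas_L2.
- exact: cmeas_L2.
- exact: cmeas_L2.
- exact: nearW.
- exact: L2class_ae.
Qed.

End targets.

Lemma residual_countable {R : realType} (T : countType) (O : T -> set (L2 R)) :
  (forall i, open (O i) /\ dense (O i)) -> residual (\bigcap_i O i).
Proof.
move=> odO; pose U k := if unpickle k is Some i then O i else setT.
have odU k : open (U k) /\ dense (U k).
  rewrite /U; case: unpickle => [i|]; first exact: odO.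
  by split; [exact: openT|move=> V V0 _; rewrite setIT].
have -> : \bigcap_i O i = \bigcap_k U k.
  apply/seteqP; split => h Hh; first by move=> k _; rewrite /U; case: unpickle => // i; exact: Hh.
  by move=> i _; have := Hh (pickle i) I; rewrite /U pickleK.
by split; [exact: L2_baire|exists U => // k; case: (odU k)].
Qed.

Lemma invS_small {R : realType} (x : R) : 0 < x -> exists m : nat, (m.+1%:R^-1 : R) < x.
Proof.
move=> x0; exists (Num.truncn x^-1).
by rewrite -[ltRHS]invrK ltf_pV2 ?posrE ?invr_gt0// truncnS_gt.
Qed.

Lemma pos_itv_exhaust {R : realType} (x : R) : 0 < x ->
  exists M, forall m : nat, (M <= m)%N -> x \in `[(m.+1%:R^-1 : R), m.+1%:R].
Proof.
move=> x0; have [k xk] := invS_small x0.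
exists (maxn k (Num.truncn x)) => m; rewrite geq_max => /andP[km xm].
rewrite in_itv /=; apply/andP; split.
  apply: le_trans (ltW xk); rewrite lef_pV2 ?posrE// ler_nat ltnS//.
by apply: le_trans (ltW (truncnS_gt x)) _; rewrite ler_nat ltnS.
Qed.

(** * The common hypercyclic vectors as a countable intersection *)

Section common_vectors.
Context {R : realType}.
Variable omega : circle R.
Local Notation target s := (L2class (fun z => step s (to_line omega z)) : L2 R).

(** Countably many targets and radii test the density of an orbit, which keeps the final
    intersection countable. *)
Lemma hypercyclic_targets (T : L2 R -> L2 R) h : hypercyclic T h <->
  forall s (j : nat), exists2 n, (0 < n)%N & L2dist (iter n T h) (target s) < j.+1%:R^-1.
Proof.
rewrite /hypercyclic dense_distP; split=> [H s j|H f e e0].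
  have j0 : 0 < j.+1%:R^-1 :> R by rewrite invr_gt0.
  have [_ [n /= n0 <-] nt] := H (target s) _ j0.
  by exists n => //; rewrite L2distC.
have e20 : 0 < e / 2 by rewrite divr_gt0.
have [s fs] := dense_step omega f e20; have [j je] := invS_small e20.
have [n n0 nt] := H s j; exists (iter n T h); first by exists n.
apply: le_lt_trans (L2dist_triangle (target s) _ _) _; rewrite [ltRHS]splitr ltrD//.
by rewrite L2distC (lt_trans nt).
Qed.

Lemma common_hypercyclic_residual (F : set (L2 R -> L2 R)) :
  (forall T, F T <-> exists a b, ((a = 1 /\ b != 0) \/ 1 < a) /\ T = aff_op omega a b) ->
  residual (common_hypercyclic F).
Proof.
move=> FE.
have inv0 (j : nat) : 0 < j.+1%:R^-1 :> R by rewrite invr_gt0.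
have /choice[eta Heta] (sj : seq (rat * rat * rat) * nat) : exists eta : R, 0 < eta /\
    forall (L : Type) (K : set L) (A B : nat -> L -> R),
    (forall n la, K la -> 0 < A n la) -> covering omega eta K A B ->
    forall f r, 0 < r -> exists2 h, L2dist f h < r & forall la, K la ->
    exists2 n, (0 < n)%N & L2dist (aff_op omega (A n la) (B n la) h) (target sj.1) < sj.2.+1%:R^-1.
  by have [eta ? ?] := covering_dense omega (target sj.1) (inv0 sj.2); exists eta.
pose tgt (L : Type) (K : set L) (A B : nat -> L -> R) s (j : nat) : set (L2 R) :=
  [set h | forall la, K la -> exists2 n, (0 < n)%N &
    L2dist (aff_op omega (A n la) (B n la) h) (target s) < j.+1%:R^-1].
(* These segments exhaust the positive reals: values of [|b|] for translations, of [ln a] for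
   dilations. *)
pose Kt (m : nat) : set R := `[m.+1%:R^-1, m.+1%:R]%classic.
(* The half-width is the one allowed by [covering_dilations]. As [eta] depends on the target only,
   the boxes with rational [q] reach every fixed point. *)
pose Kd (e : R) m (q : rat) : set (R * R) := Kt m `*` `[ratr q - e / 4, ratr q + e / 4]%classic.
pose Bt (sg : bool) n (be : R) : R := (-1) ^+ sg * (n%:R * be).
pose Ad n (la : R * R) : R := expR (n%:R * la.1).
pose Bd n (la : R * R) : R := la.2 - Ad n la * la.2.
pose O (i : seq (rat * rat * rat) * nat * nat * (bool + rat)) : set (L2 R) :=
  let: (s, j, m, k) := i in match k with
  | inl sg => @tgt R (Kt m) (fun _ _ => 1) (Bt sg) s j
  | inr q => @tgt (R * R)%type (Kd (eta (s, j)) m q) Ad Bd s j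
  end.
have tgt_dense (L : Type) (K : set L) A B s j : (forall n la, 0 < A n la) ->
    covering omega (eta (s, j)) K A B -> dense (tgt L K A B s j).
  move=> A0 cov; apply/dense_distP => f r r0; have [_ H] := Heta (s, j).
  have [|h fh Hh] := H L K A B _ cov f r r0; first by move=> n la _; exact: A0.
  by exists h.
have cAd n : continuous (Ad n).
  move=> la; apply: continuous_comp; last exact: continuous_expR.
  by apply: cvgM; [exact: cvg_cst|exact: cvg_fst].
have cBd n : continuous (Bd n).
  move=> la; apply: cvgB; first exact: cvg_snd.
  by apply: cvgM; [exact: cAd|exact: cvg_snd].
have cBt sg n : continuous (Bt sg n).
  by move=> be; apply: cvgM; [exact: cvg_cst|apply: cvgM; [exact: cvg_cst|exact: cvg_id]].
have odO i : open (O i) /\ dense (O i).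
  case: i => [[[s j] m] [sg|q]]; split.
  - apply: open_targets => //; first exact: segment_compact.
    by move=> n; exact: cst_continuous.
  - apply: tgt_dense => //; apply: covering_translations => //; last by case: (Heta (s, j)).
    by rewrite normr_sign.
  - apply: open_targets => //; last by move=> n la; exact: expR_gt0.
    by apply: compact_setX; exact: segment_compact.
  - apply: tgt_dense; first by move=> n la; exact: expR_gt0.
    by apply: covering_dilations => //; case: (Heta (s, j)).
suff -> : common_hypercyclic F = \bigcap_i O i by exact: residual_countable.
apply/seteqP; split => h Hh.
  move=> [[[s j] m] [sg|q]] _ /=.
    move=> be; rewrite /Kt /= in_itv /= => /andP[be0 _].
    have b0 : 0 < be by exact: lt_le_trans be0.
    have FT : F (aff_op omega 1 ((-1) ^+ sg * be)).
      apply/FE; exists 1, ((-1) ^+ sg * be); split => //; left; split => //.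
      by rewrite mulf_neq0 ?signr_eq0 ?gt_eqF.
    have [n n0] := (hypercyclic_targets _ _).1 (Hh _ FT) s j.
    by rewrite iter_translation mulrCA; exists n.
  move=> [al p] [/=]; rewrite /Kt /= in_itv /= => /andP[al0 _] _.
  have a0 : 0 < al by exact: lt_le_trans al0.
  have e1 : 1 < expR al by rewrite -expR0 ltr_expR.
  (* The dilation of ratio [expR al] with fixed point [p]. *)
  have FT : F (aff_op omega (expR al) ((1 - expR al) * p)).
    by apply/FE; exists (expR al), ((1 - expR al) * p); split => //; right.
  have [n n0] := (hypercyclic_targets _ _).1 (Hh _ FT) s j.
  rewrite iter_dilation ?expR_gt0 ?gt_eqF//.
  have -> : (1 - expR al) * p / (1 - expR al) = p.
    by rewrite mulrAC divff ?mul1r// subr_eq0 lt_eqF.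
  by rewrite -expRM_natl => H; exists n.
move=> T /FE[a [b [ab ->]]]; apply/hypercyclic_targets => s j.
case: ab => [[-> b0]|a1].
  (* The boolean [b < 0] selects the family of translations in the direction of [b]. *)
  have bE : b = (-1) ^+ (b < 0)%R * `|b| by rewrite -numEsign.
  have [M HM] : exists M, forall m : nat, (M <= m)%N -> `|b| \in `[m.+1%:R^-1, m.+1%:R].
    by apply: pos_itv_exhaust; rewrite normr_gt0.
  have [n n0 Hn] := Hh (s, j, M, inl (b < 0)) I `|b| (HM M (leqnn M)).
  by exists n => //; rewrite iter_translation bE mulrCA.
have a0 : 0 < a by apply: lt_trans a1.
pose p := b / (1 - a); have e40 : 0 < eta (s, j) / 4 by rewrite divr_gt0//; case: (Heta (s, j)).
have [q pq] := rat_near p e40.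
have [M HM] := pos_itv_exhaust (ln_gt0 a1).
have [|n n0 Hn] := Hh (s, j, M, inr q) I (ln a, p).
  split; first exact: HM.
  by rewrite /= in_itv /= -ler_distlC distrC ltW.
have a11 : a != 1 by rewrite gt_eqF.
exists n; [exact: n0|rewrite (iter_dilation omega b n h a0 a11)].
by move: Hn; rewrite /Bd /Ad /= expRM_natl lnK ?posrE.
Qed.

End common_vectors.

Theorem theorem8 (R : realType) (omega : circle R) :
  let F := [set composition_operator phi | phi in
    [set phi | disk_automorphism phi /\ attractive_fixed_point phi omega]] in
  common_hypercyclic F !=set0 /\ residual (common_hypercyclic F).
Proof.
move=> F; have resF : residual (common_hypercyclic F).
  by apply: (@common_hypercyclic_residual R omega) => T; exact: attractive_operatorsE.
split => //; have [dF _] := resF.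
have [|h [_ Fh]] := dF setT _ openT; first by exists point.
by exists h.
Qed.
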